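(* Let $a,b>0$ and let $R$ be the rectangle with side lengths $a,b$. Let $N_N(t)$ and $N_D(t)$ be the eigenvalue counting functions of $-\Delta$ on $R$ with Neumann, respectively Dirichlet, boundary conditions on all of $\partial R$. Put $$\widetilde N_N(t)=\frac{ab}{4\pi}t+\frac{2a+2b}{4\pi}t^{1/2}+\frac14,\qquad \widetilde N_D(t)=\frac{ab}{4\pi}t-\frac{2a+2b}{4\pi}t^{1/2}+\frac14,$$ and $$A_N(t)=\frac1t\int_0^t\big(N_N(s)-\widetilde N_N(s)\big)\,ds,\qquad A_D(t)=\frac1t\int_0^t\big(N_D(s)-\widetilde N_D(s)\big)\,ds .$$ Then there is an almost periodic function $g$ of mean value zero such that both $A=A_N$ and $A=A_D$ satisfy $$A(t)=g(t^{1/2})\,t^{-1/4}+O(t^{-1/2})\qquad\text{as } t\to\infty .$$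
   Context: The eigenvalue counting function of an operator with discrete spectrum $0\le\lambda_1\le\lambda_2\le\cdots\to\infty$ (repeated according to multiplicity) is $N(t)=\#\{j:\lambda_j\le t\}$. Almost periodic means uniformly almost periodic (in the sense of Bohr): a function $g:\mathbb R\to\mathbb R$ that is a uniform limit on $\mathbb R$ of trigonometric polynomials (finite linear combinations of $x\mapsto e^{i\gamma x}$, $\gamma\in\mathbb R$). Its mean value is $\lim_{L\to\infty}\frac1L\int_0^L g(x)\,dx$. *)

(* Defs.v *)
From HB Require Import structures.
From mathcomp Require Import all_boot all_order all_algebra finmap.
From mathcomp Require Import all_classical all_reals all_analysis.
From mathcomp Require Import complex.

Set Implicit Arguments.
Unset Strict Implicit.
Unset Printing Implicit Defensive.
Import Order.TTheory GRing.Theory Num.Theory.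
Import numFieldNormedType.Exports.
Local Open Scope classical_set_scope.
Local Open Scope ring_scope.

Definition closed_rect (R : realType) (a b : R) : set (R * R) :=
  [set p | 0 <= p.1 <= a /\ 0 <= p.2 <= b].

Definition open_rect (R : realType) (a b : R) : set (R * R) :=
  [set p | 0 < p.1 < a /\ 0 < p.2 < b].

(* Functions on the closed rectangle are represented by functions on the whole
   plane whose values off the rectangle are irrelevant. Here [u] is C^1 up to
   the boundary: [ux] and [uy] are its partial derivatives in the interior,
   extended continuously to the closed rectangle, so that on a side they give
   the one-sided partial derivatives of [u]. *)
Definition C1_closed_rect (R : realType) (a b : R) (u ux uy : R * R -> R) :=
  [/\ {within closed_rect a b, continuous u},
      {within closed_rect a b, continuous ux},
      {within closed_rect a b, continuous uy} &
      forall p, open_rect a b p ->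
        is_derive p ((1, 0) : R * R) u (ux p) /\
        is_derive p ((0, 1) : R * R) u (uy p)].

Inductive boundary_condition := Neumann | Dirichlet.

(* For Neumann, the normal derivative on the sides x = 0 and x = a is
   [- ux] and [ux], and on the sides y = 0 and y = b it is [- uy] and [uy]. *)
Definition satisfies_bc (R : realType) (bc : boundary_condition) (a b : R)
    (u ux uy : R * R -> R) : Prop :=
  match bc with
  | Neumann => forall p, closed_rect a b p ->
      (p.1 = 0 \/ p.1 = a -> ux p = 0) /\ (p.2 = 0 \/ p.2 = b -> uy p = 0)
  | Dirichlet => forall p, closed_rect a b p ->
      p.1 = 0 \/ p.1 = a \/ p.2 = 0 \/ p.2 = b -> u p = 0
  end.

(* The real solutions, C^2 up to the boundary, of - Delta u = mu u with the
   given boundary condition; 0 is included. *)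
Definition eigenspace_rect (R : realType) (bc : boundary_condition) (a b mu : R)
    : set (R * R -> R) :=
  [set u | exists ux uy uxx uxy uyx uyy : R * R -> R,
    [/\ C1_closed_rect a b u ux uy,
        C1_closed_rect a b ux uxx uxy,
        C1_closed_rect a b uy uyx uyy,
        forall p, open_rect a b p -> - (uxx p + uyy p) = mu * u p &
        satisfies_bc bc a b u ux uy]].

(* [E] has dimension [d] as a space of functions on [D], i.e. after identifying
   functions that agree on [D]. *)
Definition has_dim_on (R : realType) (T : Type) (D : set T) (E : set (T -> R))
    (d : nat) : Prop :=
  exists e : 'I_d -> T -> R,
    [/\ forall i, E (e i),
        forall c : 'I_d -> R,
          (forall p, D p -> \sum_(i < d) c i * e i p = 0) -> forall i, c i = 0 &
        forall u, E u -> exists c : 'I_d -> R,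
          forall p, D p -> u p = \sum_(i < d) c i * e i p].

(* [lam 0 <= lam 1 <= ...] lists the eigenvalues, each repeated according to its
   multiplicity (the dimension of its eigenspace, 0 for a non-eigenvalue). *)
Definition is_spectrum (R : realType) (bc : boundary_condition) (a b : R)
    (lam : nat -> R) : Prop :=
  [/\ nondecreasing_seq lam,
      lam n @[n --> \oo] --> +oo &
      forall mu : R, exists d : nat,
        has_dim_on (closed_rect a b) (eigenspace_rect bc a b mu) d /\
        ([set j | lam j = mu] #= `I_d)%card].

(* These conditions determine [lam], so the choice made by [xget] is immaterial;
   its default value is used only if no such sequence exists. *)
Definition spectrum (R : realType) (bc : boundary_condition) (a b : R)
    : nat -> R :=
  xget (fun=> 0) [set lam | is_spectrum bc a b lam].

Definition eigenvalue_count (R : realType) (bc : boundary_condition) (a b t : R)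
    : nat :=
  #|` fset_set [set j | spectrum bc a b j <= t] |.

Definition refined_asymptotics (R : realType) (bc : boundary_condition)
    (a b t : R) : R :=
  match bc with
  | Neumann => a * b / (4 * pi) * t + (2 * a + 2 * b) / (4 * pi) * Num.sqrt t + 4^-1
  | Dirichlet => a * b / (4 * pi) * t - (2 * a + 2 * b) / (4 * pi) * Num.sqrt t + 4^-1
  end.

Definition average_error (R : realType) (bc : boundary_condition) (a b t : R)
    : R :=
  t^-1 * \int[lebesgue_measure]_(s in `[0, t])
    ((eigenvalue_count bc a b s)%:R - refined_asymptotics bc a b s).

Definition expi (R : realType) (x : R) : R[i] := Complex (cos x) (sin x).

Definition trig_poly (R : realType) (P : R -> R[i]) : Prop :=
  exists (n : nat) (c : 'I_n -> R[i]) (gamma : 'I_n -> R),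
    forall x, P x = \sum_(k < n) c k * expi (gamma k * x).

Definition almost_periodic (R : realType) (g : R -> R) : Prop :=
  forall eps : R, 0 < eps -> exists P : R -> R[i],
    trig_poly P /\ forall x, `|(g x)%:C%C - P x| < eps%:C%C.

Definition has_mean_value (R : realType) (g : R -> R) (m : R) : Prop :=
  (L^-1 * \int[lebesgue_measure]_(x in `[0, L]) g x) @[L --> +oo] --> m.

(* Main.v *)
(* Put x = sqrt t, p = pi / a, q = pi / b. The products of the cosines (Neumann) or sines
   (Dirichlet) of frequencies p m and q n are eigenfunctions, with eigenvalue
   (p m)^2 + (q n)^2. They form a complete orthogonal system, and by Green's formula an
   eigenfunction is orthogonal to all those with another eigenvalue, so they span the
   eigenspaces and N(t) counts lattice points in a quarter of an ellipse.
   Integrating the count over [0, t] gives the sum over the quadrant of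
   (x^2 - (p m)^2 - (q n)^2)_+, with m, n >= 0 or m, n >= 1. Four times this is the sum over the
   full lattice, plus (Neumann) or minus (Dirichlet) the sums over the two axes, plus x^2. The
   axis sums are known up to O(x) by Poisson summation and produce the perimeter term, so the
   full lattice sum gives the same g for both boundary conditions.
   For the full lattice, two one-dimensional Poisson summations turn the sum into one of the
   Fourier transforms F of (x^2 - |v|^2)_+ at the dual lattice points, of norm r. As a
   function of x, x^(-3/2) F solves a perturbed harmonic oscillator equation, so that
   F = x^(3/2) (c cos (r x) + s sin (r x)) + O(r^(-7/2) x^(1/2)) with c, s = O(r^(-5/2)). These
   amplitudes are summable over a planar lattice, hence the sum g of the trigonometric terms is
   almost periodic, with mean 0 because r > 0. *)
Require Import Defs.
From mathcomp Require Import all_boot all_order all_algebra finmap complex.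
From mathcomp Require Import all_classical all_reals all_analysis measurable_realfun.
From mathcomp Require Import zify ring lra.
Set Implicit Arguments.
Unset Strict Implicit.
Unset Printing Implicit Defensive.
Import Order.TTheory GRing.Theory Num.Theory.
Import numFieldNormedType.Exports.
Local Open Scope classical_set_scope.
Local Open Scope ring_scope.

(** * Integrals over intervals *)

(** Averaging is what makes everything converge absolutely: the transform of the indicator of a disc
    decays only like r^(-3/2), which is not summable over a planar lattice, whereas the exponent 5/2
    of the paraboloid exceeds 2. In closed form F is 4 pi (x / r)^2 J_2(r x), and the oscillator is
    Bessel's equation of order 2 in normal form. Only this equation is used, with data at r x = 1
    bounded independently of the frequency, so the constants are uniform over the lattice. Off the
    origin r^2 is at least a constant times (k + 1) (l + 1), so r^(-5/2) is dominated by a product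
    of two one-dimensional weights, and every double series reduces to a single convergent series.
    Poisson summation rests on completeness rather than on pointwise convergence theory: a
    continuous function with absolutely summable cosine coefficients equals its cosine series. The
    same completeness theorem serves the eigenfunctions. After division by t = x^2, the remainder
    t^(-1/2) stems from the axis sums alone; the full lattice leaves only O(x^(1/2)) before the
    division. *)

Definition RI (R : realType) (a b : R) (f : R -> R) : R :=
  \int[lebesgue_measure]_(x in `[a, b]) f x.

Section RI.
Variable R : realType.
Implicit Types (a b c x y : R) (f g : R -> R).

Lemma within_itv_integrable a b f : {within `[a, b], continuous f} ->
  (@lebesgue_measure R).-integrable `[a, b] (EFin \o f).
Proof. by move=> cf; apply: continuous_compact_integrable => //; exact: segment_compact. Qed.

Lemma eq_RI a b f g : (forall x, a <= x <= b -> f x = g x) -> RI a b f = RI a b g.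
Proof. by move=> fg; apply: eq_Rintegral => x; rewrite inE/= in_itv/=; exact: fg. Qed.

Lemma RI_cst a b k : a <= b -> RI a b (fun=> k) = k * (b - a).
Proof.
move=> ab; rewrite /RI Rintegral_cst//= lebesgue_measure_itv/= lte_fin.
have [//|ba] := ltP a b; have -> : a = b by apply/eqP; rewrite eq_le ab ba.
by rewrite subrr.
Qed.

Lemma RI_bound a b f M : a <= b -> {within `[a, b], continuous f} ->
  (forall x, a <= x <= b -> `|f x| <= M) -> `|RI a b f| <= M * (b - a).
Proof.
move=> ab cf fM; apply: (le_trans (le_normr_Rintegral _ _)) => //.
  exact: within_itv_integrable.
rewrite -RI_cst//.
apply: le_Rintegral => //.
- apply: within_itv_integrable.
  move=> x; apply: continuous_comp; first exact: cf.
  exact: norm_continuous.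
- by apply: within_itv_integrable; apply: continuous_subspaceT => x; exact: cvg_cst.
Qed.

Lemma RID a b f g : {within `[a, b], continuous f} -> {within `[a, b], continuous g} ->
  RI a b (fun x => f x + g x) = RI a b f + RI a b g.
Proof. by move=> cf cg; apply: RintegralD => //; exact: within_itv_integrable. Qed.

Lemma RIB a b f g : {within `[a, b], continuous f} -> {within `[a, b], continuous g} ->
  RI a b (fun x => f x - g x) = RI a b f - RI a b g.
Proof. by move=> cf cg; apply: RintegralB => //; exact: within_itv_integrable. Qed.

Lemma RIZ a b f k : {within `[a, b], continuous f} ->
  RI a b (fun x => k * f x) = k * RI a b f.
Proof. by move=> cf; apply: RintegralZl => //; exact: within_itv_integrable. Qed.

Lemma RI_FTC a b f F : a < b -> {within `[a, b], continuous f} ->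
  {within `[a, b], continuous F} ->
  (forall x, a < x < b -> is_derive x 1 F (f x)) -> RI a b f = F b - F a.
Proof.
move=> ab cf cF dF; rewrite /RI /Rintegral (@continuous_FTC2 _ f F)//.
- have [_ cFa cFb] := (continuous_within_itvP F ab).1 cF.
  split => // x; rewrite in_itv/= => /dF dFx; exact: ex_derive.
- by move=> x; rewrite in_itv/= => /dF dFx; rewrite derive1E derive_val.
Qed.

Lemma RI0 a b : RI a b (fun=> 0) = 0.
Proof. by rewrite /RI /Rintegral integral0. Qed.

Lemma RI_id a f : RI a a f = 0.
Proof. by rewrite /RI set_itv1 Rintegral_set1. Qed.

Lemma RI_sum (I : Type) (r : seq I) (P : pred I) (F : I -> R -> R) a b :
  (forall i, {within `[a, b], continuous (F i)}) ->
  RI a b (fun x => \sum_(i <- r | P i) F i x) = \sum_(i <- r | P i) RI a b (F i).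
Proof.
move=> cF.
suff : {within `[a, b], continuous (fun x => \sum_(i <- r | P i) F i x)} /\
  RI a b (fun x => \sum_(i <- r | P i) F i x) = \sum_(i <- r | P i) RI a b (F i) by case.
elim: r => [|i r [IH1 IH2]].
  rewrite big_nil (_ : (fun x => _) = fun=> 0).
    by split; [apply: continuous_subspaceT => x; exact: cvg_cst|exact: RI0].
  by apply/funext => x; rewrite big_nil.
rewrite big_cons; case: ifPn => Pi.
  rewrite (_ : (fun x => _) = fun x => F i x + \sum_(j <- r | P j) F j x).
    rewrite -IH2 -RID//; split => //.
    by move=> x; apply: continuousD; [exact: cF|exact: IH1].
  by apply/funext => x; rewrite big_cons Pi.
rewrite (_ : (fun x => _) = fun x => \sum_(j <- r | P j) F j x)//.
by apply/funext => x; rewrite big_cons (negPf Pi).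
Qed.

Lemma RI_split c a b f : a <= c -> c <= b -> {within `[a, b], continuous f} ->
  RI a b f = RI a c f + RI c b f.
Proof.
move=> ac cb cf; apply/eqP; rewrite addrC -subr_eq; apply/eqP.
rewrite /RI Rintegral_itvB ?bnd_simp//; last exact: within_itv_integrable.
rewrite Rintegral_itv_obnd_cbnd//.
apply: (integrableS _ _ _ (within_itv_integrable cf)) => //.
by apply: subset_itv; rewrite bnd_simp.
Qed.

Lemma le_RI a b f g : {within `[a, b], continuous f} -> {within `[a, b], continuous g} ->
  (forall x, a <= x <= b -> f x <= g x) -> RI a b f <= RI a b g.
Proof.
by move=> cf cg fg; apply: le_Rintegral => //; try exact: within_itv_integrable;
  move=> x; rewrite /= in_itv; exact: fg.
Qed.

Lemma continuousW a b f : continuous f -> {within `[a, b], continuous f}.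
Proof. exact: continuous_subspaceT. Qed.

Lemma rect_bound (f : R -> R -> R) a b c d : continuous (fun p : R * R => f p.1 p.2) ->
  exists2 M : R, 0 < M & forall x y, a <= x <= b -> c <= y <= d -> `|f x y| <= M.
Proof.
move=> cf.
have [ab|ba] := leP a b; last first.
  by exists 1 => // x y /andP[ax xb]; have := le_trans ax xb; rewrite leNgt ba.
have [cd|dc] := leP c d; last first.
  by exists 1 => // x y _ /andP[ax xb]; have := le_trans ax xb; rewrite leNgt dc.
have [] := @compact_EVT_max _ R (fun p : R * R => `|f p.1 p.2|) (`[a, b] `*` `[c, d]).
- by exists (a, c); split; rewrite /= in_itv/= lexx.
- by apply: compact_setX; exact: segment_compact.
- apply: continuous_subspaceT => x; apply: continuous_comp; first exact: cf.
  exact: norm_continuous.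
move=> p _ H; exists (`|f p.1 p.2| + 1); first by rewrite ltr_wpDl.
move=> x y xab ycd; rewrite (le_trans (H (x, y) _)) ?lerDl//.
by rewrite inE; split; rewrite /= in_itv.
Qed.

Lemma continuous_pairT (T U V : topologicalType) (f : T -> U) (g : T -> V) :
  continuous f -> continuous g -> continuous (fun z => (f z, g z)).
Proof. by move=> cf cg z; apply: (cvg_pair (cf z) (cg z)). Qed.

Lemma continuous_comp2 (T : topologicalType) (f : R -> R -> R) (u v : T -> R) :
  continuous (fun p : R * R => f p.1 p.2) -> continuous u -> continuous v ->
  continuous (fun z => f (u z) (v z)).
Proof.
move=> cf cu cv z.
exact: (@cvg_comp _ _ _ (fun z => (u z, v z)) (fun p : R * R => f p.1 p.2) _ _ _
  (@continuous_pairT _ _ _ _ _ cu cv z) (cf (u z, v z))).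
Qed.

Lemma continuous_xsec (f : R -> R -> R) x : continuous (fun p : R * R => f p.1 p.2) ->
  continuous (f x).
Proof. by move=> cf; apply: continuous_comp2 cf _ _ => y; [exact: cvg_cst|exact: cvg_id]. Qed.

Lemma continuous_ysec (f : R -> R -> R) y : continuous (fun p : R * R => f p.1 p.2) ->
  continuous (f ^~ y).
Proof. by move=> cf; apply: continuous_comp2 cf _ _ => x; [exact: cvg_id|exact: cvg_cst]. Qed.

Lemma continuous_RI_param (f : R -> R -> R) a b : continuous (fun p : R * R => f p.1 p.2) ->
  continuous (fun x => RI a b (f x)).
Proof.
move=> cf x.
have [M M0 fM] := rect_bound (x - 1) (x + 1) a b cf.
have I1 (z : R) : (@lebesgue_measure R).-integrable `[a, b] (EFin \o f z).
  by apply: within_itv_integrable; apply: continuousW; exact: continuous_xsec.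
have I2 : (@lebesgue_measure R).-integrable `[a, b] (EFin \o (fun=> M)).
  by apply: within_itv_integrable; apply: continuousW => z; exact: cvg_cst.
have mD : measurable (`[a, b]%classic : set R) by [].
have I3 : x \in `]x - 1, x + 1[%classic.
  by rewrite inE /= in_itv/=; apply/andP; split; lra.
apply: (@continuity_under_integral R _ _ lebesgue_measure f `[a, b] mD (x - 1) (x + 1)
  (fun z _ => I1 z) _ (fun=> M) I2 _ x I3).
- by apply/aeW => y _ z _; exact: continuous_ysec.
- move=> z; rewrite /= in_itv/= => /andP[z1 z2]; apply/aeW => y; rewrite /= in_itv/=; apply: fM.
  by rewrite !ltW.
Qed.

(** Local in the parameter, because [RI_Fubini] applies it to an integral with variable endpoint,
    which is differentiable only to the right of its base point. *)
Lemma is_derive_RI_param_loc (f df : R -> R -> R) a b u v M :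
  (forall z, u < z < v -> {within `[a, b], continuous (f z)}) ->
  (forall z y, u < z < v -> a <= y <= b -> is_derive z 1 (f ^~ y) (df z y)) ->
  (forall z y, u < z < v -> a <= y <= b -> `|df z y| <= M) ->
  forall x, u < x < v -> is_derive x 1 (fun x => RI a b (f x)) (RI a b (df x)).
Proof.
move=> cf dfE dfM x xuv.
have E y : y \in `[a, b]%classic -> partial1of2 f x y = df x y.
  by rewrite inE/= in_itv/= => yab; have D := dfE x y xuv yab; rewrite partial1of2E derive_val.
have I1 z : `]u, v[%classic z -> (@lebesgue_measure R).-integrable `[a, b] (EFin \o f z).
  by rewrite /= in_itv/= => zuv; apply: within_itv_integrable; exact: cf.
have I2 : (@lebesgue_measure R).-integrable `[a, b] (EFin \o (fun=> `|M|)).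
  by apply: within_itv_integrable; apply: continuousW => z; exact: cvg_cst.
have I3 : `]u, v[%classic x by rewrite /= in_itv.
have I4 z y : `]u, v[%classic z -> `[a, b]%classic y -> derivable (f^~ y) z 1.
  by rewrite /= !in_itv/= => zuv yab; have D := dfE z y zuv yab; exact: ex_derive.
have I5 z y : `]u, v[%classic z -> `[a, b]%classic y -> `|partial1of2 f z y| <= `|M|.
  rewrite /= !in_itv/= => zuv yab; have D := dfE z y zuv yab.
  by rewrite partial1of2E derive_val (le_trans (dfM _ _ zuv yab))// ler_norm.
have mD : measurable (`[a, b]%classic : set R) by [].
have M0' : forall y : R, 0 <= (fun=> `|M|) y by move=> _.
have H1 := @differentiation_under_integral R _ _ lebesgue_measure f `[a, b] mD x u v I3
  I1 I4 (fun=> `|M|) M0' I2 I5.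
have H2 := @derivable_under_integral R _ _ lebesgue_measure f `[a, b] mD x u v I3
  I1 I4 (fun=> `|M|) M0' I2 I5.
by apply: DeriveDef => //; rewrite -derive1E H1; apply: eq_Rintegral => y; exact: E.
Qed.

Lemma is_derive_RI_param (f df : R -> R -> R) a b : continuous (fun p : R * R => f p.1 p.2) ->
  continuous (fun p : R * R => df p.1 p.2) ->
  (forall x y, a <= y <= b -> is_derive x 1 (f ^~ y) (df x y)) ->
  forall x, is_derive x 1 (fun x => RI a b (f x)) (RI a b (df x)).
Proof.
move=> cf cdf dfE x.
have [M M0 fM] := rect_bound (x - 1) (x + 1) a b cdf.
apply: (@is_derive_RI_param_loc f df a b (x - 1) (x + 1) M).
- by move=> z _; apply: continuousW; exact: continuous_xsec.
- by move=> z y /andP[z1 z2]; apply: fM; rewrite !ltW.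
- by apply/andP; split; lra.
Qed.

Lemma is_derive_RI a f x : continuous f -> a < x -> is_derive x 1 (RI a ^~ f) (f x).
Proof.
move=> cf ax.
have I1 : (@lebesgue_measure R).-integrable `[a, x + 1] (EFin \o f).
  by apply: within_itv_integrable; exact: continuousW.
have xx1 : x < x + 1 by rewrite ltrDl.
have [D1 D2] := continuous_FTC1_closed xx1 I1 ax (cf x).
by split; [exact: D1|rewrite -derive1E; exact: D2].
Qed.

Lemma is_derive1_continuous f df x : is_derive x 1 f df -> {for x, continuous f}.
Proof. by move=> D; apply/differentiable_continuous/derivable1_diffP. Qed.

(** The double integral up to a variable limit [x], with the [y]-integral outside, has derivative
    [RI c d (f x)]; the fundamental theorem on [[a, b]] then exchanges the order. *)
Lemma RI_Fubini (f : R -> R -> R) a b c d : a < b -> c <= d ->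
  continuous (fun p : R * R => f p.1 p.2) ->
  RI a b (fun x => RI c d (f x)) = RI c d (fun y => RI a b (f ^~ y)).
Proof.
move=> ab cd cf.
(* The base point lies left of [a], so that [G] has a two-sided derivative on all of [[a, b]]. *)
pose G x y := RI (a - 1) x (f ^~ y).
have cfT : continuous (fun p : R * R => f p.2 p.1).
  by apply: (continuous_comp2 cf) => z; [exact: cvg_snd|exact: cvg_fst].
have cG x : continuous (G x) by exact: (continuous_RI_param (f := fun y x => f x y)).
have [M M0 fM] := rect_bound (a - 1) (b + 1) c d cf.
have dB x : a - 1 < x < b + 1 -> is_derive x 1 (fun x => RI c d (G x)) (RI c d (f x)).
  apply: (@is_derive_RI_param_loc G f c d _ _ M).
  - by move=> z _; exact: continuousW.
  - by move=> z y /andP[az zb] _; apply: is_derive_RI => //; exact: continuous_ysec.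
  - by move=> z y /andP[z1 z2]; apply: fM; rewrite !ltW.
have c1 : {within `[a, b], continuous (fun x => RI c d (f x))}.
  by apply: continuousW; exact: continuous_RI_param.
have c2 : {within `[a, b], continuous (fun x => RI c d (G x))}.
  apply: derivable_within_continuous => x; rewrite in_itv/= => /andP[ax xb].
  by have /dB D : a - 1 < x < b + 1 by apply/andP; split; lra.
have d1 x : a < x < b -> is_derive x 1 (fun x => RI c d (G x)) (RI c d (f x)).
  by move=> /andP[ax xb]; apply: dB; apply/andP; split; lra.
rewrite (RI_FTC ab c1 c2 d1) -RIB; [|exact: continuousW|exact: continuousW].
apply: eq_RI => y ycd; rewrite /G (@RI_split a (a - 1) b); [|lra|lra|].
  by rewrite addrC addKr.
by apply: continuousW; exact: continuous_ysec.
Qed.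

End RI.

(** * Structural proofs of continuity and of derivatives *)

Section continuity.
Variables (R : realType) (T : topologicalType).
Implicit Types f g : T -> R.

Lemma ct_cst (k : R) : continuous (fun _ : T => k).
Proof. by move=> x; exact: cvg_cst. Qed.

Lemma ct_D f g : continuous f -> continuous g -> continuous (fun x => f x + g x).
Proof. by move=> cf cg x; apply: cvgD; [exact: cf|exact: cg]. Qed.

Lemma ct_N f : continuous f -> continuous (fun x => - f x).
Proof. by move=> cf x; apply: cvgN; exact: cf. Qed.

Lemma ct_M f g : continuous f -> continuous g -> continuous (fun x => f x * g x).
Proof. by move=> cf cg x; apply: cvgM; [exact: cf|exact: cg]. Qed.

Lemma ct_X f n : continuous f -> continuous (fun x => f x ^+ n).
Proof.
move=> cf; elim: n => [|n IH]; first by under eq_fun do rewrite expr0; exact: ct_cst.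
by under eq_fun do rewrite exprS; exact: ct_M.
Qed.

Lemma ct_comp (h : R -> R) f : continuous h -> continuous f -> continuous (fun x => h (f x)).
Proof. by move=> ch cf x; apply: (cvg_comp _ _ (cf x)); exact: ch. Qed.

Lemma ct_cos f : continuous f -> continuous (fun x => cos (f x)).
Proof. exact/ct_comp/continuous_cos. Qed.

Lemma ct_sin f : continuous f -> continuous (fun x => sin (f x)).
Proof. exact/ct_comp/continuous_sin. Qed.

Lemma ct_sum (I : Type) (r : seq I) (P : pred I) (F : I -> T -> R) :
  (forall i, continuous (F i)) -> continuous (fun x => \sum_(i <- r | P i) F i x).
Proof.
move=> cF; elim: r => [|i r IH].
  by under eq_fun do rewrite big_nil; exact: ct_cst.
under eq_fun do rewrite big_cons.
by case: (P i) => //; exact: ct_D.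
Qed.

End continuity.

Lemma ct_id (R : realType) : continuous (fun x : R => x).
Proof. by move=> x; exact: cvg_id. Qed.

Lemma ct_fst (R : realType) : continuous (fun x : R * R => x.1).
Proof. by move=> x; exact: cvg_fst. Qed.

Lemma ct_snd (R : realType) : continuous (fun x : R * R => x.2).
Proof. by move=> x; exact: cvg_snd. Qed.

Ltac ct := lazymatch goal with
  | |- continuous (fun _ => ?k) => exact: ct_cst
  | |- continuous (fun z => z) => exact: ct_id
  | |- continuous id => exact: ct_id
  | |- continuous (fun z => z.1) => exact: ct_fst
  | |- continuous (fun z => z.2) => exact: ct_snd
  | |- continuous (fun z => @?a z + @?b z) => apply: (@ct_D _ _ a b); ct
  | |- continuous (fun z => - (@?a z)) => apply: (@ct_N _ _ a); ct
  | |- continuous (fun z => @?a z * @?b z) => apply: (@ct_M _ _ a b); ct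
  | |- continuous (fun z => (@?a z) ^+ ?n) => apply: (@ct_X _ _ a n); ct
  | |- continuous (fun z => cos (@?a z)) => apply: (@ct_cos _ _ a); ct
  | |- continuous (fun z => sin (@?a z)) => apply: (@ct_sin _ _ a); ct
  | |- continuous (+%R ?c) => apply: (@ct_D _ _ (fun=> c) (fun z => z)); ct
  | |- continuous ( *%R ?c) => apply: (@ct_M _ _ (fun=> c) (fun z => z)); ct
  | |- continuous -%R => apply: (@ct_N _ _ (fun z => z)); ct
  | |- continuous (fun z => ?G (@?a z)) =>
      first [assumption | apply: (@ct_comp _ _ G a); [assumption | ct] | idtac]
  | |- _ => try assumption
  end.
Ltac cw := apply: continuousW; ct.

Section derivation.
Variable R : realType.
Implicit Types (f g : R -> R) (x a b k : R).

Lemma dv_eq f x a b : is_derive x 1 f a -> a = b -> is_derive x 1 f b.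
Proof. by move=> + <-. Qed.

Lemma dv_cst x k : is_derive x 1 (fun _ : R => k) 0.
Proof. exact: is_derive_cst. Qed.

Lemma dv_id x : is_derive x 1 (fun y : R => y) 1.
Proof. exact: is_derive_id. Qed.

Lemma dv_D f g x a b : is_derive x 1 f a -> is_derive x 1 g b ->
  is_derive x 1 (fun y => f y + g y) (a + b).
Proof. by move=> Df Dg; exact: is_deriveD. Qed.

Lemma dv_N f x a : is_derive x 1 f a -> is_derive x 1 (fun y => - f y) (- a).
Proof. by move=> Df; exact: is_deriveN. Qed.

Lemma dv_M f g x a b : is_derive x 1 f a -> is_derive x 1 g b ->
  is_derive x 1 (fun y => f y * g y) (a * g x + f x * b).
Proof.
move=> Df Dg; have H := is_deriveM Df Dg; apply: (dv_eq H).
by rewrite /GRing.scale/= addrC [g x * a]mulrC.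
Qed.

Lemma dv_comp f g x a b : is_derive (g x) 1 f a -> is_derive x 1 g b ->
  is_derive x 1 (fun y => f (g y)) (a * b).
Proof. exact: is_derive1_comp. Qed.

Lemma dv_X f x a n : is_derive x 1 f a ->
  is_derive x 1 (fun y => f y ^+ n) (n%:R * f x ^+ n.-1 * a).
Proof.
move=> Df; elim: n => [|n IH].
  under eq_fun do rewrite expr0.
  by apply: (dv_eq (dv_cst _ _)); rewrite !mul0r.
under eq_fun do rewrite exprS.
apply: (dv_eq (dv_M Df IH)); rewrite -natr1; case: n {IH} => [|n] /=; first by ring.
by rewrite exprS; ring.
Qed.

Lemma dv_cos f x a : is_derive x 1 f a -> is_derive x 1 (fun y => cos (f y)) (- sin (f x) * a).
Proof. by move=> Df; exact: (dv_comp (is_derive_cos _) Df). Qed.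

Lemma dv_sin f x a : is_derive x 1 f a -> is_derive x 1 (fun y => sin (f y)) (cos (f x) * a).
Proof. by move=> Df; exact: (dv_comp (is_derive_sin _) Df). Qed.

End derivation.

Ltac dvh := match goal with H : is_derive ?x _ ?f _ |- is_derive ?x _ ?f _ => exact: H end.
Ltac dvs := lazymatch goal with
  | |- is_derive _ _ (fun _ => ?k) _ => apply: dv_cst
  | |- is_derive _ _ (fun z => z) _ => apply: dv_id
  | |- is_derive _ _ (fun z => @?a z + @?b z) _ => apply: (@dv_D _ a b); dvs
  | |- is_derive _ _ (fun z => - (@?a z)) _ => apply: (@dv_N _ a); dvs
  | |- is_derive _ _ (fun z => @?a z * @?b z) _ => apply: (@dv_M _ a b); dvs
  | |- is_derive _ _ (fun z => (@?a z) ^+ ?n) _ => apply: (@dv_X _ a _ _ n); dvs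
  | |- is_derive _ _ (fun z => cos (@?a z)) _ => apply: (@dv_cos _ a); dvs
  | |- is_derive _ _ (fun z => sin (@?a z)) _ => apply: (@dv_sin _ a); dvs
  | |- is_derive _ _ (+%R ?c) _ => apply: (@dv_D _ (fun=> c) (fun z => z)); dvs
  | |- is_derive _ _ ( *%R ?c) _ => apply: (@dv_M _ (fun=> c) (fun z => z)); dvs
  | |- is_derive _ _ (fun z => ?G (@?a z)) _ =>
      first [dvh | match goal with H : is_derive _ _ G _ |- _ => apply: (@dv_comp _ G a _ _ _ H); dvs end | idtac]
  | |- _ => try dvh
  end.
Ltac dvr := eapply dv_eq; [dvs | rewrite /GRing.scale/=; try (by ring)].

(** * Completeness of the cosines and of the sines *)

Section completeness.
Variable R : realType.
Implicit Types (h x : R) (f c : R -> R).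

(* If [f x0 > 0], the weights [(1 - (c x - c x0)^2 / 4)^n] concentrate at [x0]. *)
Lemma orth_powers_le0 h f c : 0 < h -> continuous f -> continuous c ->
  (forall x, `|c x| <= 1) -> {in `[0, h] &, injective c} ->
  (forall n, RI 0 h (fun x => f x * c x ^+ n) = 0) ->
  forall x0, 0 <= x0 <= h -> f x0 <= 0.
Proof.
move=> h0 cf cc c1 cinj orth x0 x0h; rewrite leNgt; apply/negP => fx0.
pose P x := 1 - (c x - c x0) ^+ 2 / 4.
have cP : continuous P by rewrite /P; ct.
have P01 x : 0 <= P x <= 1.
  rewrite /P; have := c1 x; have := c1 x0; rewrite !ler_norml => /andP[a1 a2] /andP[b1 b2].
  have D1 : 0 <= (2 - (c x - c x0)) * (2 + (c x - c x0)) by apply: mulr_ge0; lra.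
  by have D2 := sqr_ge0 (c x - c x0); apply/andP; split; lra.
have Px0 : P x0 = 1 by rewrite /P subrr expr0n mul0r subr0.
(* Quantified over all [k], since a factor [P] is quadratic in [c] and raises the power of [c] by up
   to two. *)
have orthP n : forall k, RI 0 h (fun x => f x * c x ^+ k * P x ^+ n) = 0.
  elim: n => [|n IH] k.
    by rewrite -[RHS](orth k); apply: eq_RI => x _; rewrite expr0 mulr1.
  rewrite (@eq_RI _ _ _ _ (fun x => ((1 - c x0 ^+ 2 / 4) * (f x * c x ^+ k * P x ^+ n) +
     c x0 / 2 * (f x * c x ^+ k.+1 * P x ^+ n)) + (- 4^-1) * (f x * c x ^+ k.+2 * P x ^+ n))).
    rewrite RID; [|cw|cw]; rewrite RID; [|cw|cw].
    by rewrite RIZ; [|cw]; rewrite RIZ; [|cw]; rewrite RIZ; [|cw]; rewrite !IH !mulr0 !addr0.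
  by move=> x _; rewrite [P x ^+ n.+1]exprS {1}/P !exprS; field.
pose m := f x0 / 2.
have m0 : 0 < m by rewrite divr_gt0.
(* Where [f] is at most half of [f x0], the weight attains a maximum by compactness; the value 1
   would force [c x = c x0], hence [x = x0] by injectivity. *)
have [q /andP[q0 q1] qP] : exists2 q : R, 0 < q < 1 &
    forall x, 0 <= x <= h -> f x <= m -> P x <= q.
  pose K := `[0, h]%classic `&` f @^-1` [set y | y <= m].
  have cK : compact K.
    apply: compact_closedI; first exact: segment_compact.
    by apply: preimage_closed => [x _|]; [exact: cf|exact: closed_le].
  have [K0|/set0P/negP/negPn/eqP K0] := pselect (K !=set0).
    have [z] := compact_EVT_max K0 cK (continuous_subspaceT cP).
    rewrite inE => -[]; rewrite /= in_itv/= => zh fz zmax.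
    exists (Num.max (P z) 2^-1).
      rewrite lt_max invr_gt0 ltr0n orbT/= gt_max invf_lt1// ltr1n andbT.
      have /andP[_] := P01 z; rewrite le_eqVlt => /predU1P[Pz|//].
      have : z = x0.
        apply: cinj; rewrite ?in_itv//.
        have : (c z - c x0) ^+ 2 = 0 by move: Pz; rewrite /P; lra.
        by move/eqP; rewrite sqrf_eq0 subr_eq0 => /eqP.
      move=> zx0; move: fz; rewrite zx0 /m; lra.
    move=> x xh fx; rewrite le_max; apply/orP; left; apply: zmax.
    by rewrite inE; split; rewrite /= ?in_itv.
  exists 2^-1; first by rewrite invr_gt0 ltr0n invf_lt1// ltr1n.
  move=> x xh fx; suff : K x by rewrite K0.
  by split; rewrite /= ?in_itv.
pose r := (1 + q) / 2.
have qr : q < r by rewrite /r; lra.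
have r1 : r < 1 by rewrite /r; lra.
have r0 : 0 < r by rewrite /r; lra.
have [d d0 near_x0] : exists2 d : R, 0 < d & forall x, `|x - x0| < d -> m < f x /\ r < P x.
  have : \forall x \near x0, m < f x /\ r < P x.
    near=> x; split; near: x.
      by apply: (cvgr_gt (f x0) (cf x0)); rewrite /m; lra.
    by apply: (cvgr_gt (P x0) (cP x0)); rewrite Px0.
  move=> /nbhs_ballP[d /= d0 H]; exists d => // x xd; apply: H.
  by rewrite /ball/= distrC.
(* An interval with [x0] as an endpoint, to its right unless [x0 = h], stays inside [[0, h]]. *)
have [u [v [u0 vh uv uvd]]] : exists u v, [/\ 0 <= u, v <= h, u < v &
    forall x, u <= x <= v -> `|x - x0| < d].
  move/andP: x0h => [x00 x0h].
  have [x0lt|x0ge] := ltP x0 h.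
    exists x0, (Num.min h (x0 + d / 2)); split => //.
    - by rewrite ge_min lexx.
    - by rewrite lt_min x0lt/= ltrDl divr_gt0.
    - move=> x; rewrite le_min => /and3P[x1 x2 x3].
      by rewrite ger0_norm ?subr_ge0//; lra.
  exists (Num.max 0 (x0 - d / 2)), h; split => //.
  - by rewrite le_max lexx.
  - by rewrite gt_max h0/=; lra.
  - move=> x; rewrite ge_max => /andP[/andP[x1 x2] x3].
    by rewrite ltr_norml; apply/andP; split; lra.
have [M0 M00 fM0] := rect_bound 0 h 0 0 (f := fun x _ => f x)
  (ct_comp cf (@ct_fst R)).
have fM x : 0 <= x <= h -> `|f x| <= M0 by move=> xh; apply: (fM0 x 0); rewrite ?lexx.
have lowglob n x : 0 <= x <= h -> - (M0 * q ^+ n) <= f x * P x ^+ n.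
  move=> xh; have /andP[P0 P1] := P01 x.
  have [fx|fx] := leP (f x) m.
    have Pq := lerXn2r n (P0 : P x \in Num.nneg) (ltW q0 : q \in Num.nneg) (qP x xh fx).
    rewrite lerNl -mulNr; apply: (@le_trans _ _ (M0 * P x ^+ n)); last by rewrite ler_wpM2l// ltW.
    rewrite ler_wpM2r ?exprn_ge0//; have := fM x xh; rewrite ler_norml => /andP[]; lra.
  by rewrite (le_trans (y := 0))// ?oppr_le0 ?mulr_ge0 ?exprn_ge0// ltW// (lt_trans m0).
have lowloc n x : u <= x <= v -> m * r ^+ n <= f x * P x ^+ n.
  move=> /uvd/near_x0[mf rP].
  apply: ler_pM; [exact: ltW|by rewrite exprn_ge0// ltW|exact: ltW|].
  by apply: lerXn2r; rewrite ?nnegrE; [exact: ltW|exact: ltW (lt_trans r0 rP)|exact: ltW].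
(* The whole integral is 0, yet [[u, v]] contributes at least the left side and the rest at least
   minus the right side. Since [q < r], this fails for large [n]. *)
have key n : m * r ^+ n * (v - u) <= M0 * q ^+ n * (2 * h).
  have := orthP n 0%N; under eq_RI do rewrite expr0 mulr1.
  have cfP : continuous (fun x => f x * P x ^+ n) by ct.
  rewrite (@RI_split _ u) ?(ltW (lt_le_trans uv vh))//; last exact: continuousW.
  rewrite (@RI_split _ v u) ?(ltW uv)//; last exact: continuousW.
  have L1 : - (M0 * q ^+ n) * (u - 0) <= RI 0 u (fun x => f x * P x ^+ n).
    rewrite -RI_cst//; apply: le_RI; [cw|cw|] => x /andP[xx1 xx2]; apply: lowglob.
    by rewrite xx1/=; lra.
  have L2 : - (M0 * q ^+ n) * (h - v) <= RI v h (fun x => f x * P x ^+ n).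
    rewrite -RI_cst//; apply: le_RI; [cw|cw|] => x /andP[xx1 xx2]; apply: lowglob.
    by rewrite xx2 andbT; lra.
  have L3 : m * r ^+ n * (v - u) <= RI u v (fun x => f x * P x ^+ n).
    by rewrite -RI_cst ?(ltW uv)//; apply: le_RI; [cw|cw|] => x; exact: lowloc.
  have : 0 <= M0 * q ^+ n by rewrite mulr_ge0 ?exprn_ge0 ?ltW.
  by set Z := M0 * q ^+ n in L1 L2 *; nra.
have qr0 : 0 <= q / r by rewrite divr_ge0//; exact: ltW.
have qr1 : `|q / r| < 1 by rewrite ger0_norm// ltr_pdivrMr// mul1r.
have e0 : 0 < m * (v - u) / (M0 * (2 * h)) by rewrite divr_gt0 ?mulr_gt0// subr_gt0.
have [N _ /(_ N (leqnn N))] := cvgr0_norm_lt _ (cvg_expr qr1) _ e0.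
rewrite /= ger0_norm ?exprn_ge0// expr_div_n.
rewrite ltr_pdivlMr ?mulr_gt0// mulrAC ltr_pdivrMr ?exprn_gt0//.
have := key N; lra.
Unshelve. all: by end_near.
Qed.

Lemma orth_powers_eq0 h f c : 0 < h -> continuous f -> continuous c ->
  (forall x, `|c x| <= 1) -> {in `[0, h] &, injective c} ->
  (forall n, RI 0 h (fun x => f x * c x ^+ n) = 0) ->
  forall x, 0 <= x <= h -> f x = 0.
Proof.
move=> h0 cf cc c1 cinj orth x xh; apply/eqP; rewrite eq_le; apply/andP; split.
  exact: (orth_powers_le0 h0 cf cc).
rewrite -oppr_le0; apply: (orth_powers_le0 h0 (f := fun x => - f x) _ cc) => // [|n]; first ct.
rewrite (@eq_RI _ _ _ _ (fun x => -1 * (f x * c x ^+ n))); last by move=> y _; rewrite mulN1r mulNr.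
by rewrite RIZ ?orth ?mulr0//; cw.
Qed.

Lemma cos_scaled_inj h : 0 < h -> {in `[0, h] &, injective (fun x => cos (pi * x / h))}.
Proof.
move=> h0 x y; rewrite !in_itv/= => /andP[x0 xh] /andP[y0 yh] /cos_inj E.
have : pi * x / h = pi * y / h.
  apply: E; rewrite in_itv/=; apply/andP; split.
  - by rewrite !mulr_ge0 ?pi_ge0// invr_ge0 ltW.
  - by rewrite ler_pdivrMr// ler_wpM2l ?pi_ge0.
  - by rewrite !mulr_ge0 ?pi_ge0// invr_ge0 ltW.
  - by rewrite ler_pdivrMr// ler_wpM2l ?pi_ge0.
move/(mulIf (invr_neq0 (lt0r_neq0 h0)))/mulfI; apply.
by rewrite gt_eqF// pi_gt0.
Qed.

(** Multiplication by [cos (pi * x / h)] shifts a frequency by one in both directions, so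
    orthogonality to all frequencies gives orthogonality to all powers of this function, which is
    injective on [[0, h]]. *)
Lemma cosine_complete h f : 0 < h -> continuous f ->
  (forall k : nat, RI 0 h (fun x => f x * cos (k%:R * (pi * x / h))) = 0) ->
  forall x, 0 <= x <= h -> f x = 0.
Proof.
move=> h0 cf orth.
have main n : forall k : nat,
    RI 0 h (fun x => f x * cos (pi * x / h) ^+ n * cos (k%:R * (pi * x / h))) = 0.
  elim: n => [|n IH] k.
    by rewrite -[RHS](orth k); apply: eq_RI => x _; rewrite expr0 mulr1.
  case: k => [|k].
    rewrite -[RHS](IH 1%N); apply: eq_RI => x _.
    by rewrite exprSr mul0r cos0 mul1r mulr1 mulrA.
  rewrite (@eq_RI _ _ _ _ (fun x => 2^-1 * (f x * cos (pi * x / h) ^+ n * cos (k.+2%:R * (pi * x / h))) +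
     2^-1 * (f x * cos (pi * x / h) ^+ n * cos (k%:R * (pi * x / h))))).
    by rewrite RID; [|cw|cw]; rewrite RIZ; [|cw]; rewrite RIZ; [|cw]; rewrite !IH !mulr0 addr0.
  move=> x _; set A := pi * x / h.
  have -> : k.+2%:R * A = k.+1%:R * A + A by rewrite -natr1 mulrDl mul1r.
  have -> : k%:R * A = k.+1%:R * A - A by rewrite -[k.+1%:R]natr1 mulrDl mul1r addrK.
  by rewrite cosD cosB exprS; field.
apply: (@orth_powers_eq0 h f (fun x => cos (pi * x / h))) => //; first ct.
- by move=> x; exact: cos_max.
- exact: cos_scaled_inj.
move=> n; rewrite -[RHS](main n 0%N); apply: eq_RI => x _.
by rewrite mul0r cos0 mulr1.
Qed.

Lemma continuous_eq0_closure h f : 0 < h -> continuous f ->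
  (forall x, 0 < x < h -> f x = 0) -> forall x, 0 <= x <= h -> f x = 0.
Proof.
move=> h0 cf f0 x /andP[x0 xh]; apply/eqP/negPn/negP => fx.
have : \forall y \near x, 0 < `|f y|.
  have cn : continuous (fun y => `|f y|) by exact: (ct_comp (@norm_continuous _ _) cf).
  by apply: (cvgr_gt `|f x| (cn x)); rewrite normr_gt0.
move=> /nbhs_ballP[d /= d0 H].
pose e := Num.min (h / 2) (d / 2).
have e0 : 0 < e by rewrite lt_min !divr_gt0.
have eh : e <= h / 2 by rewrite ge_min lexx.
have ed : e <= d / 2 by rewrite ge_min lexx orbT.
clearbody e; pose y := if x <= h / 2 then x + e / 2 else x - e / 2.
have /f0 fy : 0 < y < h by rewrite /y; have [xle|xgt] := leP x (h / 2); apply/andP; split; lra.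
have : 0 < `|f y|.
  apply: H; rewrite -ball_normE/= ltr_norml.
  by rewrite /y; have [xle|xgt] := leP x (h / 2); apply/andP; split; lra.
by rewrite fy normr0 ltxx.
Qed.

(** As for cosines, but the powers are tested against the product of [f] with the first sine. That
    product therefore vanishes, which gives [f = 0] inside the interval, and continuity reaches the
    endpoints. *)
Lemma sine_complete h f : 0 < h -> continuous f ->
  (forall k : nat, RI 0 h (fun x => f x * sin (k.+1%:R * (pi * x / h))) = 0) ->
  forall x, 0 <= x <= h -> f x = 0.
Proof.
move=> h0 cf orth.
have main n : forall k : nat,
    RI 0 h (fun x => f x * cos (pi * x / h) ^+ n * sin (k%:R * (pi * x / h))) = 0.
  elim: n => [|n IH] k.
    case: k => [|k]; last by rewrite -[RHS](orth k); apply: eq_RI => x _; rewrite expr0 mulr1.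
    by rewrite -[RHS](@RI0 _ 0 h); apply: eq_RI => x _; rewrite mul0r sin0 mulr0.
  case: k => [|k].
    by rewrite -[RHS](@RI0 _ 0 h); apply: eq_RI => x _; rewrite mul0r sin0 mulr0.
  rewrite (@eq_RI _ _ _ _ (fun x => 2^-1 * (f x * cos (pi * x / h) ^+ n * sin (k.+2%:R * (pi * x / h))) +
     2^-1 * (f x * cos (pi * x / h) ^+ n * sin (k%:R * (pi * x / h))))).
    by rewrite RID; [|cw|cw]; rewrite RIZ; [|cw]; rewrite RIZ; [|cw]; rewrite !IH !mulr0 addr0.
  move=> x _; set A := pi * x / h.
  have -> : k.+2%:R * A = k.+1%:R * A + A by rewrite -natr1 mulrDl mul1r.
  have -> : k%:R * A = k.+1%:R * A - A by rewrite -[k.+1%:R]natr1 mulrDl mul1r addrK.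
  by rewrite sinD sinB exprS; field.
have fs0 x : 0 <= x <= h -> f x * sin (pi * x / h) = 0.
  apply: (@orth_powers_eq0 h (fun x => f x * sin (pi * x / h)) (fun x => cos (pi * x / h))) => //.
  - by ct.
  - by ct.
  - by move=> y; exact: cos_max.
  - exact: cos_scaled_inj.
  move=> n; rewrite -[RHS](main n 1%N); apply: eq_RI => y _.
  by rewrite mul1r mulrAC.
apply: continuous_eq0_closure => // x /andP[x0 xh].
have /fs0/eqP : 0 <= x <= h by rewrite (ltW x0) (ltW xh).
rewrite mulf_eq0 => /orP[/eqP//|].
rewrite gt_eqF// sin_gt0_pi//; apply/andP; split.
  by rewrite !mulr_gt0 ?pi_gt0 ?invr_gt0.
by rewrite ltr_pdivrMr// ltr_pM2l ?pi_gt0.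
Qed.

End completeness.

(** * Cosine series and Poisson summation *)

Section uniform_series.
Variable R : realType.

Lemma cvg_seqE (u : nat -> R) (l : R) : u n @[n --> \oo] --> l ->
  forall eps : R, 0 < eps -> exists N, forall n, (N <= n)%N -> `|l - u n| < eps.
Proof.
move=> ul eps e0; have [N _ H] := (@cvgrPdist_lt _ _ _ _ _ u l).1 ul eps e0.
by exists N => n Nn; apply: H.
Qed.

Lemma cvg_seqI (u : nat -> R) (l : R) :
  (forall eps : R, 0 < eps -> exists N, forall n, (N <= n)%N -> `|l - u n| <= eps) ->
  u n @[n --> \oo] --> l.
Proof.
move=> H; apply/cvgrPdist_le => eps; rewrite /= => /H[N HN]; exists N => // n; exact: HN.
Qed.

Lemma weierstrass_M_test (T : Type) (a : nat -> T -> R) (b : nat -> R) :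
  (forall k x, `|a k x| <= b k) -> cvgn (series b) ->
  exists g : T -> R, forall eps : R, 0 < eps -> exists K0, forall K, (K0 <= K)%N ->
    forall x, `|g x - \sum_(0 <= k < K) a k x| <= eps.
Proof.
move=> ab cb.
have ca x : cvgn (series (a ^~ x)).
  apply: normed_cvg; apply: series_le_cvg cb => k /=; first exact: normr_ge0.
    exact: le_trans (normr_ge0 _) (ab k x).
  exact: ab.
exists (fun x => limn (series (a ^~ x))) => eps e0.
have e4 : 0 < eps / 4 by rewrite divr_gt0.
have [K0 HK0] := cvg_seqE cb e4.
exists K0 => K K0K x.
have [N HN] := cvg_seqE (ca x) e4.
pose n := maxn N K.
have Kn : (K <= n)%N by rewrite leq_maxr.
have := HN n (leq_maxl _ _); have := HK0 _ K0K; have := HK0 _ (leq_trans K0K Kn).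
rewrite /series /=.
have D (u : nat -> R) : \sum_(0 <= k < n) u k = \sum_(0 <= k < K) u k + \sum_(K <= k < n) u k.
  by rewrite -big_cat_nat.
have : `|\sum_(K <= k < n) a k x| <= \sum_(K <= k < n) b k.
  by apply: (le_trans (ler_norm_sum _ _ _)); apply: ler_sum => k _; exact: ab.
rewrite !D.
move: (limn _) (limn _) (\sum_(0 <= k < K) _) (\sum_(0 <= k < K) _) (\sum_(K <= k < n) _) (\sum_(K <= k < n) _).
move=> l1 l2 s1 s2 t1 t2; rewrite !ltr_norml !ler_norml => /andP[? ?] /andP[? ?] /andP[? ?] /andP[? ?].
by apply/andP; split; lra.
Qed.

Lemma uniform_limit_ct (T : topologicalType) (g : T -> R) :
  (forall eps : R, 0 < eps -> exists2 P : T -> R, continuous P & forall x, `|g x - P x| <= eps) ->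
  continuous g.
Proof.
move=> H x; apply/cvgrPdist_lt => eps e0.
have e4 : 0 < eps / 4 by rewrite divr_gt0.
have [P cP gP] := H _ e4.
have := (@cvgrPdist_lt _ _ _ _ (nbhs_filter x) P (P x)).1 (cP x) _ e4.
apply: filterS => y; have := gP x; have := gP y.
rewrite !ltr_norml !ler_norml => /andP[? ?] /andP[? ?] /andP[? ?].
by apply/andP; split; lra.
Qed.

End uniform_series.

Section cosine_series.
Variable R : realType.
Implicit Types (h x : R) (f G : R -> R).

Lemma is_derive_within_ct (a b : R) (f df : R -> R) :
  (forall x, a <= x <= b -> is_derive x 1 f (df x)) -> {within `[a, b], continuous f}.
Proof.
move=> D; apply: derivable_within_continuous => x; rewrite in_itv/= => /D Dx.
exact: ex_derive.
Qed.

Lemma RI_FTCc (a b : R) (f F : R -> R) : a < b -> {within `[a, b], continuous f} ->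
  (forall x, a <= x <= b -> is_derive x 1 F (f x)) -> RI a b f = F b - F a.
Proof.
move=> ab cf dF; apply: RI_FTC => //; first exact: is_derive_within_ct dF.
by move=> x /andP[ax xb]; apply: dF; rewrite !ltW.
Qed.

Lemma normM_le (x y a b : R) : `|x| <= a -> `|y| <= b -> `|x * y| <= a * b.
Proof. by move=> xa yb; rewrite normrM; exact: ler_pM. Qed.

Lemma RI_shift G h c : 0 < h -> continuous G -> RI 0 h (fun u => G (c + u)) = RI c (c + h) G.
Proof.
move=> h0 cG; pose P x := RI (c - 1) x G.
have dP (u : R) : 0 - 1 < u -> is_derive u 1 (fun u => P (c + u)) (G (c + u)).
  move=> u0; have D : is_derive (c + u) 1 P (G (c + u)) by apply: is_derive_RI => //; lra.
  by dvr.
have c1 : {within `[0, h], continuous (fun u : R => G (c + u))}.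
  by cw.
have d x : 0 <= x <= h -> is_derive x 1 (fun u : R => P (c + u)) (G (c + x)).
  by move=> /andP[? ?]; apply: dP; lra.
rewrite (RI_FTCc h0 c1 d).
rewrite /P (@RI_split _ c (c - 1) (c + h)); [|lra|lra|cw].
by rewrite addr0 addrC addKr.
Qed.

Lemma RI_reflect G h c : 0 < h -> continuous G -> RI 0 h (fun u => G (c - u)) = RI (c - h) c G.
Proof.
move=> h0 cG; pose P x := RI (c - h - 1) x G.
have dP (u : R) : u < h + 1 -> is_derive u 1 (fun u => - P (c - u)) (G (c - u)).
  move=> u0; have D : is_derive (c - u) 1 P (G (c - u)) by apply: is_derive_RI => //; lra.
  by dvr.
have c1 : {within `[0, h], continuous (fun u : R => G (c - u))}.
  by cw.
have d x : 0 <= x <= h -> is_derive x 1 (fun u : R => - P (c - u)) (G (c - x)).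
  by move=> /andP[? ?]; apply: dP; lra.
rewrite (RI_FTCc h0 c1 d).
rewrite /P subr0 opprK addrC (@RI_split _ (c - h) (c - h - 1) c); [|lra|lra|cw].
by rewrite addrC addKr.
Qed.

Lemma cos_natmul2pi (x : R) (n : nat) : cos (x + n%:R * (2 * pi)) = cos x.
Proof.
elim: n => [|n IH]; first by rewrite mul0r addr0.
by rewrite -natr1 mulrDl mul1r addrA [X in _ + X]mulr_natl cosD2pi.
Qed.

Lemma sin_natmulpi (n : nat) : sin (n%:R * pi) = 0 :> R.
Proof.
elim: n => [|n IH]; first by rewrite mul0r sin0.
by rewrite -natr1 mulrDl mul1r sinD IH sinpi mulr0 mul0r addr0.
Qed.

Lemma RI_cos_nat (m : nat) h : 0 < h ->
  RI 0 h (fun x => cos (m.+1%:R * (pi * x / h))) = 0.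
Proof.
move=> h0; pose w : R := m.+1%:R * pi / h.
have w0 : 0 < w by rewrite /w divr_gt0// mulr_gt0// ?ltr0n// pi_gt0.
rewrite (@eq_RI _ _ _ _ (fun x => cos (w * x))); last first.
  by move=> x _; congr cos; rewrite /w; ring.
have dF (x : R) : is_derive x 1 (fun x => w^-1 * sin (w * x)) (cos (w * x)).
  by dvr; field; rewrite gt_eqF.
have cf : {within `[0, h], continuous (fun x : R => cos (w * x))} by cw.
rewrite (RI_FTCc h0 cf (fun x _ => dF x)).
have -> : w * h = m.+1%:R * pi by rewrite /w divfK// gt_eqF.
by rewrite sin_natmulpi !mulr0 sin0 mulr0 subrr.
Qed.

Lemma cosMcos (a b : R) : cos a * cos b = 2^-1 * cos (a + b) + 2^-1 * cos (a - b).
Proof. by rewrite cosD cosB; field. Qed.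

Lemma RI_cos_cos (j k : nat) h : 0 < h ->
  RI 0 h (fun x => cos (j%:R * (pi * x / h)) * cos (k%:R * (pi * x / h))) =
  if j == k then (if k == 0%N then h else h / 2) else 0.
Proof.
move=> h0; wlog jk : j k / (k <= j)%N => [H|].
  have [/H//|/ltnW/H] := leqP k j; rewrite eq_sym.
  under eq_RI do rewrite mulrC.
  by case: eqP => [->|].
have -> : RI 0 h (fun x => cos (j%:R * (pi * x / h)) * cos (k%:R * (pi * x / h))) =
  2^-1 * RI 0 h (fun x => cos ((j + k)%:R * (pi * x / h))) +
  2^-1 * RI 0 h (fun x => cos ((j - k)%:R * (pi * x / h))).
  rewrite -RIZ; [|cw]; rewrite -RIZ; [|cw]; rewrite -RID; [|cw|cw].
  apply: eq_RI => x _; move: (pi * x / h) => A; rewrite natrD natrB//.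
  by rewrite [in RHS]mulrDl [in RHS]mulrBl cosMcos.
have cos00 : RI 0 h (fun x => cos (0%:R * (pi * x / h))) = h.
  under eq_RI do rewrite mul0r cos0.
  by rewrite RI_cst ?ltW// mul1r subr0.
have [->|jk0] := eqVneq j k.
  rewrite subnn cos00; case: k {jk} => [|k]; first by rewrite addn0 cos00 /=; field.
  by rewrite addnS RI_cos_nat// mulr0 add0r mulrC.
have : (0 < j - k)%N by rewrite subn_gt0 ltn_neqAle eq_sym jk0.
have : (0 < j + k)%N by rewrite lt0n addn_eq0 negb_and; case: j jk0 {jk} => // ; case: k.
by case: (j + k)%N (j - k)%N => [//|s] [//|t] _ _; rewrite !RI_cos_nat// mulr0 addr0.
Qed.

(* The weight of the frequency [k] when the frequencies [k] and [-k] are merged. *)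
Definition cw2 (k : nat) : R := if k == 0%N then 1 else 2.

Lemma cw2_ge0 k : 0 <= cw2 k.
Proof. by rewrite /cw2; case: ifP. Qed.

Lemma cw2_le2 k : cw2 k <= 2.
Proof. by rewrite /cw2; case: ifP => // _; rewrite ler1n. Qed.

Lemma RI_cos_cosE (j k : nat) h : 0 < h ->
  RI 0 h (fun x => cos (j%:R * (pi * x / h)) * cos (k%:R * (pi * x / h))) =
  if j == k then h / cw2 j else 0.
Proof.
move=> h0; rewrite RI_cos_cos// /cw2; case: eqP => // ->.
by case: ifP; rewrite ?divr1.
Qed.

(** Summable coefficients make the series converge uniformly to a continuous [g]; the cosine
    coefficients of [f - g] all vanish, so completeness gives [f = g]. *)
Lemma cosine_series h f (b : nat -> R) : 0 < h -> continuous f ->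
  let c k := RI 0 h (fun x => f x * cos (k%:R * (pi * x / h))) in
  (forall k, `|c k| <= b k) -> cvgn (series b) ->
  forall x, 0 <= x <= h ->
  h^-1 * (\sum_(0 <= k < K) cw2 k * c k * cos (k%:R * (pi * x / h))) @[K --> \oo] --> f x.
Proof.
move=> h0 cf c cb sb.
pose a k x := h^-1 * (cw2 k * c k * cos (k%:R * (pi * x / h))).
have ca k : continuous (a k) by rewrite /a; ct.
have b0 k : 0 <= b k := le_trans (normr_ge0 _) (cb k).
have ab k x : `|a k x| <= h^-1 * 2 * b k.
  rewrite /a normrM gtr0_norm ?invr_gt0// -[leRHS]mulrA ler_pM2l ?invr_gt0//.
  rewrite -[leRHS]mulr1; apply: normM_le; last exact: cos_max.
  by apply: normM_le => //; rewrite ger0_norm ?cw2_ge0 ?cw2_le2.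
have sb2 : cvgn (series (fun k => h^-1 * 2 * b k)) by apply: is_cvg_seriesZ.
have [g gP] := weierstrass_M_test ab sb2.
have cg : continuous g.
  apply: uniform_limit_ct => eps e0; have [K0 H] := gP _ e0.
  by exists (fun x => \sum_(0 <= k < K0) a k x); [exact: ct_sum|exact: H].
have fg x : 0 <= x <= h -> f x - g x = 0.
  apply: (@cosine_complete _ h (fun x => f x - g x)) => //; first ct.
  move=> j; apply/eqP; rewrite -normr_eq0 eq_le normr_ge0 andbT.
  apply/ler_addgt0Pl => eps e0; rewrite addr0.
  have eh : 0 < eps / h by rewrite divr_gt0.
  have [K0 H] := gP _ eh.
  pose K := maxn K0 j.+1.
  pose S x := \sum_(0 <= k < K) a k x.
  have cS : continuous S by exact: ct_sum.
  (* The partial sum already contains the frequency [j], so its [j]-th coefficient is that of [f].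
     What remains is the tail [S - g], which is uniformly small. *)
  have fS0 : RI 0 h (fun x => (f x - S x) * cos (j%:R * (pi * x / h))) = 0.
    rewrite (@eq_RI _ _ _ _ (fun x => f x * cos (j%:R * (pi * x / h)) -
       \sum_(0 <= k < K) h^-1 * (cw2 k * c k) *
         (cos (k%:R * (pi * x / h)) * cos (j%:R * (pi * x / h))))); last first.
      move=> y _; rewrite mulrBl; congr (_ - _); rewrite /S mulr_suml.
      by apply: eq_bigr => k _; rewrite /a; ring.
    rewrite RIB; [|cw|apply: continuousW; apply: ct_sum => k; ct].
    rewrite RI_sum; last by move=> k; cw.
    rewrite (bigD1_seq j)/= ?iota_uniq// ?mem_index_iota ?leq_maxr//.
    rewrite RIZ; [|cw]; rewrite RI_cos_cosE// eqxx big1 ?addr0 => [|k kj].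
      rewrite -/(c j); have : cw2 j != 0 by rewrite /cw2; case: ifP => _; rewrite ?oner_eq0 ?pnatr_eq0.
      by move=> cj; field; rewrite ?cj ?(gt_eqF h0).
    by rewrite RIZ; [|cw]; rewrite RI_cos_cosE// (negPf kj) mulr0.
  rewrite (@eq_RI _ _ _ _ (fun x => (f x - S x) * cos (j%:R * (pi * x / h)) +
     (S x - g x) * cos (j%:R * (pi * x / h)))); last by move=> y _; ring.
  rewrite RID; [|cw|cw]; rewrite fS0 add0r.
  rewrite (_ : eps = eps / h * (h - 0)); last by rewrite subr0 divfK// gt_eqF.
  apply: RI_bound; [exact: ltW|cw|] => y _.
  rewrite normrM -[leRHS]mulr1; apply: ler_pM => //; last exact: cos_max.
  by rewrite distrC; apply: H; rewrite leq_maxl.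
move=> x xh; apply: cvg_seqI => eps e0; have [K0 H] := gP _ e0.
exists K0 => K K0K; have := H K K0K x; rewrite /a -mulr_sumr.
by have /eqP := fg x xh; rewrite subr_eq0 => /eqP ->.
Qed.

Lemma RI_blocks G (q : R) N : 0 < q -> continuous G ->
  RI 0 (q * N%:R) G = \sum_(0 <= n < N) RI (q * n%:R) (q * n.+1%:R) G.
Proof.
move=> q0 cG; elim: N => [|N IH]; first by rewrite mulr0 RI_id big_nil.
rewrite big_nat_recr//= -IH; apply: RI_split; last exact: continuousW.
  by rewrite mulr_ge0// ltW.
by rewrite ler_pM2l// ler_nat.
Qed.

(** Poisson summation for the even extension of [F]. Each block [[q n, q (n + 1)]] is folded at its
    midpoint onto [[0, q / 2]]; the resulting function [Phi] has the cosine coefficients [c k], and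
    its cosine series is evaluated at 0. *)
Lemma poisson1 (F : R -> R) (q X : R) (N : nat) (b : nat -> R) :
  0 < q -> 0 <= X -> X <= q * N%:R -> continuous F -> (forall y, X <= y -> F y = 0) ->
  let c k := RI 0 X (fun y => F y * cos (2 * pi * k%:R / q * y)) in
  (forall k, `|c k| <= b k) -> cvgn (series b) ->
  \sum_(0 <= k < K) cw2 k * c k @[K --> \oo] --> q / 2 * \sum_(0 <= n < N) cw2 n * F (q * n%:R).
Proof.
move=> q0 X0 XN cF F0 c cb sb.
pose h := q / 2; have h0 : 0 < h by rewrite divr_gt0.
pose Phi u := \sum_(0 <= n < N) (F (q * n%:R + u) + F (q * n.+1%:R - u)).
have cadd z : continuous (fun u : R => F (z + u)) by ct.
have csub z : continuous (fun u : R => F (z - u)) by ct.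
have cPhi : continuous Phi by apply: ct_sum => n; apply: ct_D.
have cE k : RI 0 h (fun x => Phi x * cos (k%:R * (pi * x / h))) = c k.
  pose w : R := 2 * pi * k%:R / q.
  pose G y := F y * cos (w * y).
  have cG : continuous G by rewrite /G; ct.
  have wE x : k%:R * (pi * x / h) = w * x by rewrite /w /h; field; rewrite gt_eqF.
  transitivity (RI 0 (q * N%:R) G).
    rewrite RI_blocks// (@eq_RI _ _ _ _ (fun x => \sum_(0 <= n < N) (G (q * n%:R + x) + G (q * n.+1%:R - x)))).
      rewrite RI_sum; last first.
        by move=> n; apply: continuousW; apply: ct_D; ct.
      apply: eq_bigr => n _; rewrite RID; [|cw..].
      rewrite RI_shift// RI_reflect//.
      have -> : q * n.+1%:R - h = q * n%:R + h by rewrite -natr1 /h; field.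
      by rewrite -RI_split//; [rewrite lerDl ltW|rewrite -natr1 mulrDr mulr1 lerD2l /h; lra|exact: continuousW].
    move=> x _; rewrite /Phi mulr_suml; apply: eq_bigr => n _; rewrite mulrDl wE /G.
    have wq (m : nat) : w * (q * m%:R) = (k * m)%:R * (2 * pi).
      by rewrite natrM /w; field; rewrite gt_eqF.
    congr (_ * _ + _ * _).
      by rewrite mulrDr wq [_ + w * x]addrC cos_natmul2pi.
    by rewrite mulrBr wq [_ - w * x]addrC cos_natmul2pi cosN.
  rewrite (@RI_split _ X)//; last exact: continuousW.
  rewrite [X in _ + X](@eq_RI _ _ _ _ (fun=> 0)) ?RI0 ?addr0//.
  by move=> y /andP[Xy _]; rewrite /G F0// mul0r.
have cb' k : `|RI 0 h (fun x => Phi x * cos (k%:R * (pi * x / h)))| <= b k by rewrite cE.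
have h00 : 0 <= (0 : R) <= h by rewrite lexx ltW.
have H := @cosine_series h Phi b h0 cPhi cb' sb 0 h00.
have -> : q / 2 * \sum_(0 <= n < N) cw2 n * F (q * n%:R) = h * Phi 0.
  congr (_ * _); rewrite /Phi.
  under [RHS]eq_bigr do rewrite addr0 subr0.
  rewrite big_split/=.
  (* The shifted sum drops [n = 0] and gains [n = N], where [F] vanishes because [X <= q * N%:R]. So
     0 is counted once and every other point twice. *)
  have -> : \sum_(0 <= n < N) F (q * n.+1%:R) = \sum_(0 <= n < N) (if n == 0%N then 0 else F (q * n%:R)).
    case: N XN {Phi cPhi cE cb' H} => [|N] XN; first by rewrite !big_nil.
    rewrite big_nat_recr//= big_nat_recl//= add0r F0// addr0.
    by apply: eq_big_nat.
  by rewrite -big_split/=; apply: eq_bigr => n _; rewrite /cw2; case: eqP => _; ring.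
have -> : (fun K => \sum_(0 <= k < K) cw2 k * c k) = fun K => h * (h^-1 * \sum_(0 <= k < K)
   cw2 k * RI 0 h (fun x => Phi x * cos (k%:R * (pi * x / h))) * cos (k%:R * (pi * 0 / h))).
  apply/funext => K; rewrite mulrA divff ?gt_eqF// mul1r; apply: eq_bigr => k _.
  by rewrite cE mulr0 mul0r mulr0 cos0 mulr1.
by apply: cvgMr; exact: H.
Qed.

End cosine_series.

(** * Fourier transform of a paraboloid on the disc *)

Section bessel_type_ode.
Variable R : realType.
Implicit Types (x y z a b : R).

Lemma is_derive_ge0_le (f df : R -> R) a b : a <= b ->
  (forall x, a <= x <= b -> is_derive x 1 f (df x)) ->
  (forall x, a <= x <= b -> 0 <= df x) -> f a <= f b.
Proof.
rewrite le_eqVlt => /predU1P[->//|ab D df0].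
have [|//|c cab E] := @MVT _ f df a b ab.
- by move=> x; rewrite in_itv/= => /andP[? ?]; apply: D; rewrite !ltW.
- exact: is_derive_within_ct D.
- rewrite -subr_ge0 E mulr_ge0 ?subr_ge0 ?(ltW ab)// df0//.
  by move: cab; rewrite in_itv/= => /andP[? ?]; rewrite !ltW.
Qed.

Lemma dv_V (f : R -> R) x a : f x != 0 -> is_derive x 1 f a ->
  is_derive x 1 (fun y => (f y)^-1) (- a / f x ^+ 2).
Proof.
move=> fx0 Df; have H := is_deriveV fx0 Df.
by apply: (dv_eq H); rewrite /GRing.scale/= mulrC mulNr mulrN mulrC.
Qed.

Lemma dv_inv x : x != 0 -> is_derive x 1 (fun y : R => y^-1) (- x ^- 2).
Proof. by move=> x0; apply: (dv_eq (dv_V x0 (dv_id x))); rewrite mulN1r. Qed.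

Lemma dv_expR (f : R -> R) x a : is_derive x 1 f a ->
  is_derive x 1 (fun y => expR (f y)) (expR (f x) * a).
Proof. by move=> Df; exact: (dv_comp (is_derive_expR _) Df). Qed.

(** [f + K / x] is nonincreasing and [f - K / x] is nondecreasing, so the supremum of the latter is
    the limit and lies within [K / x] of [f x]. *)
Lemma limit_of_integrable_derivative (f df : R -> R) (K : R) :
  (forall x, 1 <= x -> is_derive x 1 f (df x)) ->
  (forall x, 1 <= x -> `|df x| <= K / x ^+ 2) ->
  exists l, forall x, 1 <= x -> `|f x - l| <= K / x.
Proof.
move=> Df dfK.
have dV x : 1 <= x -> is_derive x 1 (fun y : R => y^-1) (- x ^- 2).
  by move=> x1; apply: dv_inv; rewrite gt_eqF// (lt_le_trans _ x1).
have up y z : 1 <= y -> y <= z -> f z + K / z <= f y + K / y.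
  move=> y1 yz; rewrite -lerN2.
  apply: (@is_derive_ge0_le (fun x => - (f x + K * x^-1)) (fun x => - (df x - K * x ^- 2)) y z) => //.
    move=> x /andP[yx _]; have x1 := le_trans y1 yx; have D1 := Df x x1; have D2 := dV x x1.
    by dvr.
  move=> x /andP[yx _]; have x1 := le_trans y1 yx; have := dfK x x1.
  by rewrite ler_norml => /andP[]; lra.
have dn y z : 1 <= y -> y <= z -> f y - K / y <= f z - K / z.
  move=> y1 yz.
  apply: (@is_derive_ge0_le (fun x => f x - K * x^-1) (fun x => df x + K * x ^- 2) y z) => //.
    move=> x /andP[yx _]; have x1 := le_trans y1 yx; have D1 := Df x x1; have D2 := dV x x1.
    by dvr.
  move=> x /andP[yx _]; have x1 := le_trans y1 yx; have := dfK x x1.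
  by rewrite ler_norml => /andP[]; lra.
have Kx x : 1 <= x -> 0 <= K / x.
  move=> x1; have x0 : 0 < x by rewrite (lt_le_trans _ x1).
  have := le_trans (normr_ge0 _) (dfK x x1).
  by rewrite !pmulr_lge0 ?invr_gt0// exprn_gt0.
have cross y z : 1 <= y -> 1 <= z -> f y - K / y <= f z + K / z.
  move=> y1 z1; have [yz|/ltW zy] := leP y z.
    by have := dn y z y1 yz; have := Kx z z1; lra.
  by have := up z y z1 zy; have := Kx y y1; lra.
pose A := [set u | exists2 y, 1 <= y & u = f y - K / y].
have A0 : A !=set0 by exists (f 1 - K / 1), 1.
have Aub z : 1 <= z -> ubound A (f z + K / z) by move=> z1 _ [y y1 ->]; exact: cross.
exists (sup A) => x x1.
have s1 : sup A <= f x + K / x by apply: ge_sup => //; exact: Aub.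
have s2 : f x - K / x <= sup A.
  by apply: sup_upper_bound; [split => //; exists (f 1 + K / 1); exact: Aub|exists x].
by rewrite ler_norml; apply/andP; split; lra.
Qed.

(* Variation of constants: [w cos - v sin] and [w sin + v cos] have derivatives of size
   [O(1/z^2)], because the energy [w^2 + v^2] stays bounded. *)
Lemma perturbed_oscillator (N1 : R) : 0 <= N1 -> exists2 C : R, 0 < C &
  forall w v : R -> R,
  (forall z, 1 <= z -> is_derive z 1 w (v z)) ->
  (forall z, 1 <= z -> is_derive z 1 v (- w z + 15 / 4 * w z / z ^+ 2)) ->
  w 1 ^+ 2 + v 1 ^+ 2 <= N1 ->
  exists c s, [/\ `|c| <= C, `|s| <= C &
    forall z, 1 <= z -> `|w z - (c * cos z + s * sin z)| <= C / z].
Proof.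
(* Gronwall: the energy has derivative [15 / 2 * w * v / z ^+ 2], at most [15 / 4 / z ^+ 2] times
   itself, and [z^(-2)] has integral 1 over [[1, oo)]. The added 1 makes [Q >= 1], so that a square
   bounded by [Q] has root bounded by [Q]. *)
move=> N10; pose Q := N1 * expR (15 / 4) + 1.
have Q1 : 1 <= Q by rewrite /Q lerDr mulr_ge0// expR_ge0.
pose K := 15 / 4 * Q; exists (2 * Q + 2 * K); first by rewrite /K; lra.
move=> w v Dw Dv init.
pose E z := w z ^+ 2 + v z ^+ 2.
have z0 z : 1 <= z -> 0 < z by move=> z1; rewrite (lt_le_trans _ z1).
have dV x : 1 <= x -> is_derive x 1 (fun y : R => y^-1) (- x ^- 2).
  by move=> x1; apply: dv_inv; rewrite gt_eqF// z0.
have Ele z : 1 <= z -> E z <= Q.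
  move=> z1.
  have : - (E 1 * expR (15 / 4 * 1^-1)) <= - (E z * expR (15 / 4 * z^-1)).
    apply: (@is_derive_ge0_le (fun x => - (E x * expR (15 / 4 * x^-1)))
       (fun x => - ((15 / 2 * w x * v x / x ^+ 2 - E x * (15 / 4) / x ^+ 2) * expR (15 / 4 * x^-1)))) => //.
      move=> x /andP[x1 _]; have D1 := Dw x x1; have D2 := Dv x x1; have D3 := dV x x1.
      have D4 : is_derive x 1 (fun x => 15 / 4 * x^-1) (- (15 / 4) * x ^- 2) by dvr.
      have D5 := dv_expR D4.
      by rewrite /E; dvr; field; rewrite gt_eqF// z0.
    move=> x /andP[x1 _]; rewrite oppr_ge0; apply: mulr_le0_ge0; last exact: expR_ge0.
    rewrite -mulrBl; apply: mulr_le0_ge0; last by rewrite invr_ge0 exprn_ge0// ltW// z0.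
    by have := sqr_ge0 (w x - v x); rewrite /E; lra.
  rewrite lerN2 invr1 mulr1 => H.
  have e1 : 1 <= expR (15 / 4 * z^-1).
    by rewrite -[leLHS]expR0 ler_expR mulr_ge0// invr_ge0 ltW// z0.
  have E0 : 0 <= E z by rewrite addr_ge0 ?sqr_ge0.
  have E1 : E z <= E z * expR (15 / 4 * z^-1) by rewrite ler_peMr.
  rewrite (le_trans E1)// (le_trans H)// /Q.
  by rewrite (@le_trans _ _ (N1 * expR (15 / 4))) ?lerDl// ler_wpM2r// expR_ge0.
have wQ z : 1 <= z -> `|w z| <= Q.
  move=> z1; have := Ele z z1; have := sqr_ge0 (v z); rewrite /E.
  by rewrite ler_norml => v2 wE; apply/andP; split; nra.
have vQ z : 1 <= z -> `|v z| <= Q.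
  move=> z1; have := Ele z z1; have := sqr_ge0 (w z); rewrite /E.
  by rewrite ler_norml => v2 wE; apply/andP; split; nra.
have bK (t u : R) z : 1 <= z -> `|t| <= Q -> `|u| <= 1 -> `|15 / 4 * t * u / z ^+ 2| <= K / z ^+ 2.
  move=> z1 tQ u1; rewrite /K -[leRHS]mulr1 mulrAC; apply: normM_le => //.
  apply: normM_le; first by apply: normM_le => //; rewrite ger0_norm//; lra.
  by rewrite ger0_norm// invr_ge0 exprn_ge0// ltW// z0.
have [c cP] := @limit_of_integrable_derivative (fun z => w z * cos z - v z * sin z)
  (fun z => - (15 / 4 * w z * sin z / z ^+ 2)) K
  ltac:(move=> z z1; have D1 := Dw z z1; have D2 := Dv z z1; dvr)
  ltac:(move=> z z1; rewrite normrN; apply: bK => //; [exact: wQ|exact: sin_max]).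
have [s sP] := @limit_of_integrable_derivative (fun z => w z * sin z + v z * cos z)
  (fun z => 15 / 4 * w z * cos z / z ^+ 2) K
  ltac:(move=> z z1; have D1 := Dw z z1; have D2 := Dv z z1; dvr)
  ltac:(move=> z z1; apply: bK => //; [exact: wQ|exact: cos_max]).
have K0 : 0 <= K by rewrite /K; lra.
have wc := normM_le (wQ 1 (lexx _)) (cos_max 1).
have ws := normM_le (wQ 1 (lexx _)) (sin_max 1).
have vc := normM_le (vQ 1 (lexx _)) (cos_max 1).
have vs := normM_le (vQ 1 (lexx _)) (sin_max 1).
exists c, s; split.
- have := cP 1 (lexx _); rewrite divr1; move: wc vs; rewrite !ler_norml.
  by move=> /andP[? ?] /andP[? ?] /andP[? ?]; apply/andP; split; lra.
- have := sP 1 (lexx _); rewrite divr1; move: ws vc; rewrite !ler_norml.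
  by move=> /andP[? ?] /andP[? ?] /andP[? ?]; apply/andP; split; lra.
- move=> z z1.
  have -> : w z - (c * cos z + s * sin z) =
     (w z * cos z - v z * sin z - c) * cos z + (w z * sin z + v z * cos z - s) * sin z.
    have -> : w z - (c * cos z + s * sin z) =
      w z * (cos z ^+ 2 + sin z ^+ 2) - (c * cos z + s * sin z) by rewrite cos2Dsin2 mulr1.
    by ring.
  rewrite (le_trans (ler_normD _ _))//.
  have t1 := normM_le (cP z z1) (cos_max z); have t2 := normM_le (sP z z1) (sin_max z).
  rewrite (le_trans (lerD t1 t2))// !mulr1 -mulrDl ler_wpM2r ?invr_ge0 ?(ltW (z0 z z1))//.
  lra.
Qed.

End bessel_type_ode.

(** * The disc integrals and the differential relations between them *)

Section disc_transform.
Variable R : realType.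
Implicit Types (w x y : R).

(** The integral of [cos (w * v)] over [[0, y]], with the removable singularity at [w = 0] filled
    in. *)
Definition sinq w y : R := if w == 0 then y else sin (w * y) / w.

(* [parq w Y] is the integral of [(Y^2 - v^2) cos (w v)] over [0, Y]. *)
Definition parq w y : R :=
  if w == 0 then 2 / 3 * y ^+ 3 else (2 * sinq w y - 2 * y * cos (w * y)) / w ^+ 2.

Lemma dv_sinq w y : is_derive y 1 (sinq w) (cos (w * y)).
Proof.
rewrite /sinq; case: eqP => [->|/eqP w0].
  by apply: (dv_eq (dv_id y)); rewrite mul0r cos0.
by dvr; field.
Qed.

Lemma dv_parq w y : is_derive y 1 (parq w) (2 * y * sinq w y).
Proof.
have Ds := dv_sinq w y.
rewrite /parq; case: eqP => [w0|/eqP w0].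
  by dvr; rewrite /sinq w0 eqxx; field.
by dvr; rewrite /sinq (negPf w0); field.
Qed.

Lemma ct_sinq w : continuous (sinq w).
Proof. by move=> y; apply: is_derive1_continuous; exact: dv_sinq. Qed.

Lemma ct_parq w : continuous (parq w).
Proof. by move=> y; apply: is_derive1_continuous; exact: dv_parq. Qed.

Lemma sinq0 w : sinq w 0 = 0.
Proof. by rewrite /sinq mulr0 sin0 mul0r; case: ifP. Qed.

Lemma parq0 w : parq w 0 = 0.
Proof. by rewrite /parq sinq0 mulr0 mul0r subr0 mul0r expr0n mulr0; case: ifP. Qed.

Lemma parq_eq w y : w ^+ 2 * parq w y = 2 * sinq w y - 2 * y * cos (w * y).
Proof.
rewrite /parq; case: eqP => [w0|/eqP w0].
  by rewrite /sinq w0 eqxx mul0r cos0 expr0n/=; ring.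
by rewrite mulrCA divff ?mulr1// expf_eq0.
Qed.

Lemma sinq_le w y : 0 <= y -> `|sinq w y| <= y.
Proof.
rewrite le_eqVlt => /predU1P[<-|y0]; first by rewrite sinq0 normr0.
have cc : {within `[0, y], continuous (fun u : R => cos (w * u))} by cw.
have -> : sinq w y = sinq w y - sinq w 0 by rewrite sinq0 subr0.
rewrite -(RI_FTCc y0 cc (fun u _ => dv_sinq w u)).
apply: le_trans (RI_bound (ltW y0) cc (fun u _ => cos_max (w * u))) _.
by rewrite mul1r subr0.
Qed.

Lemma parq_le w y : 0 <= y -> `|parq w y| <= 2 * y ^+ 3.
Proof.
rewrite le_eqVlt => /predU1P[<-|y0]; first by rewrite parq0 normr0 expr0n/= mulr0.
have cs := ct_sinq (w := w).
have cc : {within `[0, y], continuous (fun u : R => 2 * u * sinq w u)} by cw.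
have -> : parq w y = parq w y - parq w 0 by rewrite parq0 subr0.
rewrite -(RI_FTCc y0 cc (fun u _ => dv_parq w u)).
have b u : 0 <= u <= y -> `|2 * u * sinq w u| <= 2 * y * y.
  move=> /andP[u0 uy]; apply: normM_le; last exact: le_trans (sinq_le w u0) uy.
  by rewrite ger0_norm ?mulr_ge0// ler_pM2l.
apply: le_trans (RI_bound (ltW y0) cc b) _.
by rewrite subr0 !exprS expr0 !mulr1 !mulrA.
Qed.

Lemma parq_decay w y : 0 <= y -> w != 0 -> `|parq w y| <= 4 * y / w ^+ 2.
Proof.
move=> y0 w0; rewrite /parq (negPf w0); apply: normM_le.
  have := sinq_le w y0; have := cos_max (w * y); rewrite !ler_norml.
  by move=> /andP[? ?] /andP[? ?]; apply/andP; split; nra.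
by rewrite ger0_norm// invr_ge0 sqr_ge0.
Qed.

Lemma RI_parq w y : 0 <= y -> RI 0 y (fun v => (y ^+ 2 - v ^+ 2) * cos (w * v)) = parq w y.
Proof.
rewrite le_eqVlt => /predU1P[<-|y0]; first by rewrite parq0 RI_id.
have cc : {within `[0, y], continuous (fun v : R => (y ^+ 2 - v ^+ 2) * cos (w * v))} by cw.
have D (v : R) : 0 <= v <= y ->
    is_derive v 1 (fun v => (y ^+ 2 - v ^+ 2) * sinq w v + parq w v) ((y ^+ 2 - v ^+ 2) * cos (w * v)).
  by move=> _; have D1 := dv_sinq w v; have D2 := dv_parq w v; dvr.
by rewrite (RI_FTCc y0 cc D) subrr mul0r add0r sinq0 mulr0 add0r parq0 subr0.
Qed.

(* Up to the factor 4, [discF x l1 l2] is the integral of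
   [(x^2 - |p|^2) cos (l1 p1) cos (l2 p2)] over the disc of radius [x] (with [p1 = x sin th]),
   [discD] that of [cos (l1 p1) cos (l2 p2)], and [discE] is the derivative of [discD]. *)
Definition discF (l1 l2 x : R) := RI 0 (pi / 2)
  (fun th => parq l2 (x * cos th) * cos (l1 * (x * sin th)) * (x * cos th)).
Definition discD (l1 l2 x : R) := RI 0 (pi / 2)
  (fun th => sinq l2 (x * cos th) * cos (l1 * (x * sin th)) * (x * cos th)).
Definition discE (l1 l2 x : R) := RI 0 (pi / 2)
  (fun th => cos (l2 * (x * cos th)) * cos (l1 * (x * sin th)) * x).

Let pi2 : 0 < pi / 2 :> R.
Proof. by rewrite divr_gt0// pi_gt0. Qed.

(** The derivative of a disc integral in the radius is the integral over the bounding circle.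
    Differentiation under the integral yields [g], which differs from the integrand of [discE] by
    the derivative of [A], and [A] vanishes at both ends. *)
Lemma dv_discD (l1 l2 x : R) : is_derive x 1 (discD l1 l2) (discE l1 l2 x).
Proof.
have cs := ct_sinq (w := l2).
pose f x th := sinq l2 (x * cos th) * cos (l1 * (x * sin th)) * (x * cos th).
pose g x th := cos (l2 * (x * cos th)) * cos (l1 * (x * sin th)) * (x * (1 - sin th ^+ 2))
  + sinq l2 (x * cos th) * (cos (l1 * (x * sin th)) * cos th
     - l1 * sin th * sin (l1 * (x * sin th)) * (x * cos th)).
have -> : discE l1 l2 x = RI 0 (pi / 2) (g x).
  pose A th := sinq l2 (x * cos th) * cos (l1 * (x * sin th)) * sin th.
  pose dA th := g x th - cos (l2 * (x * cos th)) * cos (l1 * (x * sin th)) * x.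
  have cA : {within `[0, pi / 2], continuous dA} by rewrite /dA /g; cw.
  have DA th : 0 <= th <= pi / 2 -> is_derive th 1 A (dA th).
    move=> _; have D1 := dv_sinq l2 (x * cos th).
    by rewrite /A /dA /g; dvr.
  have := RI_FTCc pi2 cA DA.
  rewrite /A cos_pihalf mulr0 sinq0 !mul0r sin0 mulr0 subr0 /dA RIB; [|rewrite /g; cw|cw].
  by move/eqP; rewrite subr_eq0 => /eqP ->.
apply: (@is_derive_RI_param _ f g).
- by rewrite /f; ct.
- by rewrite /g; ct.
- move=> y th _; have D1 := dv_sinq l2 (y * cos th).
  rewrite /f /g; dvr; rewrite -cos2sin2; ring.
Qed.

(** The paraboloid vanishes on the bounding circle, so only its own derivative [2 * x] in the radius
    survives. The bookkeeping is that of [dv_discD]. *)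
Lemma dv_discF (l1 l2 x : R) : is_derive x 1 (discF l1 l2) (2 * x * discD l1 l2 x).
Proof.
have cs := ct_sinq (w := l2).
have cp := ct_parq (w := l2).
pose f x th := parq l2 (x * cos th) * cos (l1 * (x * sin th)) * (x * cos th).
pose g x th := 2 * x * (sinq l2 (x * cos th) * cos (l1 * (x * sin th)) * (x * cos th)) * (1 - sin th ^+ 2)
  + parq l2 (x * cos th) * (cos (l1 * (x * sin th)) * cos th
     - l1 * sin th * sin (l1 * (x * sin th)) * (x * cos th)).
have -> : 2 * x * discD l1 l2 x = RI 0 (pi / 2) (g x).
  pose A th := parq l2 (x * cos th) * cos (l1 * (x * sin th)) * sin th.
  pose dA th := g x th - 2 * x * (sinq l2 (x * cos th) * cos (l1 * (x * sin th)) * (x * cos th)).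
  have cA : {within `[0, pi / 2], continuous dA} by rewrite /dA /g; cw.
  have DA th : 0 <= th <= pi / 2 -> is_derive th 1 A (dA th).
    move=> _; have D1 := dv_parq l2 (x * cos th).
    by rewrite /A /dA /g; dvr.
  have := RI_FTCc pi2 cA DA.
  rewrite /A cos_pihalf mulr0 parq0 !mul0r sin0 mulr0 subr0 /dA RIB; [|rewrite /g; cw|cw].
  by move/eqP; rewrite subr_eq0 => /eqP ->; rewrite RIZ//; cw.
apply: (@is_derive_RI_param _ f g).
- by rewrite /f; ct.
- by rewrite /g; ct.
- move=> y th _; have D1 := dv_parq l2 (y * cos th).
  rewrite /f /g; dvr; rewrite -cos2sin2; ring.
Qed.

(* Green's identity on the disc, in polar form. *)
Lemma disc_green (l1 l2 x : R) :
  (l1 ^+ 2 + l2 ^+ 2) * discF l1 l2 x = 4 * discD l1 l2 x - 2 * x * discE l1 l2 x.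
Proof.
have cs := ct_sinq (w := l2).
have cp := ct_parq (w := l2).
pose A th := l1 * parq l2 (x * cos th) * sin (l1 * (x * sin th))
  - 2 * x * sinq l2 (x * cos th) * cos (l1 * (x * sin th)) * sin th.
pose F th := parq l2 (x * cos th) * cos (l1 * (x * sin th)) * (x * cos th).
pose D th := sinq l2 (x * cos th) * cos (l1 * (x * sin th)) * (x * cos th).
pose E th := cos (l2 * (x * cos th)) * cos (l1 * (x * sin th)) * x.
pose dA th := (l1 ^+ 2 + l2 ^+ 2) * F th - (4 * D th - 2 * x * E th).
have cA : {within `[0, pi / 2], continuous dA} by rewrite /dA /F /D /E; cw.
have DA th : 0 <= th <= pi / 2 -> is_derive th 1 A (dA th).
  move=> _; have D1 := dv_parq l2 (x * cos th); have D2 := dv_sinq l2 (x * cos th).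
  rewrite /A /dA /F /D /E; dvr.
  (* The product of [l2 ^+ 2] with [parq] is isolated, because [parq_eq] rewrites it without
     excluding [l2 = 0]. *)
  rewrite [(l1 ^+ 2 + l2 ^+ 2) * _]mulrDl.
  rewrite [l2 ^+ 2 * _]mulrA [l2 ^+ 2 * (_ * _)]mulrA parq_eq.
  have s2 : cos th ^+ 2 = 1 - sin th ^+ 2 by exact: cos2sin2.
  ring: s2.
have := RI_FTCc pi2 cA DA.
rewrite /A cos_pihalf sin0 !(mulr0, mul0r, parq0, sinq0, sin0, subr0) /dA.
rewrite RIB; [|rewrite /F; cw|rewrite /D /E; cw].
rewrite RIB; [|rewrite /D; cw|rewrite /E; cw].
rewrite !RIZ; [|rewrite /E; cw|rewrite /D; cw|rewrite /F; cw].
by move/eqP; rewrite subr_eq0 => /eqP.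
Qed.

End disc_transform.

(** * Asymptotics of the disc transform, uniform in the frequencies *)

Section disc_asymptotics.
Variable R : realType.
Implicit Types (w x y z : R).

Let pi2 : 0 < pi / 2 :> R.
Proof. by rewrite divr_gt0// pi_gt0. Qed.

Let pi2_le2 : pi / 2 <= 2 :> R.
Proof. exact: ltW (pihalf_lt2 R). Qed.

Lemma cos_pihalf01 (th : R) : 0 <= th <= pi / 2 -> 0 <= cos th <= 1.
Proof.
move=> /andP[t0 t1]; rewrite cos_le1 andbT cos_ge0_pihalf// t1 andbT.
by rewrite (le_trans _ t0)// oppr_le0 ltW.
Qed.

Lemma discD_le (l1 l2 x : R) : 0 <= x -> `|discD l1 l2 x| <= 2 * x ^+ 2.
Proof.
move=> x0; have cs := ct_sinq (w := l2).
have cc : {within `[0, pi / 2], continuous (fun th : R =>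
   sinq l2 (x * cos th) * cos (l1 * (x * sin th)) * (x * cos th))} by cw.
have b th : 0 <= th <= pi / 2 ->
    `|sinq l2 (x * cos th) * cos (l1 * (x * sin th)) * (x * cos th)| <= x * 1 * x.
  move=> /cos_pihalf01/andP[c0 c1].
  have xc : x * cos th <= x by rewrite ler_piMr.
  have xc0 : 0 <= x * cos th by rewrite mulr_ge0.
  apply: normM_le; last by rewrite ger0_norm.
  by apply: normM_le; [exact: le_trans (sinq_le l2 xc0) xc|exact: cos_max].
apply: le_trans (RI_bound (ltW pi2) cc b) _.
by rewrite subr0 mulr1 mulrC -expr2 ler_wpM2r// sqr_ge0.
Qed.

Lemma discF_le (l1 l2 x : R) : 0 <= x -> `|discF l1 l2 x| <= 4 * x ^+ 4.
Proof.
move=> x0; have cs := ct_parq (w := l2).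
have cc : {within `[0, pi / 2], continuous (fun th : R =>
   parq l2 (x * cos th) * cos (l1 * (x * sin th)) * (x * cos th))} by cw.
have b th : 0 <= th <= pi / 2 ->
    `|parq l2 (x * cos th) * cos (l1 * (x * sin th)) * (x * cos th)| <= 2 * x ^+ 3 * 1 * x.
  move=> /cos_pihalf01/andP[c0 c1].
  have xc : x * cos th <= x by rewrite ler_piMr.
  have xc0 : 0 <= x * cos th by rewrite mulr_ge0.
  apply: normM_le; last by rewrite ger0_norm.
  apply: normM_le; last exact: cos_max.
  apply: (le_trans (parq_le l2 xc0)); rewrite ler_pM2l//.
  by rewrite lerXn2r.
apply: le_trans (RI_bound (ltW pi2) cc b) _.
rewrite subr0 mulr1 -mulrA -exprSr mulrAC ler_wpM2r ?exprn_ge0//.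
by rewrite (le_trans (ler_wpM2l _ pi2_le2))//; lra.
Qed.

Lemma dv_scale (f df : R -> R) (r z : R) : (forall x, is_derive x 1 f (df x)) ->
  is_derive z 1 (fun z => f (z / r)) (df (z / r) / r).
Proof. by move=> Df; have D := Df (z / r); dvr. Qed.

(* [r^4 discF(z/r)] solves [h' = 2 z d], [d' = (4 d - h) / (2 z)] independently of the
   frequencies, and [z^(-3/2) h] is then a perturbed oscillator. *)
Lemma discF_asymptotics : exists2 C : R, 0 < C & forall l1 l2 r : R, 0 < r ->
  r ^+ 2 = l1 ^+ 2 + l2 ^+ 2 ->
  exists cs : R * R, [/\ `|cs.1| <= C, `|cs.2| <= C & forall x, 1 <= r * x ->
    `|discF l1 l2 x - x `^ (3 / 2) * r `^ (- (5 / 2)) * (cs.1 * cos (r * x) + cs.2 * sin (r * x))|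
    <= C * (x `^ (3 / 2) * r `^ (- (5 / 2)) / (r * x))].
Proof.
(* At [z = 1], [h] is at most 4 and [d] at most 2 in absolute value, so [w] is at most 4 and
   [v = 2 d - 3/2 h] at most 10. Hence any bound from 16 + 100 upwards serves. *)
have [C C0 HC] := @perturbed_oscillator R 200 (ler0n _ _).
exists C => // l1 l2 r r0 r2.
(* In the variable [z = r x] the frequencies drop out: in closed form [h z] is [pi z^2 J_2(z)]. *)
pose h z := r ^+ 4 * discF l1 l2 (z / r).
pose d z := r ^+ 2 * discD l1 l2 (z / r).
pose e z := r * discE l1 l2 (z / r).
have rn0 : r != 0 by rewrite gt_eqF.
have he z : h z = 4 * d z - 2 * z * e z.
  have := disc_green l1 l2 (z / r); rewrite -r2 /h /d /e => G.
  have -> : r ^+ 4 * discF l1 l2 (z / r) = r ^+ 2 * (r ^+ 2 * discF l1 l2 (z / r)) by ring.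
  by rewrite G; field.
have Dh z : is_derive z 1 h (2 * z * d z).
  have D := dv_scale r z (dv_discF l1 l2).
  by rewrite /h /d; dvr; field.
have Dd z : is_derive z 1 d (e z).
  have D := dv_scale r z (dv_discD l1 l2).
  by rewrite /d /e; dvr; field.
pose s z : R := z `^ (- (3 / 2)).
pose w z := s z * h z.
pose v z := s z * (2 * z * d z - 3 / 2 * h z / z).
have z0 z : 1 <= z -> 0 < z by move=> z1; rewrite (lt_le_trans _ z1).
have Ds z : 1 <= z -> is_derive z 1 s (- (3 / 2) * s z / z).
  move=> /z0 zz; apply: (dv_eq (is_derive1_powR (- (3 / 2)) zz)).
  have zn0 : z != 0 by rewrite gt_eqF.
  by rewrite powRB ?zn0 ?implybT// powRr1 ?(ltW zz)// mulrA.
have dV x : 1 <= x -> is_derive x 1 (fun y : R => y^-1) (- x ^- 2).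
  by move=> x1; apply: dv_inv; rewrite gt_eqF// z0.
have Dw z : 1 <= z -> is_derive z 1 w (v z).
  by move=> z1; have D1 := Dh z; have D2 := Ds z z1; rewrite /w /v; dvr.
have Dv z : 1 <= z -> is_derive z 1 v (- w z + 15 / 4 * w z / z ^+ 2).
  move=> z1; have D1 := Dh z; have D2 := Ds z z1; have D3 := Dd z; have D4 := dV z z1.
  rewrite /w /v; dvr; rewrite he; field.
  by rewrite gt_eqF// z0.
have s1 : s 1 = 1 by rewrite /s powR1.
have h1 : `|h 1| <= 4.
  rewrite /h mul1r normrM (ger0_norm (exprn_ge0 4 (ltW r0))).
  have ri : 0 <= r^-1 by rewrite invr_ge0 ltW.
  have := discF_le l1 l2 ri; rewrite -(ler_pM2l (exprn_gt0 4 r0)) => /le_trans; apply.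
  by rewrite mulrCA -exprMn divff// expr1n mulr1.
have d1 : `|d 1| <= 2.
  rewrite /d mul1r normrM (ger0_norm (exprn_ge0 2 (ltW r0))).
  have ri : 0 <= r^-1 by rewrite invr_ge0 ltW.
  have := discD_le l1 l2 ri; rewrite -(ler_pM2l (exprn_gt0 2 r0)) => /le_trans; apply.
  by rewrite mulrCA -exprMn divff// expr1n mulr1.
have init : w 1 ^+ 2 + v 1 ^+ 2 <= 200.
  rewrite /w /v s1 !mul1r mulr1 divr1.
  move: h1 d1; rewrite !ler_norml => /andP[h1 h2] /andP[d1 d2].
  have sq (u B : R) : - B <= u -> u <= B -> u ^+ 2 <= B ^+ 2.
    move=> u1 u2; have : 0 <= (B - u) * (B + u) by apply: mulr_ge0; lra.
    lra.
  have A1 := sq _ _ h1 h2.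
  have A2 : (2 * d 1 - 3 / 2 * h 1) ^+ 2 <= 10 ^+ 2 by apply: sq; lra.
  lra.
have [c [s' [cC sC cs]]] := HC w v Dw Dv init.
exists (c, s'); split => //= x rx1.
have x0 : 0 < x by rewrite -(pmulr_rgt0 _ r0) z0.
have E : discF l1 l2 x = x `^ (3 / 2) * r `^ (- (5 / 2)) * w (r * x).
  have xE : r * x / r = x by rewrite mulrAC divff// mul1r.
  rewrite /w /s /h xE.
  rewrite powRM ?(ltW r0) ?(ltW x0)// !powRN.
  have -> : r `^ (5 / 2) = r ^+ 4 / r `^ (3 / 2).
    rewrite -powR_mulrn ?(ltW r0)// -powRB ?rn0 ?implybT//; congr (_ `^ _); lra.
  have p1 : r `^ (3 / 2) != 0 by rewrite gt_eqF// powR_gt0.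
  have p2 : x `^ (3 / 2) != 0 by rewrite gt_eqF// powR_gt0.
  by field; rewrite rn0 p1 p2.
rewrite E -mulrBr normrM ger0_norm ?mulr_ge0 ?powR_ge0//.
rewrite [leRHS]mulrCA; apply: ler_wpM2l; first by rewrite mulr_ge0 ?powR_ge0.
exact: cs.
Qed.

End disc_asymptotics.

(** * A summable weight *)

Section weights.
Variable R : realType.

(** The exponent is half of 5/2: as [r^2] dominates a multiple of [(k + 1) (l + 1)], the amplitude
    [r^(-5/2)] is dominated by a multiple of [u54 k * u54 l]. *)
Definition u54 (k : nat) : R := k.+1%:R `^ (- (5 / 4)).

Lemma u54_gt0 k : 0 < u54 k.
Proof. by rewrite powR_gt0// ltr0Sn. Qed.

(** Comparison with the integral of [x^(-5/4)] over [[k + 1, k + 2]], whose primitive is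
    [-4 x^(-1/4)]. *)
Lemma u54_step k : u54 k.+1 <= 4 * (k.+1%:R `^ (- (1 / 4)) - k.+2%:R `^ (- (1 / 4))).
Proof.
have k0 : (0 : R) < k.+1%:R by rewrite ltr0Sn.
have kk : k.+1%:R <= k.+2%:R :> R by rewrite ler_nat.
pose F (x : R) := - 4 * x `^ (- (1 / 4)) - u54 k.+1 * x.
have H : F k.+1%:R <= F k.+2%:R.
  apply: (@is_derive_ge0_le R F (fun x => x `^ (- (5 / 4)) - u54 k.+1) _ _ kk) => x /andP[x1 x2].
    have xp : 0 < x := lt_le_trans k0 x1.
    have D := is_derive1_powR (- (1 / 4)) xp.
    rewrite /F; dvr; rewrite [_ - 1](_ : _ = - (5 / 4)); last by lra.
    by field.
  have xp : 0 < x := lt_le_trans k0 x1.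
  rewrite subr_ge0 /u54 !powRN lef_pV2 ?posrE ?powR_gt0//.
  by apply: ge0_ler_powR => //; rewrite ?nnegrE ?ltW//; lra.
by move: H; rewrite /F -(natr1 k.+1); lra.
Qed.

Lemma cvg_u54 : cvgn (series u54).
Proof.
apply: nondecreasing_is_cvgn.
  move=> m n mn; rewrite /series/= (big_cat_nat _ mn)//= lerDl.
  by apply: sumr_ge0 => k _; exact: ltW (u54_gt0 k).
(* The first term is 1, and the integral of [x^(-5/4)] over [[1, oo)] is 4. *)
exists 5 => _ [n _ <-].
suff H k : series u54 k.+1 <= 5 - 4 * k.+1%:R `^ (- (1 / 4)).
  case: n => [|n]; first by rewrite /series/= big_nil.
  by rewrite (le_trans (H n))// gerBl mulr_ge0// powR_ge0.
elim: k => [|k IH]; first by rewrite /series/= big_nat1 /u54 !powR1; lra.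
have := u54_step k; move: IH; rewrite /series/= [in X in _ -> _ -> X <= _]big_nat_recr//=.
by lra.
Qed.

End weights.

(** * Sums over lattices *)

Section square_sums.
Variable R : realType.

Lemma u54_sum_bound : exists2 U : R, 0 < U & forall n, \sum_(0 <= k < n) u54 R k <= U.
Proof.
exists (limn (series (u54 R)) + 1).
  rewrite ltr_wpDl// (le_trans (y := series (u54 R) 0))//.
    by rewrite /series/= big_nil.
  apply: nondecreasing_cvgn_le; last exact: cvg_u54.
  move=> m n mn; rewrite /series/= (big_cat_nat _ mn)//= lerDl.
  by apply: sumr_ge0 => k _; exact: ltW (u54_gt0 _ k).
move=> n; rewrite (le_trans (y := limn (series (u54 R))))// ?lerDl//.
apply: (@nondecreasing_cvgn_le _ (series (u54 R))); last exact: cvg_u54.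
move=> i j ij; rewrite /series/= (big_cat_nat _ ij)//= lerDl.
by apply: sumr_ge0 => k _; exact: ltW (u54_gt0 _ k).
Qed.

(** Double series are summed along growing squares, so that their convergence is that of a
    sequence. *)
Definition sqsum (a : nat -> nat -> R) (K : nat) : R :=
  \sum_(0 <= k < K) \sum_(0 <= l < K) a k l.

(** [B] is chosen before [a], because it is later applied to coefficients that depend on [x]. *)
Lemma sqsum_bound (M : R) : 0 <= M -> exists2 B : R, 0 < B & forall a : nat -> nat -> R,
  (forall k l, `|a k l| <= M * (u54 R k * u54 R l)) -> forall K, `|sqsum a K| <= B.
Proof.
move=> M0; have [U U0 HU] := u54_sum_bound.
exists (M * (U * U) + 1); first by rewrite ltr_wpDl// !mulr_ge0// ltW.
move=> a ab K; rewrite (@le_trans _ _ (M * (U * U)))// ?lerDl// /sqsum.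
apply: (le_trans (ler_norm_sum _ _ _)).
apply: (@le_trans _ _ (\sum_(0 <= k < K) M * (u54 R k * U))).
  apply: ler_sum => k _; apply: (le_trans (ler_norm_sum _ _ _)).
  apply: (@le_trans _ _ (\sum_(0 <= l < K) M * (u54 R k * u54 R l))).
    by apply: ler_sum => l _; exact: ab.
  rewrite -mulr_sumr -mulr_sumr ler_wpM2l// ler_wpM2l ?HU//.
  exact: ltW (u54_gt0 _ k).
rewrite -mulr_sumr -mulr_suml ler_wpM2l// ler_wpM2r// ?HU//.
exact: ltW.
Qed.

Lemma sqsumS a K : sqsum a K.+1 = sqsum a K +
  (\sum_(0 <= l < K.+1) a K l + \sum_(0 <= k < K) a k K).
Proof.
rewrite /sqsum big_nat_recr//=.
under eq_bigr do rewrite big_nat_recr//=.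
by rewrite big_split/= -addrA [X in _ + X]addrC.
Qed.

Lemma sqsum_M_test (a : nat -> nat -> R -> R) (M : R) :
  (forall k l x, `|a k l x| <= M * (u54 R k * u54 R l)) ->
  exists g : R -> R, forall eps : R, 0 < eps -> exists K0, forall K, (K0 <= K)%N ->
    forall x, `|g x - sqsum (fun k l => a k l x) K| <= eps.
Proof.
move=> aM; have [U U0 HU] := u54_sum_bound.
have M0 : 0 <= M.
  have := le_trans (normr_ge0 _) (aM 0%N 0%N 0).
  by rewrite pmulr_lge0// mulr_gt0// u54_gt0.
pose d K x := sqsum (fun k l => a k l x) K.+1 - sqsum (fun k l => a k l x) K.
have db K x : `|d K x| <= (2 * M * U) * u54 R K.
  rewrite /d sqsumS addrC addKr (le_trans (ler_normD _ _))//.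
  have -> : 2 * M * U * u54 R K = M * (u54 R K * U) + M * (U * u54 R K) by ring.
  apply: lerD; apply: (le_trans (ler_norm_sum _ _ _)).
    apply: (@le_trans _ _ (\sum_(0 <= l < K.+1) M * (u54 R K * u54 R l))).
      by apply: ler_sum => l _; exact: aM.
    by rewrite -mulr_sumr -mulr_sumr ler_wpM2l// ler_wpM2l ?HU// ltW// u54_gt0.
  apply: (@le_trans _ _ (\sum_(0 <= k < K) M * (u54 R k * u54 R K))).
    by apply: ler_sum => l _; exact: aM.
  by rewrite -mulr_sumr -mulr_suml ler_wpM2l// ler_wpM2r ?HU// ltW// u54_gt0.
have sd : cvgn (series (fun k => (2 * M * U) * u54 R k)).
  by apply: (@is_cvg_seriesZ _ (u54 R) (2 * M * U)); exact: cvg_u54.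
have [g gP] := weierstrass_M_test db sd.
exists g => eps /gP[K0 HK0]; exists K0 => K /HK0 H x; have := H x.
by rewrite telescope_sumr// /sqsum [in X in _ - (_ - X)]big_nil subr0.
Qed.

(** Beyond [K], row [k] has a tail of at most [M * u54 R k] times a tail of the weight series. These
    errors sum over [k] to something small, so square sums and iterated sums have the same limit. *)
Lemma cvg_iterated_square (a : nat -> nat -> R) (h : nat -> R) (S M : R) :
  (forall k l, `|a k l| <= M * (u54 R k * u54 R l)) ->
  (forall k, \sum_(0 <= l < L) a k l @[L --> \oo] --> h k) ->
  \sum_(0 <= k < K) h k @[K --> \oo] --> S ->
  sqsum a K @[K --> \oo] --> S.
Proof.
move=> aM ah hS; have [U U0 HU] := u54_sum_bound.
have M0 : 0 <= M.
  have := le_trans (normr_ge0 _) (aM 0%N 0%N).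
  by rewrite pmulr_lge0// mulr_gt0// u54_gt0.
apply: cvg_seqI => eps e0.
have e4 : 0 < eps / 4 by rewrite divr_gt0.
have eU : 0 < eps / 4 / (M * U + 1) by rewrite divr_gt0// ltr_wpDl// mulr_ge0// ltW.
have [N1 H1] := cvg_seqE hS e4.
have [N2 H2] := cvg_seqE (@cvg_u54 R) eU.
pose t := limn (series (u54 R)).
exists (maxn N1 N2) => K; rewrite geq_max => /andP[K1 K2].
have inner k : `|h k - \sum_(0 <= l < K) a k l| <= M * u54 R k * (2 * (eps / 4 / (M * U + 1))).
  apply/ler_addgt0Pl => e' e'0.
  have [N3 H3] := cvg_seqE (ah k) e'0.
  pose L := maxn N3 K.
  have KL : (K <= L)%N by rewrite leq_maxr.
  have := H3 L (leq_maxl _ _).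
  rewrite (big_cat_nat _ KL)//= => H4.
  have H5 : `|\sum_(K <= l < L) a k l| <= M * u54 R k * (2 * (eps / 4 / (M * U + 1))).
    apply: (le_trans (ler_norm_sum _ _ _)).
    apply: (@le_trans _ _ (\sum_(K <= l < L) M * (u54 R k * u54 R l))).
      by apply: ler_sum => l _; exact: aM.
    rewrite -mulr_sumr -mulr_sumr mulrA ler_wpM2l ?mulr_ge0 ?(ltW (u54_gt0 _ _))//.
    have := H2 K K2; have := H2 L (leq_trans K2 KL).
    rewrite /series/= (big_cat_nat _ KL)//= !ltr_norml => /andP[? ?] /andP[? ?]; lra.
  move: H4 H5; move: (\sum_(0 <= l < K) _) (\sum_(K <= l < L) _) => s1 s2.
  move: (M * _ * _) => B; rewrite !ltr_norml !ler_norml => /andP[? ?] /andP[? ?].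
  by apply/andP; split; lra.
have outer : `|\sum_(0 <= k < K) h k - sqsum a K| <= eps / 2.
  rewrite /sqsum -sumrB (le_trans (ler_norm_sum _ _ _))//.
  apply: (@le_trans _ _ (\sum_(0 <= k < K) M * u54 R k * (2 * (eps / 4 / (M * U + 1))))).
    by apply: ler_sum => k _; exact: inner.
  rewrite -mulr_suml -mulr_sumr.
  have MU : 0 < M * U + 1 by rewrite ltr_wpDl// mulr_ge0// ltW.
  have MH : M * (\sum_(0 <= k < K) u54 R k) <= M * U + 1.
    by rewrite (@le_trans _ _ (M * U)) ?lerDl// ler_wpM2l.
  have -> : eps / 2 = (M * U + 1) * (2 * (eps / 4 / (M * U + 1))) by field; rewrite gt_eqF.
  by rewrite ler_wpM2r// mulr_ge0// ltW.
have := H1 K K1; move: outer; rewrite !ltr_norml !ler_norml => /andP[? ?] /andP[? ?].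
by apply/andP; split; lra.
Qed.

End square_sums.

(** * Poisson summation in the plane *)

Section lattice.
Variable R : realType.
Implicit Types (x y : R).

Definition pos (u : R) : R := Num.max u 0.

Lemma pos_ge0 u : 0 <= pos u.
Proof. by rewrite /pos le_max lexx orbT. Qed.

Lemma pos_id u : 0 <= u -> pos u = u.
Proof. by move=> u0; rewrite /pos max_l. Qed.

Lemma pos_le0 u : u <= 0 -> pos u = 0.
Proof. by move=> u0; rewrite /pos max_r. Qed.

Lemma ct_pos : continuous pos.
Proof.
move=> u; rewrite /pos; apply: (@continuous_max _ _ (fun u : R => u) (fun=> 0)) => //.
exact: cvg_cst.
Qed.

Lemma ct_sqrt : continuous (Num.sqrt : R -> R).
Proof. exact: sqrt_continuous. Qed.

Definition freq (p : R) (k : nat) : R := 2 * pi * k%:R / p.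

Lemma natSsq_u54 k : k.+1%:R ^- 2 <= u54 R k.
Proof.
have k0 : (0 : R) < k.+1%:R by rewrite ltr0Sn.
rewrite /u54 -powR_mulrn ?(ltW k0)// -powRN; apply: ler_powR; last by lra.
by rewrite ler1n.
Qed.

(** For nonzero frequencies the bound is linear in [y], which is what leaves an error of order [x]
    in the axis sums. The shift from [k.+1] to [k.+2] in the weight is paid for by the factor
    [2 pi]. *)
Lemma parq_u54S q k y : 0 < q -> 0 <= y ->
  `|parq (freq q k.+1) y| <= 4 * y * q ^+ 2 * u54 R k.+1.
Proof.
move=> q0 y0.
have yq : 0 <= 4 * y * q ^+ 2 by rewrite !mulr_ge0// ?exprn_ge0// ltW.
have k0 : (0 : R) < k.+1%:R by rewrite ltr0Sn.
have w0 : freq q k.+1 != 0.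
  by rewrite gt_eqF// /freq divr_gt0// !mulr_gt0// pi_gt0.
apply: (le_trans (parq_decay y0 w0)).
apply: (@le_trans _ _ (4 * y * q ^+ 2 * k.+2%:R ^- 2)); last first.
  by rewrite ler_wpM2l// natSsq_u54.
rewrite -[leRHS]mulrA; apply: ler_wpM2l; first by rewrite mulr_ge0.
rewrite /freq expr_div_n invf_div ler_wpM2l ?exprn_ge0 ?(ltW q0)//.
rewrite lef_pV2 ?posrE ?exprn_gt0 ?mulr_gt0 ?pi_gt0 ?ltr0Sn//.
rewrite lerXn2r ?nnegrE// ?mulr_ge0 ?pi_ge0//.
have p2 := pi_ge2 R; have k1 : (1 : R) <= k.+1%:R by rewrite ler1n.
rewrite -[k.+2%:R]natr1; nra.
Qed.

Lemma parq_u54 q k y : 0 < q -> 0 <= y ->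
  `|parq (freq q k) y| <= (2 * y ^+ 3 + 4 * y * q ^+ 2) * u54 R k.
Proof.
move=> q0 y0; have y3 : 0 <= y ^+ 3 by rewrite exprn_ge0.
have yq : 0 <= 4 * y * q ^+ 2 by rewrite !mulr_ge0// ?exprn_ge0// ltW.
case: k => [|k].
  by rewrite /u54 powR1 mulr1 (le_trans (parq_le _ y0))// lerDl.
apply: (le_trans (parq_u54S k q0 y0)).
by rewrite ler_wpM2r ?lerDr ?mulr_ge0//; exact: ltW (u54_gt0 _ _).
Qed.

Lemma poisson_parq (q y : R) (N : nat) : 0 < q -> 0 <= y -> y <= q * N%:R ->
  \sum_(0 <= k < K) cw2 R k * parq (freq q k) y @[K --> \oo] -->
  q / 2 * \sum_(0 <= n < N) cw2 R n * pos (y ^+ 2 - (q * n%:R) ^+ 2).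
Proof.
move=> q0 y0 yN.
pose F v := pos (y ^+ 2 - v ^+ 2).
have cF : continuous F by have cp := ct_pos; rewrite /F; ct.
have F0 v : y <= v -> F v = 0.
  by move=> yv; rewrite /F pos_le0// subr_le0 lerXn2r// nnegrE// (le_trans y0).
have cE k : RI 0 y (fun v => F v * cos (2 * pi * k%:R / q * v)) = parq (freq q k) y.
  rewrite -RI_parq//; apply: eq_RI => v /andP[v0 vy]; rewrite /F pos_id//.
  by rewrite subr_ge0 lerXn2r.
have cb k : `|RI 0 y (fun v => F v * cos (2 * pi * k%:R / q * v))| <=
    (2 * y ^+ 3 + 4 * y * q ^+ 2) * u54 R k.
  by rewrite cE; exact: parq_u54.
have sb : cvgn (series (fun k => (2 * y ^+ 3 + 4 * y * q ^+ 2) * u54 R k)).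
  by apply: (@is_cvg_seriesZ _ (u54 R)); exact: cvg_u54.
have := poisson1 q0 y0 yN cF F0 cb sb.
by under eq_fun do under eq_bigr do rewrite cE.
Qed.

Definition chord x y := Num.sqrt (pos (x ^+ 2 - y ^+ 2)).

Lemma ct_chord x : continuous (chord x).
Proof. by have cp := ct_pos; have cs := ct_sqrt; rewrite /chord; ct. Qed.

Lemma chord_ge0 x y : 0 <= chord x y.
Proof. exact: sqrtr_ge0. Qed.

Lemma chord_sqr x y : chord x y ^+ 2 = pos (x ^+ 2 - y ^+ 2).
Proof. by rewrite sqr_sqrtr// pos_ge0. Qed.

(** Substitution [y = x sin th], under which the chord becomes [x cos th]. *)
Lemma RI_parq_chord (w l x : R) : 0 < x ->
  RI 0 x (fun y => parq w (chord x y) * cos (l * y)) = discF l w x.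
Proof.
move=> x0; have pi2 : 0 < pi / 2 :> R by rewrite divr_gt0// pi_gt0.
have cc := ct_chord (x := x); have cp := ct_parq (w := w).
pose G y := parq w (chord x y) * cos (l * y).
have cG : continuous G by rewrite /G; ct.
have -> : discF l w x = RI 0 (pi / 2) (fun th => G (x * sin th) * (x * cos th)).
  apply: eq_RI => th tpi; have /andP[c0 _] := cos_pihalf01 tpi.
  congr (parq w _ * _ * _); rewrite /chord.
  have -> : x ^+ 2 - (x * sin th) ^+ 2 = (x * cos th) ^+ 2.
    by rewrite !exprMn cos2sin2; ring.
  by rewrite pos_id ?sqr_ge0// sqrtr_sqr ger0_norm// mulr_ge0// ltW.
(* A base point below 0 makes [P] differentiable at [th = 0] as well. *)
pose P y := RI (-1) y G.
have cR : {within `[0, pi / 2], continuous (fun th : R => G (x * sin th) * (x * cos th))} by cw.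
have D th : 0 <= th <= pi / 2 ->
    is_derive th 1 (fun th => P (x * sin th)) (G (x * sin th) * (x * cos th)).
  move=> /andP[t0 t1]; have s0 : 0 <= sin th.
    by apply: sin_ge0_pi; rewrite t0/= (le_trans t1)// ler_pdivrMr// ler_peMr ?pi_ge0// ler1n.
  have xs : -1 < x * sin th by rewrite (lt_le_trans (y := 0))// mulr_ge0// ltW.
  have D : is_derive (x * sin th) 1 P (G (x * sin th)) by exact: is_derive_RI.
  by dvr.
rewrite (RI_FTCc pi2 cR D) sin_pihalf mulr1 sin0 mulr0 /P.
rewrite (@RI_split _ 0 (-1) x); [|lra|exact: ltW|exact: continuousW].
by rewrite addrC addKr.
Qed.

Lemma cvg_sum_nat (f : nat -> nat -> R) (l : nat -> R) (N : nat) :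
  (forall m, f m K @[K --> \oo] --> l m) ->
  \sum_(0 <= m < N) f m K @[K --> \oo] --> \sum_(0 <= m < N) l m.
Proof.
move=> fl; elim: N => [|N IH].
  by under eq_fun do rewrite big_nil; rewrite big_nil; exact: cvg_cst.
by under eq_fun do rewrite big_nat_recr//=; rewrite big_nat_recr//=; apply: cvgD.
Qed.

(** Summation in the second coordinate gives [parq] of the chord, a function of the first
    coordinate; Poisson summation in that coordinate gives [discF]. [M] may depend on [x], since it
    only justifies passing from iterated sums to square sums. *)
Lemma poisson2 (p q x M : R) (N : nat) : 0 < p -> 0 < q -> 0 < x ->
  x <= p * N%:R -> x <= q * N%:R ->
  (forall k l, `|discF (freq p l) (freq q k) x| <= M * (u54 R k * u54 R l)) ->
  sqsum (fun k l => cw2 R k * cw2 R l * discF (freq p l) (freq q k) x) K @[K --> \oo] -->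
  p * q / 4 * \sum_(0 <= m < N) \sum_(0 <= n < N)
    cw2 R m * cw2 R n * pos (x ^+ 2 - (p * m%:R) ^+ 2 - (q * n%:R) ^+ 2).
Proof.
move=> p0 q0 x0 xp xq FM.
have M0 : 0 <= M.
  have := le_trans (normr_ge0 _) (FM 0%N 0%N).
  by rewrite pmulr_lge0// mulr_gt0// u54_gt0.
pose G k y := parq (freq q k) (chord x y).
pose h k := cw2 R k * (p / 2 * \sum_(0 <= m < N) cw2 R m * G k (p * m%:R)).
have cw2n k : `|cw2 R k| <= 2 by rewrite ger0_norm ?cw2_ge0 ?cw2_le2.
have cx y : chord x y <= x.
  rewrite -[leRHS]ger0_norm ?(ltW x0)// -sqrtr_sqr; apply: ler_wsqrtr.
  by rewrite /pos ge_max sqr_ge0 andbT gerBl sqr_ge0.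
apply: (@cvg_iterated_square _ _ h _ (4 * M)).
- move=> k l; rewrite (_ : 4 * M * _ = 2 * 2 * (M * (u54 R k * u54 R l))); last by ring.
  by apply: normM_le; [exact: normM_le|exact: FM].
- move=> k; rewrite /h (_ : (fun L => _) = fun L => cw2 R k *
    \sum_(0 <= l < L) cw2 R l * discF (freq p l) (freq q k) x); last first.
    by apply/funext => L; rewrite mulr_sumr; apply: eq_bigr => l _; rewrite mulrA.
  apply: cvgMr.
  have cc := ct_chord (x := x); have cp := ct_parq (w := freq q k).
  have cG : continuous (G k) by rewrite /G; ct.
  have G0 y : x <= y -> G k y = 0.
    move=> xy; rewrite /G /chord pos_le0 ?sqrtr0 ?parq0//.
    by rewrite subr_le0 lerXn2r// nnegrE// ltW// (lt_le_trans x0).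
  have cE l : RI 0 x (fun y => G k y * cos (2 * pi * l%:R / p * y)) = discF (freq p l) (freq q k) x.
    by rewrite RI_parq_chord.
  have cb l : `|RI 0 x (fun y => G k y * cos (2 * pi * l%:R / p * y))| <= (M * u54 R k) * u54 R l.
    by rewrite cE -mulrA.
  have sb : cvgn (series (fun l => (M * u54 R k) * u54 R l)).
    by apply: (@is_cvg_seriesZ _ (u54 R)); exact: cvg_u54.
  have := poisson1 p0 (ltW x0) xp cG G0 cb sb.
  by under eq_fun do under eq_bigr do rewrite cE.
- have E K : \sum_(0 <= k < K) h k = \sum_(0 <= m < N) p / 2 * cw2 R m *
      \sum_(0 <= k < K) cw2 R k * parq (freq q k) (chord x (p * m%:R)).
    rewrite /h; under eq_bigr do rewrite mulrA mulr_sumr.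
    rewrite exchange_big/=; apply: eq_bigr => m _; rewrite mulr_sumr.
    by apply: eq_bigr => k _; rewrite /G; ring.
  under eq_fun do rewrite E.
  have -> : p * q / 4 * (\sum_(0 <= m < N) \sum_(0 <= n < N)
      cw2 R m * cw2 R n * pos (x ^+ 2 - (p * m%:R) ^+ 2 - (q * n%:R) ^+ 2)) =
      \sum_(0 <= m < N) p / 2 * cw2 R m * (q / 2 * \sum_(0 <= n < N)
      cw2 R n * pos (chord x (p * m%:R) ^+ 2 - (q * n%:R) ^+ 2)).
    rewrite mulr_sumr; apply: eq_bigr => m _; rewrite !mulr_sumr; apply: eq_bigr => n _.
    (* The inner truncation is harmless because a nonnegative square is subtracted from it. *)
    rewrite chord_sqr (_ : pos (pos _ - _) = pos (x ^+ 2 - (p * m%:R) ^+ 2 - (q * n%:R) ^+ 2)).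
      by field.
    have [le|/ltW ge] := leP (x ^+ 2 - (p * m%:R) ^+ 2) 0; last by rewrite (pos_id ge).
    have s0 := sqr_ge0 (q * n%:R).
    by rewrite (pos_le0 le) sub0r !pos_le0//; lra.
  apply: cvg_sum_nat => m; apply: cvgMr.
  exact: poisson_parq (chord_ge0 _ _) (le_trans (cx _) xq).
Qed.

End lattice.

(** * Asymptotics of the lattice sum *)

Section lattice_asymptotics.
Variable R : realType.

(** At frequency zero the integrand is [2 / 3 * x ^+ 4 * cos th ^+ 4], with [A] as explicit
    primitive. This is the source of the area term. *)
Lemma discF00 (x : R) : discF 0 0 x = pi * x ^+ 4 / 8.
Proof.
have pi2 : 0 < pi / 2 :> R by rewrite divr_gt0// pi_gt0.
pose A (th : R) := 2 / 3 * x ^+ 4 * (3 / 8 * th + 3 / 8 * (sin th * cos th) + 1 / 4 * (sin th * cos th ^+ 3)).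
pose dA (th : R) := 2 / 3 * x ^+ 4 * cos th ^+ 4.
have cA : {within `[0, pi / 2], continuous dA} by rewrite /dA; cw.
have D th : 0 <= th <= pi / 2 -> is_derive th 1 A (dA th).
  move=> _; rewrite /A /dA; dvr; rewrite /=.
  have s2 : sin th ^+ 2 = 1 - cos th ^+ 2 by exact: sin2cos2.
  by field: s2.
have -> : discF 0 0 x = RI 0 (pi / 2) dA.
  apply: eq_RI => th _; rewrite /parq eqxx mul0r cos0 /dA; ring.
by rewrite (RI_FTCc pi2 cA D) /A cos_pihalf sin_pihalf sin0; field.
Qed.

Lemma powR32 (x : R) : 0 < x -> x `^ (3 / 2) = x * x `^ (1 / 2).
Proof.
move=> x0; have -> : 3 / 2 = 1 + 1 / 2 :> R by field.
by rewrite powRD ?powRr1 ?(ltW x0)// (gt_eqF x0) implybT.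
Qed.

(** The length of the shortest nonzero vector of the dual lattice. *)
Let fdelta (p q : R) := Num.min (2 * pi / p) (2 * pi / q).

(** All frequencies are treated at once: they are bounded below off the origin, so a single
    threshold [x1 = 2 / dl] ensures [r x >= 1] for each of them. The origin is excluded by giving it
    amplitude 0. *)
Lemma freq_terms (p q : R) : 0 < p -> 0 < q ->
  exists M x1 : R, exists r c s : nat -> nat -> R,
  [/\ 0 < M, 0 < x1,
    forall k l, `|c k l| <= M * (u54 R k * u54 R l) /\ `|s k l| <= M * (u54 R k * u54 R l),
    forall k l, if (k + l)%N == 0%N then c k l = 0 /\ s k l = 0 else 0 < r k l &
    forall k l x, (k + l)%N != 0%N -> x1 <= x ->
      `|discF (freq p l) (freq q k) x - x `^ (3 / 2) * (c k l * cos (r k l * x) + s k l * sin (r k l * x))|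
      <= M * (u54 R k * u54 R l) * x `^ (1 / 2)].
Proof.
move=> p0 q0; have [C C0 HC] := discF_asymptotics R.
have pi0 := pi_gt0 R.
pose dl := fdelta p q.
have dl0 : 0 < dl by rewrite lt_min !divr_gt0// mulr_gt0.
pose r k l := Num.sqrt (freq p l ^+ 2 + freq q k ^+ 2).
have r2 k l : r k l ^+ 2 = freq p l ^+ 2 + freq q k ^+ 2.
  by rewrite sqr_sqrtr// addr_ge0 ?sqr_ge0.
have fp l : dl * l%:R <= freq p l.
  rewrite /freq mulrAC ler_wpM2r//; by rewrite ge_min lexx.
have fq k : dl * k%:R <= freq q k.
  rewrite /freq mulrAC ler_wpM2r//; by rewrite ge_min lexx orbT.
have sqge (a b : R) : 0 <= a -> a <= b -> a ^+ 2 <= b ^+ 2.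
  by move=> a0 ab; rewrite lerXn2r// nnegrE// (le_trans a0).
(* Off the origin the quadratic form controls even the shifted product, which is the step from [r]
   to the weights [u54]. *)
have nn k l : (k + l)%N != 0%N -> (k.+1%:R * l.+1%:R : R) <= 4 * (l%:R ^+ 2 + k%:R ^+ 2).
  move=> kl0; rewrite -!natrX -natrD -!natrM ler_nat.
  case: k l kl0 => [|k] [|l]//= _; nia.
have rge k l : (k + l)%N != 0%N -> dl ^+ 2 / 4 * (k.+1%:R * l.+1%:R) <= r k l ^+ 2.
  move=> /nn H; rewrite r2.
  apply: (@le_trans _ _ (dl ^+ 2 * (l%:R ^+ 2 + k%:R ^+ 2))).
    by rewrite -mulrA ler_wpM2l ?sqr_ge0//; move: H; move: (k.+1%:R * l.+1%:R) => ?; lra.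
  rewrite mulrDr -!exprMn; apply: lerD; apply: sqge => //; by rewrite mulr_ge0 ?(ltW dl0).
have rgd k l : (k + l)%N != 0%N -> dl / 2 <= r k l.
  move=> kl0; rewrite -(@ler_pXn2r _ 2) ?nnegrE ?divr_ge0 ?(ltW dl0) ?sqrtr_ge0//.
  apply: le_trans (rge k l kl0); rewrite expr_div_n -natrX ler_peMr//.
    by rewrite divr_ge0// sqr_ge0.
  by rewrite -natrM ler1n.
have r0 k l : (k + l)%N != 0%N -> 0 < r k l.
  by move=> /rgd; apply: lt_le_trans; rewrite divr_gt0.
pose A : R := (dl ^+ 2 / 4) `^ (- (5 / 4)).
have A0 : 0 < A by rewrite powR_gt0// divr_gt0// exprn_gt0.
have amp k l : (k + l)%N != 0%N -> r k l `^ (- (5 / 2)) <= A * (u54 R k * u54 R l).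
  move=> kl0; have rk := r0 k l kl0.
  have B0 : 0 < dl ^+ 2 / 4 * (k.+1%:R * l.+1%:R).
    by rewrite mulr_gt0// ?divr_gt0 ?exprn_gt0// mulr_gt0// ltr0Sn.
  have -> : A * (u54 R k * u54 R l) = (dl ^+ 2 / 4 * (k.+1%:R * l.+1%:R)) `^ (- (5 / 4)).
    have d4 : 0 <= dl ^+ 2 / 4 by rewrite divr_ge0// sqr_ge0.
    have kl : (0 : R) <= k.+1%:R * l.+1%:R by rewrite mulr_ge0.
    by rewrite (powRM _ d4 kl) (powRM _ (ler0n _ _) (ler0n _ _)).
  have -> : - (5 / 2) = 2 * (- (5 / 4)) :> R by field.
  rewrite powRrM powR_mulrn ?(ltW rk)// !powRN lef_pV2 ?posrE ?powR_gt0// ?exprn_gt0//.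
  apply: ge0_ler_powR; rewrite ?nnegrE ?sqr_ge0 ?(ltW B0)//; last exact: rge.
have /choice[f fP] : forall kl : nat * nat, exists cs : R * R,
    (kl.1 + kl.2)%N != 0%N -> [/\ `|cs.1| <= C, `|cs.2| <= C & forall x, 1 <= r kl.1 kl.2 * x ->
    `|discF (freq p kl.2) (freq q kl.1) x - x `^ (3 / 2) * r kl.1 kl.2 `^ (- (5 / 2)) *
       (cs.1 * cos (r kl.1 kl.2 * x) + cs.2 * sin (r kl.1 kl.2 * x))|
    <= C * (x `^ (3 / 2) * r kl.1 kl.2 `^ (- (5 / 2)) / (r kl.1 kl.2 * x))].
  move=> [k l] /=; have [kl0|kl0] := eqVneq (k + l)%N 0%N; first by exists (0, 0).
  by have [cs H] := HC _ _ _ (r0 k l kl0) (r2 k l); exists cs.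
pose c k l := if (k + l)%N == 0%N then 0 else r k l `^ (- (5 / 2)) * (f (k, l)).1.
pose s k l := if (k + l)%N == 0%N then 0 else r k l `^ (- (5 / 2)) * (f (k, l)).2.
pose M := C * A + C * A * (2 / dl).
have CA0 : 0 < C * A by rewrite mulr_gt0.
have M1 : C * A <= M by rewrite lerDl mulr_ge0 ?divr_ge0 ?(ltW dl0) ?(ltW CA0).
have M2 : C * A * (2 / dl) <= M by rewrite lerDr ltW.
have M0 : 0 < M := lt_le_trans CA0 M1.
have uu k l : 0 < u54 R k * u54 R l by rewrite mulr_gt0 ?u54_gt0.
have ampC k l (z : R) : (k + l)%N != 0%N -> `|z| <= C ->
    `|r k l `^ (- (5 / 2)) * z| <= M * (u54 R k * u54 R l).
  move=> kl0 zC; apply: (@le_trans _ _ (A * (u54 R k * u54 R l) * C)).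
    by apply: normM_le => //; rewrite ger0_norm ?powR_ge0// amp.
  by rewrite mulrAC [A * C]mulrC ler_wpM2r// ltW.
exists M, (2 / dl), r, c, s; split => //.
- by rewrite divr_gt0.
- move=> k l; rewrite /c /s; have [_|kl0] := eqVneq (k + l)%N 0%N.
    by rewrite normr0 mulr_ge0 ?(ltW M0) ?(ltW (uu _ _)).
  by have [f1 f2 _] := fP (k, l) kl0; split; exact: ampC.
- by move=> k l; rewrite /c /s; have [//|kl0] := eqVneq (k + l)%N 0%N; exact: r0.
- move=> k l x kl0 x1; rewrite /c /s (negPf kl0).
  have x0 : 0 < x by rewrite (lt_le_trans _ x1)// divr_gt0.
  have rk := r0 k l kl0.
  have rx : 1 <= r k l * x.
    apply: (@le_trans _ _ (dl / 2 * (2 / dl))).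
      by rewrite mulrC mulrA divfK ?divff ?gt_eqF.
    by apply: ler_pM => //; rewrite ?divr_ge0 ?(ltW dl0)// rgd.
  have [_ _ /(_ x rx)] := fP (k, l) kl0.
  rewrite /= (_ : x `^ (3 / 2) * r k l `^ (- (5 / 2)) * _ = x `^ (3 / 2) *
     (r k l `^ (- (5 / 2)) * (f (k, l)).1 * cos (r k l * x) +
      r k l `^ (- (5 / 2)) * (f (k, l)).2 * sin (r k l * x))); last by ring.
  move=> /le_trans; apply.
  rewrite (powR32 x0).
  have -> : C * (x * x `^ (1 / 2) * r k l `^ (- (5 / 2)) / (r k l * x)) =
    (C * (r k l `^ (- (5 / 2)) / r k l)) * x `^ (1 / 2).
    by field; rewrite !gt_eqF.
  rewrite ler_wpM2r ?powR_ge0//.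
  apply: (@le_trans _ _ (C * A * (2 / dl) * (u54 R k * u54 R l))); last by rewrite ler_wpM2r// ltW.
  have ri : (r k l)^-1 <= 2 / dl.
    by rewrite -[2 / dl]invrK invf_div lef_pV2 ?posrE ?divr_gt0// rgd.
  have -> : C * A * (2 / dl) * (u54 R k * u54 R l) = C * (A * (u54 R k * u54 R l) * (2 / dl)) by ring.
  rewrite ler_wpM2l ?(ltW C0)//; apply: ler_pM => //; first exact: powR_ge0.
    by rewrite invr_ge0 ltW.
  exact: amp.
Qed.

End lattice_asymptotics.

Section lattice_main.
Variable R : realType.

Lemma sqsumD (a b : nat -> nat -> R) K :
  sqsum (fun k l => a k l + b k l) K = sqsum a K + sqsum b K.
Proof. by rewrite /sqsum -big_split/=; apply: eq_bigr => k _; rewrite -big_split. Qed.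

Lemma sqsumZ (a : nat -> nat -> R) z K : sqsum (fun k l => z * a k l) K = z * sqsum a K.
Proof. by rewrite /sqsum mulr_sumr; apply: eq_bigr => k _; rewrite mulr_sumr. Qed.

Lemma eq_sqsum (a b : nat -> nat -> R) K : (forall k l, a k l = b k l) -> sqsum a K = sqsum b K.
Proof. by move=> ab; apply: eq_bigr => k _; apply: eq_bigr => l _. Qed.

Lemma sqsum00 (z : R) K : sqsum (fun k l => if (k + l)%N == 0%N then z else 0) K.+1 = z.
Proof.
rewrite /sqsum big_nat_recl//= big_nat_recl//= !big1 ?addr0// => k _; rewrite ?big1.
Qed.

(* For large [N], the sum of [(x^2 - |v|^2)_+] over the whole lattice [pZ x qZ], folded
   onto a quadrant by the weights [cw2]. *)
Definition lattice_sum (p q x : R) (N : nat) : R :=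
  \sum_(0 <= m < N) \sum_(0 <= n < N)
    cw2 R m * cw2 R n * pos (x ^+ 2 - (p * m%:R) ^+ 2 - (q * n%:R) ^+ 2).

Lemma lattice_asymptotics (p q : R) : 0 < p -> 0 < q ->
  exists (g : R -> R) (M x1 : R) (r c s : nat -> nat -> R),
  [/\ 0 < M, 0 < x1, forall k l, 0 < r k l,
    forall eps : R, 0 < eps -> exists K, forall x,
      `|g x - sqsum (fun k l => c k l * cos (r k l * x) + s k l * sin (r k l * x)) K| <= eps &
    forall x N, x1 <= x -> x <= p * N%:R -> x <= q * N%:R ->
      `|p * q / 4 * lattice_sum p q x N - pi * x ^+ 4 / 8 - x `^ (3 / 2) * g x| <= M * x `^ (1 / 2)].
Proof.
move=> p0 q0; have [M [x1 [r [c [s [M0 x10 csM rP HF]]]]]] := freq_terms p0 q0.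
have uu k l : 0 < u54 R k * u54 R l by rewrite mulr_gt0 ?u54_gt0.
pose T k l x := c k l * cos (r k l * x) + s k l * sin (r k l * x).
pose w k l : R := cw2 R k * cw2 R l.
have w4 k l : `|w k l| <= 2 * 2.
  by apply: normM_le; rewrite ger0_norm ?cw2_ge0 ?cw2_le2.
have TM k l x : `|T k l x| <= 2 * M * (u54 R k * u54 R l).
  have [cM sM] := csM k l.
  apply: (le_trans (ler_normD _ _)).
  have -> : 2 * M * (u54 R k * u54 R l) = M * (u54 R k * u54 R l) * 1 + M * (u54 R k * u54 R l) * 1.
    by ring.
  by apply: lerD; apply: normM_le => //; [exact: cos_max|exact: sin_max].
have aM k l x : `|w k l * T k l x| <= 2 * 2 * (2 * M) * (u54 R k * u54 R l).
  by rewrite -mulrA; exact: normM_le.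
have [g gP] := sqsum_M_test aM.
have M40 : 0 <= 2 * 2 * M by rewrite mulr_ge0// ltW.
have [B B0 HB] := sqsum_bound M40.
(* At the origin the amplitudes vanish, and the dummy frequency 1 keeps all frequencies positive. *)
exists g, B, x1, (fun k l => if (k + l)%N == 0%N then 1 else r k l),
  (fun k l => w k l * c k l), (fun k l => w k l * s k l); split => //.
- by move=> k l; have := rP k l; case: ifP.
- move=> eps /gP[K HK]; exists K => x; apply: le_trans (HK K (leqnn K) x).
  rewrite (_ : sqsum _ K = sqsum (fun k l => w k l * T k l x) K)//.
  apply: eq_sqsum => k l; rewrite /T; have := rP k l; case: ifP => [_ [-> ->]|_ _]; ring.
move=> x N xx1 xp xq.
have x0 : 0 < x := lt_le_trans x10 xx1.
pose h := x `^ (1 / 2). pose h3 := x `^ (3 / 2).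
have h0 : 0 < h by rewrite powR_gt0.
have h30 : 0 < h3 by rewrite powR_gt0.
pose D k l := discF (freq p l) (freq q k) x.
have D00 : D 0%N 0%N = pi * x ^+ 4 / 8.
  by rewrite /D /freq !mulr0 !mul0r discF00.
have DM k l : (k + l)%N != 0%N -> `|D k l - h3 * T k l x| <= M * (u54 R k * u54 R l) * h.
  by move=> kl; exact: HF.
(* This bound grows with [x]; it is used only as the hypothesis of [poisson2]. *)
pose Mx := pi * x ^+ 4 / 8 + h3 * (2 * M) + M * h.
have Dx k l : `|D k l| <= Mx * (u54 R k * u54 R l).
  have pix : 0 <= pi * x ^+ 4 / 8 by rewrite divr_ge0// mulr_ge0 ?pi_ge0// exprn_ge0// ltW.
  have [|kl] := eqVneq (k + l)%N 0%N.
    move=> /eqP; rewrite addn_eq0 => /andP[/eqP -> /eqP ->].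
    rewrite D00 /u54 !powR1 !mulr1 ger0_norm// /Mx -addrA lerDl addr_ge0// ?mulr_ge0//; exact: ltW.
  rewrite -[D k l](subrK (h3 * T k l x)) (le_trans (ler_normD _ _))//.
  have t1 := DM k l kl.
  have t2 : `|h3 * T k l x| <= h3 * (2 * M * (u54 R k * u54 R l)).
    by apply: normM_le; rewrite // ger0_norm// ltW.
  apply: (le_trans (lerD t1 t2)).
  have := mulr_ge0 pix (ltW (uu k l)); rewrite /Mx; lra.
have S := poisson2 p0 q0 x0 xp xq Dx.
rewrite -/(lattice_sum p q x N) in S.
(* Divided by [x^(1/2)], the remainders are bounded independently of [x], so all their square sums
   are at most [B]. *)
pose d k l := if (k + l)%N == 0%N then 0 else h^-1 * (w k l * (D k l - h3 * T k l x)).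
have dM k l : `|d k l| <= 2 * 2 * M * (u54 R k * u54 R l).
  rewrite /d; case: eqVneq => [_|kl].
    by rewrite normr0 mulr_ge0// ltW.
  rewrite normrM ger0_norm ?invr_ge0 ?(ltW h0)// mulrC ler_pdivrMr//.
  have -> : 2 * 2 * M * (u54 R k * u54 R l) * h = 2 * 2 * (M * (u54 R k * u54 R l) * h) by ring.
  by apply: normM_le => //; exact: DM.
have E K : sqsum (fun k l => cw2 R k * cw2 R l * discF (freq p l) (freq q k) x) K.+1 =
   h * sqsum d K.+1 + h3 * sqsum (fun k l => w k l * T k l x) K.+1 + pi * x ^+ 4 / 8.
  rewrite -[pi * x ^+ 4 / 8](sqsum00 _ K) -!sqsumZ -!sqsumD; apply: eq_sqsum => k l.
  rewrite /d -/(w k l) -/(D k l); have [|kl] := eqVneq (k + l)%N 0%N.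
    move=> /[dup] kl /eqP; rewrite addn_eq0 => /andP[/eqP k0 /eqP l0].
    have := rP k l; rewrite kl eqxx => -[c0 s0].
    rewrite /T c0 s0 k0 l0 D00 /w /cw2 eqxx; ring.
  by field; rewrite gt_eqF.
apply/ler_addgt0Pl => eps e0.
have e4 : 0 < eps / 2 by rewrite divr_gt0.
have e5 : 0 < eps / 2 / h3 by rewrite divr_gt0.
have [K1 H1] := cvg_seqE S e4.
have [K2 H2] := gP _ e5.
pose K := maxn K1 K2.
have := H1 K.+1 (leq_trans (leq_maxl _ _) (leqnSn _)).
have := H2 K.+1 (leq_trans (leq_maxr _ _) (leqnSn _)) x.
have := HB d dM K.+1; rewrite E.
rewrite -/h -/h3.
set sd := sqsum d K.+1; set sT := sqsum (fun k l => w k l * T k l x) K.+1.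
set L := p * q / 4 * _ => b1 b2 b3.
have b1' : `|h * sd| <= h * B by apply: normM_le => //; rewrite ger0_norm// ltW.
have b2' : `|h3 * (g x - sT)| <= eps / 2.
  have -> : eps / 2 = h3 * (eps / 2 / h3) by field; rewrite gt_eqF.
  by apply: normM_le => //; rewrite ger0_norm// ltW.
move: b1' b2' b3; rewrite mulrBr !ltr_norml !ler_norml => /andP[? ?] /andP[? ?] /andP[? ?].
by apply/andP; split; lra.
Qed.

End lattice_main.

(** * From the full lattice to the quadrant *)

Section quarter_sums.
Variable R : realType.

Definition axis_sum (p x : R) (N : nat) : R :=
  \sum_(0 <= m < N) cw2 R m * pos (x ^+ 2 - (p * m%:R) ^+ 2).

(** After Poisson summation the zero frequency contributes [2 / 3 * x ^+ 3], and all others together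
    are of order [x] by [parq_u54S]. *)
Lemma axis_asymptotics (p : R) : 0 < p -> exists2 M : R, 0 < M &
  forall x N, 0 <= x -> x <= p * N%:R -> `|axis_sum p x N - 4 / (3 * p) * x ^+ 3| <= M * x.
Proof.
move=> p0; have [U U0 HU] := u54_sum_bound R.
have M0 : 0 < 2 / p * (8 * p ^+ 2 * U) by rewrite mulr_gt0 ?divr_gt0// !mulr_gt0// exprn_gt0.
exists (2 / p * (8 * p ^+ 2 * U)) => // x N x0 xN.
have S := poisson_parq p0 x0 xN; rewrite -/(axis_sum p x N) in S.
suff H : `|p / 2 * axis_sum p x N - 2 / 3 * x ^+ 3| <= 8 * p ^+ 2 * U * x.
  have -> : axis_sum p x N - 4 / (3 * p) * x ^+ 3 = 2 / p * (p / 2 * axis_sum p x N - 2 / 3 * x ^+ 3).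
    by field; rewrite gt_eqF.
  have pp : 0 <= 2 / p by rewrite divr_ge0// ltW.
  by rewrite -[leRHS]mulrA; apply: normM_le => //; rewrite ger0_norm.
apply/ler_addgt0Pl => eps e0.
have [K HK] := cvg_seqE S e0.
have := HK K.+1 (leqnSn K); rewrite big_nat_recl//=.
have -> : cw2 R 0 * parq (freq p 0) x = 2 / 3 * x ^+ 3.
  by rewrite /cw2 eqxx /freq mulr0 mul0r /parq eqxx mul1r.
have B : `|\sum_(0 <= k < K) cw2 R k.+1 * parq (freq p k.+1) x| <= 8 * p ^+ 2 * U * x.
  apply: (le_trans (ler_norm_sum _ _ _)).
  apply: (@le_trans _ _ (\sum_(0 <= k < K) 2 * (4 * x * p ^+ 2 * u54 R k.+1))).
    apply: ler_sum => k _; apply: normM_le; last exact: parq_u54S.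
    by rewrite ger0_norm.
  rewrite -!mulr_sumr.
  have -> : 8 * p ^+ 2 * U * x = 2 * (4 * x * p ^+ 2 * U) by ring.
  rewrite ler_pM2l// ler_wpM2l ?mulr_ge0 ?sqr_ge0 ?(ltW p0)//.
  apply: le_trans (HU K.+1); rewrite [leRHS]big_nat_recl//= lerDr.
  exact: ltW (u54_gt0 _ _).
move: B; move: (\sum_(0 <= k < K) _) => B.
rewrite !ltr_norml !ler_norml => /andP[? ?] /andP[? ?].
by apply/andP; split; lra.
Qed.

(* The Neumann ([d = 0]) and Dirichlet ([d = 1]) sums. *)
Definition quarter_sum (d : nat) (p q x : R) (N : nat) : R :=
  \sum_(0 <= m < N) \sum_(0 <= n < N)
    pos (x ^+ 2 - (p * (m + d)%:R) ^+ 2 - (q * (n + d)%:R) ^+ 2).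

Lemma sum_cw2 (f : nat -> R) N : (0 < N)%N ->
  \sum_(0 <= m < N) cw2 R m * f m = 2 * \sum_(0 <= m < N) f m - f 0%N.
Proof.
case: N => // N _; rewrite !big_nat_recl//= /cw2 eqxx -mulr_sumr.
by move: (\sum_(0 <= i < N) _) => s; ring.
Qed.

Lemma sum_shift1 (f : nat -> R) N : f N = 0 ->
  \sum_(0 <= m < N) f (m + 1)%N = \sum_(0 <= m < N) f m - f 0%N.
Proof.
under eq_bigr do rewrite addn1.
case: N => [f0|N fN]; first by rewrite !big_nil f0 subr0.
by rewrite big_nat_recr//= fN addr0 big_nat_recl//= addrC addKr.
Qed.

(** The folding weight is 2 minus the indicator of index 0 in each coordinate. Expanding the product
    leaves the quadrant, the two axes and the origin, whose term is [x ^+ 2]. *)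
Lemma quarter_sumN (p q x : R) N : 0 <= x -> (0 < N)%N ->
  4 * quarter_sum 0 p q x N =
  lattice_sum p q x N + axis_sum p x N + axis_sum q x N + x ^+ 2.
Proof.
move=> x0 N0.
pose f m n := pos (x ^+ 2 - (p * m%:R) ^+ 2 - (q * n%:R) ^+ 2).
have -> : quarter_sum 0 p q x N = \sum_(0 <= m < N) \sum_(0 <= n < N) f m n.
  by apply: eq_bigr => m _; apply: eq_bigr => n _; rewrite !addn0.
have fm0 m : f m 0%N = pos (x ^+ 2 - (p * m%:R) ^+ 2) by rewrite /f mulr0 expr0n subr0.
have f0n n : f 0%N n = pos (x ^+ 2 - (q * n%:R) ^+ 2) by rewrite /f mulr0 expr0n subr0.
have f00 : f 0%N 0%N = x ^+ 2 by rewrite fm0 mulr0 expr0n subr0 pos_id// sqr_ge0.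
have -> : axis_sum p x N = 2 * (\sum_(0 <= m < N) f m 0%N) - x ^+ 2.
  by rewrite /axis_sum; under eq_bigr do rewrite -fm0; rewrite sum_cw2// f00.
have -> : axis_sum q x N = 2 * (\sum_(0 <= n < N) f 0%N n) - x ^+ 2.
  by rewrite /axis_sum; under eq_bigr do rewrite -f0n; rewrite sum_cw2// f00.
have -> : lattice_sum p q x N = 4 * (\sum_(0 <= m < N) \sum_(0 <= n < N) f m n)
    - 2 * (\sum_(0 <= m < N) f m 0%N) - 2 * (\sum_(0 <= n < N) f 0%N n) + x ^+ 2.
  rewrite /lattice_sum.
  under eq_bigr do (under eq_bigr do rewrite -mulrA; rewrite -mulr_sumr sum_cw2//).
  rewrite sum_cw2//= -/(f _ _) sumrB -mulr_sumr -/(f _ _) f00.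
  by rewrite /f; ring.
by ring.
Qed.

(** The Dirichlet sum is the Neumann sum without its axes. Shifting the indices by 1 brings in only
    terms with an index equal to [N], which vanish because [x] is at most [p * N%:R] and
    [q * N%:R]. *)
Lemma quarter_sumD (p q x : R) N : 0 <= x -> (0 < N)%N -> x <= p * N%:R -> x <= q * N%:R ->
  4 * quarter_sum 1 p q x N =
  lattice_sum p q x N - axis_sum p x N - axis_sum q x N + x ^+ 2.
Proof.
move=> x0 N0 xp xq.
pose f m n := pos (x ^+ 2 - (p * m%:R) ^+ 2 - (q * n%:R) ^+ 2).
have fN m : f N m = 0 /\ f m N = 0.
  have := sqr_ge0 (p * m%:R); have := sqr_ge0 (q * m%:R).
  have : x ^+ 2 <= (p * N%:R) ^+ 2 by rewrite lerXn2r// nnegrE// (le_trans x0).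
  have : x ^+ 2 <= (q * N%:R) ^+ 2 by rewrite lerXn2r// nnegrE// (le_trans x0).
  by rewrite /f; split; rewrite pos_le0//; lra.
have := quarter_sumN p q x0 N0.
have -> : quarter_sum 0 p q x N = \sum_(0 <= m < N) \sum_(0 <= n < N) f m n.
  by apply: eq_bigr => m _; apply: eq_bigr => n _; rewrite !addn0.
have fm0 m : f m 0%N = pos (x ^+ 2 - (p * m%:R) ^+ 2) by rewrite /f mulr0 expr0n subr0.
have f0n n : f 0%N n = pos (x ^+ 2 - (q * n%:R) ^+ 2) by rewrite /f mulr0 expr0n subr0.
have f00 : f 0%N 0%N = x ^+ 2 by rewrite fm0 mulr0 expr0n subr0 pos_id// sqr_ge0.
have -> : axis_sum p x N = 2 * (\sum_(0 <= m < N) f m 0%N) - x ^+ 2.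
  by rewrite /axis_sum; under eq_bigr do rewrite -fm0; rewrite sum_cw2// f00.
have -> : axis_sum q x N = 2 * (\sum_(0 <= n < N) f 0%N n) - x ^+ 2.
  by rewrite /axis_sum; under eq_bigr do rewrite -f0n; rewrite sum_cw2// f00.
have -> : quarter_sum 1 p q x N = \sum_(0 <= m < N) \sum_(0 <= n < N) f m n
    - \sum_(0 <= m < N) f m 0%N - (\sum_(0 <= n < N) f 0%N n - x ^+ 2).
  have -> : quarter_sum 1 p q x N = \sum_(0 <= m < N) \sum_(0 <= n < N) f (m + 1)%N (n + 1)%N by [].
  pose g m := \sum_(0 <= n < N) f m n - f m 0%N.
  rewrite (eq_bigr (fun m => g (m + 1)%N)) => [|m _]; last first.
    by rewrite (@sum_shift1 (f (m + 1)%N))// (fN _).2.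
  rewrite sum_shift1; last first.
    by rewrite /g big1 ?(fN _).1 ?subr0// => n _; rewrite (fN _).1.
  by rewrite /g sumrB f00.
lra.
Qed.

End quarter_sums.

(** * Almost periodicity *)

Section almost_periodicity.
Variable R : realType.

(** A real form of uniform approximation by trigonometric polynomials; the positive frequencies are
    what makes the mean value 0. *)
Definition trig_approx (g : R -> R) (r c s : nat -> nat -> R) : Prop :=
  (forall k l, 0 < r k l) /\
  forall eps : R, 0 < eps -> exists K, forall x,
    `|g x - sqsum (fun k l => c k l * cos (r k l * x) + s k l * sin (r k l * x)) K| <= eps.

Lemma trig_polyD (P Q : R -> R[i]) : trig_poly P -> trig_poly Q ->
  trig_poly (fun x => P x + Q x).
Proof.
move=> [n [c [f HP]]] [m [d [e HQ]]].
exists (n + m)%N, (fun i => match fintype.split i with inl j => c j | inr j => d j end),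
  (fun i => match fintype.split i with inl j => f j | inr j => e j end) => x.
rewrite HP HQ big_split_ord/=; congr (_ + _); apply: eq_bigr => i _.
  by rewrite -[lshift m i]/(unsplit (inl i)) unsplitK.
by rewrite -[rshift n i]/(unsplit (inr i)) unsplitK.
Qed.

Lemma trig_poly0 : trig_poly (fun _ : R => 0).
Proof. by exists 0%N, (fun=> 0), (fun=> 0) => x; rewrite big_ord0. Qed.

Lemma trig_poly_sum (I : Type) (t : seq I) (P : I -> R -> R[i]) :
  (forall i, trig_poly (P i)) -> trig_poly (fun x => \sum_(i <- t) P i x).
Proof.
move=> H; elim: t => [|i t IH].
  by under eq_fun do rewrite big_nil; exact: trig_poly0.
by under eq_fun do rewrite big_cons; exact: trig_polyD.
Qed.

Lemma trig_poly_cos_sin (r c s : R) :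
  trig_poly (fun x => (c * cos (r * x) + s * sin (r * x))%:C%C).
Proof.
(* Euler's formulas: the coefficients of the frequencies [r] and [- r] are [(c - i s) / 2] and
   [(c + i s) / 2]. *)
exists 2%N, (fun i => if i == 0 :> nat then Complex (c / 2) (- s / 2) else Complex (c / 2) (s / 2)),
  (fun i => if i == 0 :> nat then r else - r) => x.
rewrite big_ord_recl big_ord1 /= /expi !mulNr cosN sinN /real_complex_def.
by apply/eqP; rewrite eq_complex /=; apply/andP; split; apply/eqP; field.
Qed.

Lemma trig_approx_almost_periodic g r c s : trig_approx g r c s -> almost_periodic g.
Proof.
move=> [r0 H] eps e0; have e2 : 0 < eps / 2 by rewrite divr_gt0.
have [K HK] := H _ e2.
pose P x := sqsum (fun k l => c k l * cos (r k l * x) + s k l * sin (r k l * x)) K.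
exists (fun x => (P x)%:C%C); split.
  rewrite (_ : (fun x => _) = fun x => \sum_(0 <= k < K) \sum_(0 <= l < K)
     (c k l * cos (r k l * x) + s k l * sin (r k l * x))%:C%C).
    by apply: trig_poly_sum => k; apply: trig_poly_sum => l; exact: trig_poly_cos_sin.
  apply/funext => x; rewrite /P /sqsum rmorph_sum/=.
  by apply: eq_bigr => k _; rewrite rmorph_sum.
move=> x; rewrite -rmorphB/= normc_def/= expr0n/= addr0 sqrtr_sqr ltcR.
by rewrite (le_lt_trans (HK x))// ltr_pdivrMr// ltr_pMr// ltr1n.
Qed.

Lemma trig_approx_continuous g r c s : trig_approx g r c s -> continuous g.
Proof.
move=> [r0 H]; apply: uniform_limit_ct => eps /H[K HK].
exists (fun x => sqsum (fun k l => c k l * cos (r k l * x) + s k l * sin (r k l * x)) K) => //.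
by apply: ct_sum => k; apply: ct_sum => l; ct.
Qed.

(** The bound is independent of [L], so it disappears in the mean. *)
Lemma RI_trig_le (r c s L : R) : 0 < r -> 0 < L ->
  `|RI 0 L (fun x => c * cos (r * x) + s * sin (r * x))| <= (`|c| + 2 * `|s|) / r.
Proof.
move=> r0 L0.
have cf : {within `[0, L], continuous (fun x : R => c * cos (r * x) + s * sin (r * x))} by cw.
have D (x : R) : 0 <= x <= L -> is_derive x 1 (fun x => (c * sin (r * x) - s * cos (r * x)) * r^-1)
    (c * cos (r * x) + s * sin (r * x)).
  by move=> _; dvr; field; rewrite gt_eqF.
rewrite (RI_FTCc L0 cf D) mulr0 sin0 cos0 mulr0 sub0r mulr1 -mulrBl.
apply: normM_le; last by rewrite ger0_norm// invr_ge0 ltW.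
rewrite opprK -addrA (le_trans (ler_normD _ _))//; apply: lerD.
  by rewrite normrM ler_piMr// sin_max.
rewrite (le_trans (ler_normD _ _))// normrN normrM mulr_natl mulr2n lerD2r.
by rewrite ler_piMr// cos_max.
Qed.

Lemma trig_approx_mean_value g r c s : trig_approx g r c s -> has_mean_value g 0.
Proof.
move=> ap; have cg := trig_approx_continuous ap; case: ap => [r0 H].
apply/cvgrPdist_le => eps e0 /=.
have e2 : 0 < eps / 2 by rewrite divr_gt0.
have [K HK] := H _ e2.
pose t k l x := c k l * cos (r k l * x) + s k l * sin (r k l * x).
pose P x := sqsum (fun k l => t k l x) K.
have ctt k l : continuous (t k l) by rewrite /t; ct.
have cP : continuous P by apply: ct_sum => k; apply: ct_sum => l.
pose B := sqsum (fun k l => (`|c k l| + 2 * `|s k l|) / r k l) K.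
have B0 : 0 <= B.
  apply: sumr_ge0 => k _; apply: sumr_ge0 => l _; apply: mulr_ge0; last by rewrite invr_ge0 ltW.
  by rewrite addr_ge0// mulr_ge0.
near=> L.
have L0 : 0 < L by near: L; apply: nbhs_pinfty_gt; rewrite num_real.
have LB : B / (eps / 2) <= L by near: L; apply: nbhs_pinfty_ge; rewrite num_real.
rewrite sub0r normrN -/(RI 0 L g).
have -> : RI 0 L g = RI 0 L (fun x => g x - P x) + RI 0 L P.
  by rewrite -RID; [|cw|cw]; apply: eq_RI => x _; rewrite subrK.
have h1 : `|RI 0 L (fun x => g x - P x)| <= eps / 2 * L.
  have := @RI_bound _ 0 L (fun x => g x - P x) (eps / 2) (ltW L0).
  by rewrite subr0; apply; [cw|move=> x _; exact: HK].
have h2 : `|RI 0 L P| <= B.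
  rewrite /P /sqsum RI_sum; last by move=> k; apply: continuousW; apply: ct_sum.
  apply: (le_trans (ler_norm_sum _ _ _)); apply: ler_sum => k _.
  rewrite RI_sum; last by move=> l; cw.
  apply: (le_trans (ler_norm_sum _ _ _)); apply: ler_sum => l _.
  exact: RI_trig_le.
rewrite normrM ger0_norm ?invr_ge0 ?(ltW L0)// mulrC ler_pdivrMr//.
rewrite (le_trans (ler_normD _ _))//.
move: LB; rewrite ler_pdivrMr//; lra.
Unshelve. all: by end_near.
Qed.

End almost_periodicity.

(** * Averages of the counting function *)

Section averages.
Variable R : realType.
Notation mu := (@lebesgue_measure R).

(** Lets both families of modes be indexed from 0, although Dirichlet frequencies start at 1. *)
Definition bc_shift (bc : boundary_condition) : nat :=
  match bc with Neumann => 0 | Dirichlet => 1 end.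

Definition rect_eigenvalue (bc : boundary_condition) (a b : R) (m n : nat) : R :=
  (pi / a * (m + bc_shift bc)%:R) ^+ 2 + (pi / b * (n + bc_shift bc)%:R) ^+ 2.

Lemma RI_step (l t : R) : 0 <= l -> 0 <= t ->
  mu.-integrable `[0, t] (EFin \o (fun s : R => (l <= s)%R%:R : R)) /\
  RI 0 t (fun s => (l <= s)%R%:R) = pos (t - l).
Proof.
move=> l0 t0.
have E : (fun s : R => (l <= s)%R%:R : R) = \1_(`[l, +oo[).
  by apply/funext => s; rewrite indicE; congr (nat_of_bool _)%:R; apply/idP/idP; rewrite inE/= in_itv/= andbT.
split.
  apply: (@le_integrable _ _ _ _ _ _ _ (EFin \o (fun=> 1))) => //.
  - by rewrite E; apply/measurable_EFinP.
  - by move=> s _; rewrite /= lee_fin normr1 ger0_norm// lern1 leq_b1.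
  - by apply: within_itv_integrable; cw.
rewrite E /RI /Rintegral integral_indic//=.
have [lt|tl] := leP l t.
  have -> : `[l, +oo[ `&` `[0, t] = `[l, t]%classic.
    apply/seteqP; split => s /=; rewrite !in_itv/= ?andbT.
      by move=> [-> /andP[_ ->]].
    by move=> /andP[ls ->]; rewrite ls (le_trans l0).
  rewrite lebesgue_measure_itv/= lte_fin pos_id ?subr_ge0//.
  by case: ltP => //= tl; apply/eqP; rewrite eq_sym subr_eq0 eq_le lt tl.
have -> : `[l, +oo[ `&` `[0, t] = set0.
  apply/seteqP; split => s //=; rewrite !in_itv/= andbT => -[ls /andP[_ st]].
  by have := le_trans ls st; rewrite leNgt tl.
by rewrite measure0 pos_le0// subr_le0 ltW.
Qed.

(** Step functions are not continuous, so integrability has to be carried along with the value of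
    the integral. *)
Lemma RI_step_sum (l : nat -> nat -> R) (t : R) (N : nat) :
  (forall m n, 0 <= l m n) -> 0 <= t ->
  let f s := \sum_(0 <= m < N) \sum_(0 <= n < N) (l m n <= s)%R%:R in
  mu.-integrable `[0, t] (EFin \o f) /\
  RI 0 t f = \sum_(0 <= m < N) \sum_(0 <= n < N) pos (t - l m n).
Proof.
move=> l0 t0 f.
have S (F : nat -> R -> R) (v : nat -> R) K :
    (forall m, mu.-integrable `[0, t] (EFin \o F m) /\ RI 0 t (F m) = v m) ->
    mu.-integrable `[0, t] (EFin \o (fun s => \sum_(0 <= m < K) F m s)) /\
    RI 0 t (fun s => \sum_(0 <= m < K) F m s) = \sum_(0 <= m < K) v m.
  move=> H; elim: K => [|K [IH1 IH2]].
    have -> : (fun s => \sum_(0 <= m < 0) F m s) = fun=> 0 by apply/funext => s; rewrite big_nil.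
    by rewrite big_nil RI0; split => //; apply: within_itv_integrable; cw.
  have -> : (fun s => \sum_(0 <= m < K.+1) F m s) = fun s => \sum_(0 <= m < K) F m s + F K s.
    by apply/funext => s; rewrite big_nat_recr.
  have [H1 H2] := H K; split.
    have -> : EFin \o (fun s => \sum_(0 <= m < K) F m s + F K s) =
      (EFin \o (fun s => \sum_(0 <= m < K) F m s)) \+ (EFin \o F K)%E by [].
    exact: integrableD.
  by rewrite big_nat_recr//= -IH2 -H2 /RI RintegralD.
apply: (S (fun m s => \sum_(0 <= n < N) (l m n <= s)%R%:R)
  (fun m => \sum_(0 <= n < N) pos (t - l m n))) => m.
by apply: (S (fun n s => (l m n <= s)%R%:R) (fun n => pos (t - l m n))) => n; exact: RI_step.
Qed.

Definition signed_perimeter (bc : boundary_condition) (a b : R) : R :=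
  match bc with Neumann => 2 * a + 2 * b | Dirichlet => - (2 * a + 2 * b) end.

Lemma refined_asymptoticsE bc (a b t : R) : refined_asymptotics bc a b t =
  a * b / (4 * pi) * t + signed_perimeter bc a b / (4 * pi) * Num.sqrt t + 4^-1.
Proof. by case: bc => //=; rewrite mulNr mulNr. Qed.

Lemma ct_refined bc (a b : R) : continuous (refined_asymptotics bc a b).
Proof.
have cs := @ct_sqrt R.
rewrite (_ : refined_asymptotics bc a b = fun t => a * b / (4 * pi) * t +
  signed_perimeter bc a b / (4 * pi) * Num.sqrt t + 4^-1); first ct.
by apply/funext => t; exact: refined_asymptoticsE.
Qed.

Lemma RI_refined bc (a b t : R) : 0 < t ->
  RI 0 t (refined_asymptotics bc a b) =
  a * b / (8 * pi) * Num.sqrt t ^+ 4 + signed_perimeter bc a b / (6 * pi) * Num.sqrt t ^+ 3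
  + Num.sqrt t ^+ 2 / 4.
Proof.
move=> t0; have cs := @ct_sqrt R; have pi0 := pi_gt0 R.
have sq s : 0 <= s -> Num.sqrt s ^+ 2 = s :> R by move=> s0; rewrite sqr_sqrtr.
pose F s := a * b / (8 * pi) * s ^+ 2 + signed_perimeter bc a b / (6 * pi) * (s * Num.sqrt s) + s / 4.
have D s : 0 < s < t -> is_derive s 1 F (refined_asymptotics bc a b s).
  move=> /andP[s0 _]; have D := is_derive1_sqrt s0.
  have rs : Num.sqrt s != 0 by rewrite gt_eqF// sqrtr_gt0.
  rewrite refined_asymptoticsE /F; dvr.
  move: rs (sq s (ltW s0)); set y := Num.sqrt s; clearbody y => rs <-.
  move: (lt0r_neq0 pi0); set P := pi; clearbody P => P0.
  by field; rewrite rs P0.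
rewrite (RI_FTC t0 _ _ D); [|apply: continuousW; exact: ct_refined|rewrite /F; cw].
rewrite /F sqrtr0; move: (sq t (ltW t0)); set y := Num.sqrt t; clearbody y => <-.
move: (lt0r_neq0 pi0); set P := pi; clearbody P => P0.
by field; rewrite P0.
Qed.

Lemma quarter_sum_eigenvalues bc (a b t : R) N : 0 <= t ->
  \sum_(0 <= m < N) \sum_(0 <= n < N) pos (t - rect_eigenvalue bc a b m n) =
  quarter_sum (bc_shift bc) (pi / a) (pi / b) (Num.sqrt t) N.
Proof.
move=> t0; apply: eq_bigr => m _; apply: eq_bigr => n _.
by rewrite sqr_sqrtr// /rect_eigenvalue opprD addrA.
Qed.

Lemma powR_sqr_div (x c d : R) : 0 < x -> d = 2 * c + 2 -> (x ^+ 2) `^ c = x `^ d / x ^+ 2.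
Proof.
move=> x0 ->; rewrite -powR_mulrn ?ltW// -powRrM -[2%:R in X in _ / X]/(2 : R).
by rewrite -powRB ?(gt_eqF x0) ?implybT//; congr (_ `^ _); ring.
Qed.

(** The lattice description of the counting function enters as a hypothesis, which separates the
    analysis from the spectral theory. *)
Lemma average_asymptotics (a b : R) : 0 < a -> 0 < b ->
  (forall bc s N, s < (pi / a * N%:R) ^+ 2 -> s < (pi / b * N%:R) ^+ 2 ->
    (eigenvalue_count bc a b s)%:R =
    \sum_(0 <= m < N) \sum_(0 <= n < N) (rect_eigenvalue bc a b m n <= s)%R%:R :> R) ->
  exists g : R -> R,
    [/\ almost_periodic g, has_mean_value g 0 &
        forall bc : boundary_condition,
          exists2 C : R, 0 < C & \forall t \near +oo,
            `|average_error bc a b t - g (Num.sqrt t) * t `^ (- 4^-1)|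
              <= C * `|t `^ (- 2^-1)|].
Proof.
move=> a0 b0 count; have pi0 := pi_gt0 R.
pose p := pi / a; pose q := pi / b.
have p0 : 0 < p by rewrite divr_gt0.
have q0 : 0 < q by rewrite divr_gt0.
have [g [M [x1 [r [c [d [M0 x10 r0 gap gL]]]]]]] := lattice_asymptotics p0 q0.
have [Mp Mp0 HMp] := axis_asymptotics p0.
have [Mq Mq0 HMq] := axis_asymptotics q0.
(* [k] is the inverse of [p * q], which turns [p * q / 4 * lattice_sum] into a quarter of the
   lattice sum; the final function is therefore [k * g]. *)
pose k := a * b / pi ^+ 2.
have k0 : 0 < k by rewrite divr_gt0 ?mulr_gt0// exprn_gt0.
have kpq : k * (p * q) = 1 by rewrite /k /p /q; move: (lt0r_neq0 pi0);
  set P := pi; clearbody P => P0; field; rewrite P0 !gt_eqF.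
have ap : trig_approx (fun x => k * g x) r (fun m n => k * c m n) (fun m n => k * d m n).
  split => // eps e0; have ek : 0 < eps / k by rewrite divr_gt0.
  have [K HK] := gap _ ek; exists K => x.
  rewrite (eq_sqsum (b := fun m n => k * (c m n * cos (r m n * x) + d m n * sin (r m n * x)))).
    rewrite sqsumZ -mulrBr; have -> : eps = k * (eps / k) by field; rewrite gt_eqF.
    by apply: normM_le => //; rewrite ger0_norm// ltW.
  by move=> m n; ring.
exists (fun x => k * g x); split.
- exact: trig_approx_almost_periodic ap.
- exact: trig_approx_mean_value ap.
move=> bc; pose C := k * M + Mp / 4 + Mq / 4.
have C0 : 0 < C by rewrite /C addr_gt0 ?divr_gt0// addr_gt0 ?divr_gt0// mulr_gt0.
exists C => //; near=> t.
have t1 : 1 <= t by near: t; apply: nbhs_pinfty_ge; rewrite num_real.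
have tx : x1 ^+ 2 <= t by near: t; apply: nbhs_pinfty_ge; rewrite num_real.
have t0 : 0 < t by rewrite (lt_le_trans _ t1).
pose x := Num.sqrt t.
have x0 : 0 < x by rewrite sqrtr_gt0.
have xt : x ^+ 2 = t by rewrite sqr_sqrtr// ltW.
have xge1 : 1 <= x by rewrite -(@ler_pXn2r _ 2) ?nnegrE ?(ltW x0)// xt expr1n.
have xgex : x1 <= x by rewrite -(@ler_pXn2r _ 2) ?nnegrE ?(ltW x0) ?(ltW x10)// xt.
(* The box depends on [t] and covers all lattice points of norm at most [x]. The inequalities are
   strict because [count] asks for strict ones. *)
have [N [N0 xp xq]] : exists N, [/\ (0 < N)%N, x < p * N%:R & x < q * N%:R].
  have H1 := archi_boundP (divr_ge0 (ltW x0) (ltW p0)).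
  have H2 := archi_boundP (divr_ge0 (ltW x0) (ltW q0)).
  pose n1 := Num.bound (x / p); pose n2 := Num.bound (x / q).
  have L1 : n1%:R <= (maxn n1 n2)%:R :> R by rewrite ler_nat leq_maxl.
  have L2 : n2%:R <= (maxn n1 n2)%:R :> R by rewrite ler_nat leq_maxr.
  exists (maxn n1 n2); split.
  - by rewrite -(ltr_nat R) (lt_le_trans _ L1)// (le_lt_trans _ H1)// divr_ge0 ?ltW.
  - by rewrite mulrC -ltr_pdivrMr// (lt_le_trans H1).
  - by rewrite mulrC -ltr_pdivrMr// (lt_le_trans H2).
have sumE s : 0 <= s <= t -> (eigenvalue_count bc a b s)%:R =
    \sum_(0 <= m < N) \sum_(0 <= n < N) (rect_eigenvalue bc a b m n <= s)%R%:R :> R.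
  move=> /andP[s0 st]; apply: count; apply: (le_lt_trans st); rewrite -xt.
    by rewrite ltrXn2r// ?ltW.
  by rewrite ltrXn2r// ?ltW.
have ev0 m n : 0 <= rect_eigenvalue bc a b m n by rewrite addr_ge0// sqr_ge0.
have [int1 RI1] := RI_step_sum N ev0 (ltW t0).
have int2 := within_itv_integrable (continuousW (a := 0) (b := t) (ct_refined (bc := bc) (a := a) (b := b))).
pose Q := quarter_sum (bc_shift bc) p q x N.
pose E := Q - (a * b / (8 * pi) * x ^+ 4 + signed_perimeter bc a b / (6 * pi) * x ^+ 3 + x ^+ 2 / 4).
have avg : average_error bc a b t = t^-1 * E.
  congr (_ * _); rewrite /E /Q /x -quarter_sum_eigenvalues ?(ltW t0)// -RI_refined// -RI1 /RI.
  rewrite -RintegralB//; apply: eq_Rintegral => s; rewrite inE/= in_itv/= => st.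
  by rewrite sumE.
(* The boundary condition survives only as the sign [sg] of the axis remainders: the perimeter term
   cancels their main parts and the constant 1/4 cancels the contribution of the origin. *)
have EE : exists2 sg : R, `|sg| <= 1 & E = k * (p * q / 4 * lattice_sum p q x N - pi * x ^+ 4 / 8) +
    sg * ((axis_sum p x N - 4 / (3 * p) * x ^+ 3) / 4 + (axis_sum q x N - 4 / (3 * q) * x ^+ 3) / 4).
  have kp : k * (p * q / 4 * lattice_sum p q x N - pi * x ^+ 4 / 8) =
     lattice_sum p q x N / 4 - a * b / (8 * pi) * x ^+ 4.
    transitivity ((k * (p * q)) * lattice_sum p q x N / 4 - k * pi * x ^+ 4 / 8); first by ring.
    rewrite kpq /k; move: (lt0r_neq0 pi0); set P := pi; clearbody P => P0; field; by rewrite P0.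
  have pE : 4 / (3 * p) = 2 * a / (6 * pi) * 4.
    rewrite /p; move: (lt0r_neq0 pi0); set P := pi; clearbody P => P0; field; by rewrite P0 gt_eqF.
  have qE : 4 / (3 * q) = 2 * b / (6 * pi) * 4.
    rewrite /q; move: (lt0r_neq0 pi0); set P := pi; clearbody P => P0; field; by rewrite P0 gt_eqF.
  rewrite kp pE qE /E /Q; case: (bc) => /=.
    exists 1; first by rewrite normr1.
    by have := quarter_sumN p q (ltW x0) N0; lra.
  exists (-1); first by rewrite normrN1.
  by have := quarter_sumD (ltW x0) N0 (ltW xp) (ltW xq); lra.
have pw1 : t `^ (- 4^-1) = x `^ (3 / 2) / t by rewrite -xt; apply: powR_sqr_div => //; field.
have pw2 : t `^ (- 2^-1) = x / t by rewrite -xt -[X in X / _](powRr1 (ltW x0)); apply: powR_sqr_div => //; field.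
(* This absorbs the lattice remainder into the larger order [x] of the axis sums. *)
have xh : x `^ (1 / 2) <= x.
  by rewrite -[leRHS]powRr1 ?(ltW x0)//; apply: ler_powR => //; lra.
rewrite avg -/x pw1 pw2 (ger0_norm (divr_ge0 (ltW x0) (ltW t0))).
have -> : t^-1 * E - k * g x * (x `^ (3 / 2) / t) = (E - k * (x `^ (3 / 2) * g x)) * t^-1 by ring.
rewrite [C * _]mulrA; apply: normM_le; last by rewrite ger0_norm// invr_ge0 ltW.
have [sg sg1 ->] := EE.
rewrite addrAC -mulrBr.
have B1 : `|k * (p * q / 4 * lattice_sum p q x N - pi * x ^+ 4 / 8 - x `^ (3 / 2) * g x)| <= k * (M * x).
  apply: normM_le; first by rewrite ger0_norm// ltW.
  by apply: (le_trans (gL x N xgex (ltW xp) (ltW xq))); rewrite ler_pM2l.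
have B2 : `|sg * ((axis_sum p x N - 4 / (3 * p) * x ^+ 3) / 4 + (axis_sum q x N - 4 / (3 * q) * x ^+ 3) / 4)|
    <= 1 * (Mp * x / 4 + Mq * x / 4).
  apply: normM_le => //; rewrite (le_trans (ler_normD _ _))//; apply: lerD.
    by apply: normM_le; [exact: HMp (ltW x0) (ltW xp)|rewrite ger0_norm].
  by apply: normM_le; [exact: HMq (ltW x0) (ltW xq)|rewrite ger0_norm].
apply: (le_trans (ler_normD _ _)); apply: (le_trans (lerD B1 B2)).
by rewrite /C; lra.
Unshelve. all: by end_near.
Qed.

End averages.

(** * The spectrum of the rectangle *)

Section modes.
Variable R : realType.
Implicit Types (bc : boundary_condition) (h a b x y mu : R) (i j k m n : nat) (f g : R -> R).

Definition mode_freq (bc : boundary_condition) (h : R) (k : nat) : R :=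
  pi / h * (k + bc_shift bc)%:R.

Definition mode (bc : boundary_condition) (h : R) (k : nat) (x : R) : R :=
  match bc with
  | Neumann => cos (mode_freq bc h k * x)
  | Dirichlet => sin (mode_freq bc h k * x)
  end.

Definition dmode (bc : boundary_condition) (h : R) (k : nat) (x : R) : R :=
  match bc with
  | Neumann => - mode_freq bc h k * sin (mode_freq bc h k * x)
  | Dirichlet => mode_freq bc h k * cos (mode_freq bc h k * x)
  end.

Definition end_bc (bc : boundary_condition) (h : R) (f f1 : R -> R) : Prop :=
  match bc with
  | Neumann => f1 0 = 0 /\ f1 h = 0
  | Dirichlet => f 0 = 0 /\ f h = 0
  end.

Lemma ct_mode bc h k : continuous (mode bc h k).
Proof. by rewrite /mode; case: bc; ct. Qed.

Lemma ct_dmode bc h k : continuous (dmode bc h k).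
Proof. by rewrite /dmode; case: bc; ct. Qed.

Lemma dv_mode bc h k (x : R) : is_derive x 1 (mode bc h k) (dmode bc h k x).
Proof. by rewrite /mode /dmode; case: bc; dvr. Qed.

Lemma dv_dmode bc h k (x : R) :
  is_derive x 1 (dmode bc h k) (- mode_freq bc h k ^+ 2 * mode bc h k x).
Proof. by rewrite /mode /dmode; case: bc; dvr. Qed.

Lemma mode_end_bc bc h k : 0 < h -> end_bc bc h (mode bc h k) (dmode bc h k).
Proof.
move=> h0; have E : mode_freq bc h k * h = (k + bc_shift bc)%:R * pi.
  by rewrite /mode_freq mulrAC divfK ?gt_eqF// mulrC.
by case: bc E => E; rewrite /= ?mulr0 E sin_natmulpi ?sin0 ?mulr0.
Qed.

Lemma mode_freq_inj bc h j k : 0 < h -> mode_freq bc h j ^+ 2 = mode_freq bc h k ^+ 2 -> j = k.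
Proof.
move=> h0; have p0 : 0 < pi / h by rewrite divr_gt0 ?pi_gt0.
have f0 i : 0 <= mode_freq bc h i by apply: mulr_ge0; [exact: ltW|].
move/eqP; rewrite eqrXn2// => /eqP /(mulfI (lt0r_neq0 p0)) /eqP.
by rewrite eqr_nat eqn_add2r => /eqP.
Qed.

(** Green's formula in one variable: [f1 * mode - f * dmode] vanishes at both ends, because [f] and
    the mode satisfy the same boundary condition. *)
Lemma RI_mode_green bc h k (f f1 f2 : R -> R) : 0 < h ->
  {within `[0, h], continuous f} -> {within `[0, h], continuous f1} ->
  {within `[0, h], continuous f2} ->
  (forall x, 0 < x < h -> is_derive x 1 f (f1 x)) ->
  (forall x, 0 < x < h -> is_derive x 1 f1 (f2 x)) -> end_bc bc h f f1 ->
  RI 0 h (fun x => f2 x * mode bc h k x) =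
  - mode_freq bc h k ^+ 2 * RI 0 h (fun x => f x * mode bc h k x).
Proof.
move=> h0 cf cf1 cf2 d1 d2 fbc; set w := - _ ^+ 2.
have cm := continuousW (a := 0) (b := h) (@ct_mode bc h k).
have cd := continuousW (a := 0) (b := h) (@ct_dmode bc h k).
have cfm : {within `[0, h], continuous (fun x => f x * mode bc h k x)} by exact: ct_M cf cm.
have cwfm : {within `[0, h], continuous (fun x => w * (f x * mode bc h k x))}.
  exact: ct_M (@ct_cst R (subspace `[0, h]) w) cfm.
have cf2m : {within `[0, h], continuous (fun x => f2 x * mode bc h k x)} by exact: ct_M cf2 cm.
apply/eqP; rewrite -subr_eq0 -RIZ// -RIB//.
pose F x := f1 x * mode bc h k x - f x * dmode bc h k x.
have cG := ct_D cf2m (ct_N cwfm).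
have cF : {within `[0, h], continuous F} := ct_D (ct_M cf1 cm) (ct_N (ct_M cf cd)).
have dF x : 0 < x < h -> is_derive x 1 F (f2 x * mode bc h k x - w * (f x * mode bc h k x)).
  move=> x0h; have D1 := d1 x x0h; have D2 := d2 x x0h.
  apply: (dv_eq (dv_D (dv_M D2 (dv_mode bc h k x)) (dv_N (dv_M D1 (dv_dmode bc h k x))))).
  by rewrite -/w; clearbody w; ring.
rewrite (RI_FTC h0 cG cF dF).
by move: (mode_end_bc bc k h0) fbc; rewrite /F; case: (bc) => -[-> ->] [-> ->];
  rewrite ?mul0r ?mulr0 !subr0.
Qed.

Lemma mode_complete bc (h : R) (f : R -> R) : 0 < h -> continuous f ->
  (forall k, RI 0 h (fun x => f x * mode bc h k x) = 0) ->
  forall x, 0 <= x <= h -> f x = 0.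
Proof.
move=> h0 cf; case: bc => H; [apply: cosine_complete|apply: sine_complete] => // k;
  rewrite -[RHS](H k); congr RI; apply/funext => x; congr (_ * _); rewrite /= /mode_freq.
  by congr cos; rewrite /= addn0; field; rewrite gt_eqF.
by congr sin; rewrite /= addn1; field; rewrite gt_eqF.
Qed.

(** Green's formula for two modes: their squared frequencies differ, so the inner product must
    vanish. *)
Lemma mode_orthogonal bc h j k : 0 < h -> j != k ->
  RI 0 h (fun x => mode bc h j x * mode bc h k x) = 0.
Proof.
move=> h0 jk.
have c2 i : continuous (fun x => - mode_freq bc h i ^+ 2 * mode bc h i x).
  by apply: ct_M; [exact: ct_cst|exact: ct_mode].
have H i l := RI_mode_green l h0 (continuousW (@ct_mode bc h i))
  (continuousW (@ct_dmode bc h i)) (continuousW (c2 i))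
  (fun x _ => dv_mode bc h i x) (fun x _ => dv_dmode bc h i x) (mode_end_bc bc i h0).
have := H j k; rewrite (_ : (fun x => _ * mode bc h j x * mode bc h k x) =
  fun x => - mode_freq bc h j ^+ 2 * (mode bc h j x * mode bc h k x)); last first.
  by apply/funext => x; rewrite mulrA.
rewrite RIZ; last by apply: continuousW (ct_M _ _); exact: ct_mode.
move/eqP; rewrite !mulNr eqr_opp -subr_eq0 -mulrBl mulf_eq0 subr_eq0 => /orP[|/eqP//].
by move=> /eqP/(mode_freq_inj h0) jkE; rewrite jkE eqxx in jk.
Qed.

(** A mode of norm 0 would be orthogonal to every mode, hence zero by completeness. But a cosine is
    1 at 0, and a sine is 1 at its quarter period [h / (2 * k.+1%:R)]. *)
Lemma mode_norm_neq0 bc h k : 0 < h -> RI 0 h (fun x => mode bc h k x * mode bc h k x) != 0.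
Proof.
move=> h0; apply/negP => /eqP n0.
have m0 : forall x, 0 <= x <= h -> mode bc h k x = 0.
  apply: (@mode_complete bc) => //; first exact: ct_mode.
  move=> j; have [<-//|kj] := eqVneq k j; exact: mode_orthogonal.
case: bc n0 m0 => _ m0.
  have := m0 0; rewrite lexx (ltW h0) => /(_ isT); rewrite /= mulr0 cos0 => /eqP.
  by rewrite oner_eq0.
pose x := h / (2 * k.+1%:R).
have k0 : 0 < k.+1%:R :> R by rewrite ltr0n.
have /m0 : 0 <= x <= h.
  rewrite /x divr_ge0 ?mulr_ge0 ?(ltW h0) ?(ltW k0)//= ler_pdivrMr ?mulr_gt0//.
  by rewrite ler_peMr ?(ltW h0)// -natrM ler1n.
rewrite /= /mode_freq /= addn1 (_ : pi / h * _ * x = pi / 2) ?sin_pihalf.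
  by move/eqP; rewrite oner_eq0.
rewrite /x; move: (pi) => P; field.
by rewrite !gt_eqF.
Qed.

End modes.

(** * Fourier coefficients on the rectangle *)

Section rectangle.
Variable R : realType.
Implicit Types (bc : boundary_condition) (h a b x y mu : R) (i j k m n : nat).
Implicit Types (u : R * R -> R) (f g : R -> R -> R).

(** The projection of the line onto [[0, h]], written with absolute values so that its continuity is
    immediate. *)
Definition clamp h x : R := (h + `|x| - `|x - h|) / 2.

Lemma clamp_id h x : 0 <= x <= h -> clamp h x = x.
Proof.
move=> /andP[x0 xh]; rewrite /clamp ger0_norm// ler0_norm ?subr_le0//; lra.
Qed.

Lemma clamp_bound h x : 0 <= h -> 0 <= clamp h x <= h.
Proof.
move=> h0; have [xh|hx] := leP x h; rewrite /clamp.
  rewrite (ler0_norm (x := x - h)) ?subr_le0//.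
  by have [x0|x0] := ler0P x; apply/andP; split; lra.
by rewrite !gtr0_norm ?subr_gt0// ?(le_lt_trans h0)//; apply/andP; split; lra.
Qed.

Lemma ct_clamp h : continuous (clamp h).
Proof.
have cn := @norm_continuous _ R^o.
rewrite (_ : clamp h = fun x => (h + `|x| + - `|x + - h|) * 2^-1)//.
apply: ct_M; last exact: ct_cst.
apply: ct_D; first by apply: ct_D; [exact: ct_cst|exact: cn].
by apply: ct_N; apply: (@ct_comp _ _ (fun x : R => `|x|) (fun x => x + - h)); [exact: cn|ct].
Qed.

Lemma continuous_within_comp (T U V : topologicalType) (A : set U) (u : U -> V) (g : T -> U) :
  {within A, continuous u} -> continuous g -> (forall z, A (g z)) -> continuous (u \o g).
Proof.
move=> /subspace_continuousP cu cg Ag z; apply: (@cvg_comp _ _ _ g u _ (within A (nbhs (g z)))).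
  move=> P AP; apply: (@filterS _ (nbhs z) _ (g @^-1` [set y | A y -> P y])).
    by move=> t; exact: (fun H => H (Ag t)).
  exact: cg AP.
exact: cu (Ag z).
Qed.

(* Replaces the junk values off the closed rectangle by a continuous extension. *)
Definition clamped a b u : R -> R -> R := fun x y => u (clamp a x, clamp b y).

Lemma ct_clamped a b u : 0 <= a -> 0 <= b -> {within closed_rect a b, continuous u} ->
  continuous (fun p : R * R => clamped a b u p.1 p.2).
Proof.
move=> a0 b0 cu; apply: (continuous_within_comp (g := fun p : R * R => (clamp a p.1, clamp b p.2)) cu).
  apply: continuous_pairT.
    exact: ct_comp (@ct_clamp a) (@ct_fst R).
  exact: ct_comp (@ct_clamp b) (@ct_snd R).
by move=> z; split; exact: clamp_bound.
Qed.

Lemma clampedE a b u x y : 0 <= x <= a -> 0 <= y <= b -> clamped a b u x y = u (x, y).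
Proof. by move=> xa yb; rewrite /clamped !clamp_id. Qed.

Lemma within_xsec a b u y : 0 <= a -> 0 <= y <= b -> {within closed_rect a b, continuous u} ->
  {within `[0, a], continuous (fun x => u (x, y))}.
Proof.
move=> a0 yb cu; have b0 : 0 <= b by case/andP: yb => /le_trans; exact.
apply: (@subspace_eq_continuous _ _ _ (fun x => clamped a b u x y)).
  by move=> x; rewrite inE/= in_itv/= => xa; rewrite /= clampedE.
by apply: continuousW; exact: continuous_ysec (ct_clamped a0 b0 cu).
Qed.

Lemma within_ysec a b u x : 0 <= b -> 0 <= x <= a -> {within closed_rect a b, continuous u} ->
  {within `[0, b], continuous (fun y => u (x, y))}.
Proof.
move=> b0 xa cu; have a0 : 0 <= a by case/andP: xa => /le_trans; exact.
apply: (@subspace_eq_continuous _ _ _ (clamped a b u x)).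
  by move=> y; rewrite inE/= in_itv/= => yb; rewrite /= clampedE.
by apply: continuousW; exact: continuous_xsec (ct_clamped a0 b0 cu).
Qed.

Lemma is_derive_xsec u x y (l : R) :
  is_derive (x, y) ((1, 0) : R * R) u l <-> is_derive x 1 (fun x => u (x, y)) l.
Proof.
have E : (fun h : R => h^-1 *: (u (h *: ((1, 0) : R * R) + (x, y)) - u (x, y))) =
         (fun h : R => h^-1 *: (u (h *: 1 + x, y) - u (x, y))).
  apply/funext => h; congr (_ *: (u _ - _)).
  by transitivity (h *: (1 : R) + x, h *: (0 : R) + y); [by []|rewrite scaler0 add0r].
by split=> -[D <-]; split; move: D; rewrite /derivable /derive E.
Qed.

Lemma is_derive_ysec u x y (l : R) :
  is_derive (x, y) ((0, 1) : R * R) u l <-> is_derive y 1 (fun y => u (x, y)) l.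
Proof.
have E : (fun h : R => h^-1 *: (u (h *: ((0, 1) : R * R) + (x, y)) - u (x, y))) =
         (fun h : R => h^-1 *: (u (x, h *: 1 + y) - u (x, y))).
  apply/funext => h; congr (_ *: (u _ - _)).
  by transitivity (h *: (0 : R) + x, h *: (1 : R) + y); [by []|rewrite scaler0 add0r].
by split=> -[D <-]; split; move: D; rewrite /derivable /derive E.
Qed.

Definition mode_coef bc a b f m n : R :=
  RI 0 a (fun x => RI 0 b (fun y => f x y * mode bc b n y) * mode bc a m x).

Definition ct2 f := continuous (fun p : R * R => f p.1 p.2).

Lemma ct2_mul_mode bc b f n : ct2 f -> ct2 (fun x y => f x y * mode bc b n y).
Proof. by move=> cf; apply: ct_M => //; exact: ct_comp (@ct_mode R bc b n) (@ct_snd R). Qed.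

Lemma ct_ymul_mode bc b f n x : ct2 f -> continuous (fun y => f x y * mode bc b n y).
Proof. by move=> cf; apply: ct_M; [exact: continuous_xsec cf|exact: ct_mode]. Qed.

Lemma ct_RI_mul_mode bc b f n : ct2 f -> continuous (fun x => RI 0 b (fun y => f x y * mode bc b n y)).
Proof.
by move=> cf; apply: (@continuous_RI_param _ (fun x y => f x y * mode bc b n y)); exact: ct2_mul_mode.
Qed.

(** Puts the [x]-integral inside, where Green's formula for the second [x]-derivative applies. *)
Lemma mode_coef_swap bc a b f m n : 0 < a -> 0 < b -> ct2 f ->
  mode_coef bc a b f m n =
  RI 0 b (fun y => RI 0 a (fun x => f x y * mode bc a m x) * mode bc b n y).
Proof.
move=> a0 b0 cf.
have c1 : ct2 (fun x y => mode bc a m x * (f x y * mode bc b n y)).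
  apply: ct_M; last exact: ct2_mul_mode.
  exact: ct_comp (@ct_mode R bc a m) (@ct_fst R).
transitivity (RI 0 a (fun x => RI 0 b (fun y => mode bc a m x * (f x y * mode bc b n y)))).
  apply: eq_RI => x _; rewrite mulrC RIZ//.
  by apply: continuousW; exact: ct_ymul_mode.
rewrite (@RI_Fubini _ (fun x y => mode bc a m x * (f x y * mode bc b n y))) ?ltW//.
apply: eq_RI => y _; rewrite mulrC -RIZ.
  by apply: eq_RI => x _; ring.
apply: continuousW; apply: ct_M; last exact: ct_mode.
exact: continuous_ysec.
Qed.

Lemma eq_on_closure h (f g : R -> R) : 0 < h -> continuous f -> continuous g ->
  (forall x, 0 < x < h -> f x = g x) -> forall x, 0 <= x <= h -> f x = g x.
Proof.
move=> h0 cf cg fg x xh; apply/eqP; rewrite -subr_eq0; apply/eqP; move: x xh.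
apply: continuous_eq0_closure => //; first exact: ct_D cf (ct_N cg).
by move=> x /fg ->; rewrite subrr.
Qed.

(** The differential equation holds only in the open rectangle; continuity extends the equality to
    the sides, one variable at a time. *)
Lemma eq_mode_coef bc a b f g m n : 0 < a -> 0 < b -> ct2 f -> ct2 g ->
  (forall x y, 0 < x < a -> 0 < y < b -> f x y = g x y) ->
  mode_coef bc a b f m n = mode_coef bc a b g m n.
Proof.
move=> a0 b0 cf cg fg.
have E1 x y : 0 < x < a -> 0 <= y <= b -> f x y = g x y.
  move=> xa; move: y; apply: eq_on_closure => //; [exact: continuous_xsec..|].
  by move=> y yb; exact: fg.
have E2 x y : 0 <= y <= b -> 0 <= x <= a -> f x y = g x y.
  move=> yb; move: x; apply: (@eq_on_closure _ (f ^~ y) (g ^~ y)) => //; [exact: continuous_ysec..|].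
  by move=> x xa; exact: E1.
by apply: eq_RI => x xa; congr (_ * _); apply: eq_RI => y yb; congr (_ * _); exact: E2.
Qed.

Lemma mode_coefD bc a b f g m n : ct2 f -> ct2 g ->
  mode_coef bc a b (fun x y => f x y + g x y) m n =
  mode_coef bc a b f m n + mode_coef bc a b g m n.
Proof.
move=> cf cg.
rewrite -RID; [|by apply: continuousW; apply: ct_M; [exact: ct_RI_mul_mode|exact: ct_mode]..].
apply: eq_RI => x _; rewrite -mulrDl; congr (_ * _).
rewrite -RID; first by apply: eq_RI => y _; rewrite mulrDl.
  by apply: continuousW; exact: ct_ymul_mode.
by apply: continuousW; exact: ct_ymul_mode.
Qed.

Lemma mode_coefZ bc a b f (k : R) m n : ct2 f ->
  mode_coef bc a b (fun x y => k * f x y) m n = k * mode_coef bc a b f m n.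
Proof.
move=> cf.
rewrite -RIZ; last first.
  by apply: continuousW; apply: ct_M; [exact: ct_RI_mul_mode|exact: ct_mode].
apply: eq_RI => x _; rewrite mulrA; congr (_ * _); rewrite -RIZ.
  by apply: eq_RI => y _; rewrite mulrA.
by apply: continuousW; exact: ct_ymul_mode.
Qed.

(** Completeness in [x] kills every [y]-coefficient as a function of [x]; completeness in [y] then
    kills [f]. *)
Lemma mode_complete2 bc a b f : 0 < a -> 0 < b -> ct2 f ->
  (forall m n, mode_coef bc a b f m n = 0) ->
  forall x y, 0 <= x <= a -> 0 <= y <= b -> f x y = 0.
Proof.
move=> a0 b0 cf f0 x y xa; move: y; apply: (@mode_complete _ bc) => //.
  exact: continuous_xsec.
move=> n; move: x xa; apply: (@mode_complete _ bc) => //.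
  exact: ct_RI_mul_mode.
by move=> m; exact: f0.
Qed.

Definition mode2 bc a b (p : nat * nat) : R -> R -> R :=
  fun x y => mode bc a p.1 x * mode bc b p.2 y.

Lemma ct_mode2 bc a b p : ct2 (mode2 bc a b p).
Proof.
exact: ct_M (ct_comp (@ct_mode R bc a p.1) (@ct_fst R)) (ct_comp (@ct_mode R bc b p.2) (@ct_snd R)).
Qed.

Lemma mode2_coef bc a b p m n : mode_coef bc a b (mode2 bc a b p) m n =
  RI 0 a (fun x => mode bc a p.1 x * mode bc a m x) *
  RI 0 b (fun y => mode bc b p.2 y * mode bc b n y).
Proof.
rewrite mulrC -RIZ; last by apply: continuousW (ct_M _ _); exact: ct_mode.
apply: eq_RI => x _; rewrite [RHS]mulrA; congr (_ * _).
rewrite [RHS]mulrC -RIZ; first by apply: eq_RI => y _; rewrite mulrA.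
by apply: continuousW (ct_M _ _); exact: ct_mode.
Qed.

Lemma mode2_coef_neq0 bc a b p : 0 < a -> 0 < b ->
  mode_coef bc a b (mode2 bc a b p) p.1 p.2 != 0.
Proof. by move=> a0 b0; rewrite mode2_coef mulf_neq0 ?mode_norm_neq0. Qed.

Lemma mode2_coef_eq0 bc a b p m n : 0 < a -> 0 < b -> p != (m, n) ->
  mode_coef bc a b (mode2 bc a b p) m n = 0.
Proof.
case: p => j k a0 b0; rewrite mode2_coef xpair_eqE negb_and => /orP[] jk.
  by rewrite mode_orthogonal// mul0r.
by rewrite [X in _ * X]mode_orthogonal// mulr0.
Qed.

Lemma rect_eigenvalueE bc a b m n :
  rect_eigenvalue bc a b m n = mode_freq bc a m ^+ 2 + mode_freq bc b n ^+ 2.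
Proof. by []. Qed.

(** Green's formula in each variable multiplies the coefficient by minus a squared frequency.
    Comparison with the equation gives that the coefficient times the difference of the two
    eigenvalues is 0. *)
Lemma eigenfunction_coef bc a b mu u m n : 0 < a -> 0 < b ->
  eigenspace_rect bc a b mu u -> rect_eigenvalue bc a b m n != mu ->
  mode_coef bc a b (clamped a b u) m n = 0.
Proof.
move=> a0 b0 [ux [uy [uxx [uxy [uyx [uyy [Cu Cux Cuy pde ubc]]]]]]] neq.
have [cu cux cuy du] := Cu; have [_ cuxx _ dux] := Cux; have [_ _ cuyy duy] := Cuy.
have C := ct_clamped (ltW a0) (ltW b0).
have cU := C _ cu; have cUxx := C _ cuxx; have cUyy := C _ cuyy.
have ow (h x : R) : 0 < x < h -> 0 <= x <= h by move=> /andP[? ?]; rewrite !ltW.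
have H0 h : 0 < h -> 0 <= (0 : R) <= h by move=> h0; rewrite lexx ltW.
have Hh h : 0 < h -> 0 <= h <= h by move=> h0; rewrite lexx ltW.
have cX f : ct2 f -> continuous (fun y => RI 0 a (fun x => f x y * mode bc a m x)).
  move=> cf; apply: (@continuous_RI_param _ (fun y x => f x y * mode bc a m x)).
  apply: ct_M; last exact: ct_comp (@ct_mode R bc a m) (@ct_snd R).
  exact: (@continuous_comp2 _ _ f _ _ cf (@ct_snd R) (@ct_fst R)).
have X : mode_coef bc a b (clamped a b uxx) m n =
    - mode_freq bc a m ^+ 2 * mode_coef bc a b (clamped a b u) m n.
  rewrite !mode_coef_swap// -RIZ; last by apply: continuousW; apply: ct_M; [exact: cX|exact: ct_mode].
  apply: eq_RI => y yb; rewrite mulrA; congr (_ * _); move: y yb.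
  (* The derivatives are given only for interior [y], so the identity is proved there and extended
     to the sides by continuity. *)
  apply: eq_on_closure => //; first exact: cX.
    by apply: ct_M; [exact: ct_cst|exact: cX].
  move=> y yb; have yb' := ow _ _ yb.
  transitivity (RI 0 a (fun x => uxx (x, y) * mode bc a m x)).
    by apply: eq_RI => x xa; rewrite clampedE.
  transitivity (- mode_freq bc a m ^+ 2 * RI 0 a (fun x => u (x, y) * mode bc a m x)); last first.
    by congr (_ * _); apply: eq_RI => x xa; rewrite clampedE.
  apply: (@RI_mode_green _ _ _ _ _ (fun x => ux (x, y))) => //;
    [exact: within_xsec (ltW a0) yb' _..| | |].
  - by move=> x xa; apply/is_derive_xsec; exact: (du (x, y) (conj xa yb)).1.
  - by move=> x xa; apply/is_derive_xsec; exact: (dux (x, y) (conj xa yb)).1.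
  - case: (bc) ubc => /= H.
      by split; [apply: (H (0, y) (conj (H0 _ a0) yb')).1; left|
                 apply: (H (a, y) (conj (Hh _ a0) yb')).1; right].
    by split; [apply: (H (0, y) (conj (H0 _ a0) yb')); left|
               apply: (H (a, y) (conj (Hh _ a0) yb')); right; left].
have Y : mode_coef bc a b (clamped a b uyy) m n =
    - mode_freq bc b n ^+ 2 * mode_coef bc a b (clamped a b u) m n.
  rewrite /mode_coef -RIZ; last by apply: continuousW; apply: ct_M; [exact: ct_RI_mul_mode|exact: ct_mode].
  apply: eq_RI => x xa; rewrite mulrA; congr (_ * _); move: x xa.
  apply: eq_on_closure => //; first exact: ct_RI_mul_mode.
    by apply: ct_M; [exact: ct_cst|exact: ct_RI_mul_mode].
  move=> x xa; have xa' := ow _ _ xa.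
  transitivity (RI 0 b (fun y => uyy (x, y) * mode bc b n y)).
    by apply: eq_RI => y yb; rewrite clampedE.
  transitivity (- mode_freq bc b n ^+ 2 * RI 0 b (fun y => u (x, y) * mode bc b n y)); last first.
    by congr (_ * _); apply: eq_RI => y yb; rewrite clampedE.
  apply: (@RI_mode_green _ _ _ _ _ (fun y => uy (x, y))) => //;
    [exact: within_ysec (ltW b0) xa' _..| | |].
  - by move=> y yb; apply/is_derive_ysec; exact: (du (x, y) (conj xa yb)).2.
  - by move=> y yb; apply/is_derive_ysec; exact: (duy (x, y) (conj xa yb)).2.
  - case: (bc) ubc => /= H.
      by split; [apply: (H (x, 0) (conj xa' (H0 _ b0))).2; left|
                 apply: (H (x, b) (conj xa' (Hh _ b0))).2; right].
    by split; [apply: (H (x, 0) (conj xa' (H0 _ b0))); right; right; left|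
               apply: (H (x, b) (conj xa' (Hh _ b0))); right; right; right].
have P : mode_coef bc a b (clamped a b uxx) m n + mode_coef bc a b (clamped a b uyy) m n =
    - mu * mode_coef bc a b (clamped a b u) m n.
  rewrite -(mode_coefD bc a b m n cUxx cUyy) -(mode_coefZ bc a b (- mu) m n cU).
  have cL : ct2 (fun x y => clamped a b uxx x y + clamped a b uyy x y) by exact: ct_D cUxx cUyy.
  have cR : ct2 (fun x y => - mu * clamped a b u x y) by apply: ct_M cU; exact: ct_cst.
  apply: (eq_mode_coef bc m n a0 b0 cL cR).
  move=> x y xa yb; rewrite !clampedE; [|exact: ow..].
  by have := pde (x, y) (conj xa yb); rewrite mulNr => <-; rewrite opprK.
move: P; rewrite X Y => /eqP; rewrite -subr_eq0 -mulrDl -mulrBl mulf_eq0 => /orP[|/eqP//].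
rewrite opprK addrC -opprD -rect_eigenvalueE subr_eq0 eq_sym => /eqP E.
by rewrite E eqxx in neq.
Qed.

End rectangle.

(** * Bases of the eigenspaces *)

Section eigenspaces.
Variable R : realType.
Implicit Types (bc : boundary_condition) (h a b x y mu : R) (k m n : nat).
Implicit Types (u : R * R -> R) (f g : R -> R -> R).

Lemma C1_closed_rectM a b (f f1 g g1 : R -> R) :
  continuous f -> continuous f1 -> continuous g -> continuous g1 ->
  (forall x, is_derive x 1 f (f1 x)) -> (forall y, is_derive y 1 g (g1 y)) ->
  C1_closed_rect a b (fun p => f p.1 * g p.2) (fun p => f1 p.1 * g p.2) (fun p => f p.1 * g1 p.2).
Proof.
move=> cf cf1 cg cg1 df dg.
have C (v w : R -> R) : continuous v -> continuous w ->
    {within closed_rect a b, continuous (fun p => v p.1 * w p.2)}.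
  move=> cv cw; apply: continuous_subspaceT.
  exact: ct_M (ct_comp cv (@ct_fst R)) (ct_comp cw (@ct_snd R)).
split; [exact: C..|].
move=> [x y] _; split.
  apply/is_derive_xsec; apply: (dv_eq (dv_M (df x) (dv_cst x (g y)))).
  by rewrite mulr0 addr0.
apply/is_derive_ysec; apply: (dv_eq (dv_M (dv_cst y (f x)) (dg y))).
by rewrite mul0r add0r.
Qed.

Lemma mode2_eigenspace bc a b (q : nat * nat) : 0 < a -> 0 < b ->
  eigenspace_rect bc a b (rect_eigenvalue bc a b q.1 q.2) (fun p => mode2 bc a b q p.1 p.2).
Proof.
move=> a0 b0; case: q => m n /=; rewrite rect_eigenvalueE.
set wm := mode_freq bc a m; set wn := mode_freq bc b n.
have c2 h k : continuous (fun x => - mode_freq bc h k ^+ 2 * mode bc h k x).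
  by apply: ct_M; [exact: ct_cst|exact: ct_mode].
exists (fun p => dmode bc a m p.1 * mode bc b n p.2), (fun p => mode bc a m p.1 * dmode bc b n p.2).
exists (fun p => (- wm ^+ 2 * mode bc a m p.1) * mode bc b n p.2),
  (fun p => dmode bc a m p.1 * dmode bc b n p.2), (fun p => dmode bc a m p.1 * dmode bc b n p.2),
  (fun p => mode bc a m p.1 * (- wn ^+ 2 * mode bc b n p.2)).
have [cm cd] := (@ct_mode R bc, @ct_dmode R bc).
split.
- exact: C1_closed_rectM (cm a m) (cd a m) (cm b n) (cd b n) (dv_mode bc a m) (dv_mode bc b n).
- exact: C1_closed_rectM (cd a m) (c2 a m) (cm b n) (cd b n) (dv_dmode bc a m) (dv_mode bc b n).
- exact: C1_closed_rectM (cm a m) (cd a m) (cd b n) (c2 b n) (dv_mode bc a m) (dv_dmode bc b n).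
- by move=> [x y] _ /=; rewrite /mode2 /=; ring.
have := mode_end_bc bc m a0; have := mode_end_bc bc n b0; rewrite /mode2 {}/wm {}/wn {c2 cm cd}.
case: bc => /= -[n0 nb] [m0 ma] [x y] _ /=.
  by split=> -[->|->]; rewrite ?m0 ?ma ?n0 ?nb ?mul0r ?mulr0.
by move=> [|[|[|]]] ->; rewrite ?m0 ?ma ?n0 ?nb ?mul0r ?mulr0.
Qed.

Lemma mode_coef0 bc a b m n : mode_coef bc a b (fun _ _ => 0) m n = 0 :> R.
Proof.
rewrite -[RHS](RI0 0 a); apply: eq_RI => x _; rewrite -[RHS](mul0r (mode bc a m x)).
by congr (_ * _); rewrite -[RHS](RI0 0 b); apply: eq_RI => y _; rewrite mul0r.
Qed.

Lemma ct2_mode2_sum bc a b (I : Type) (r : seq I) (c : I -> R) (F : I -> nat * nat) :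
  ct2 (fun x y => \sum_(i <- r) c i * mode2 bc a b (F i) x y).
Proof.
elim: r => [|i r IH].
  by rewrite (_ : (fun x y => _) = fun _ _ => 0); [exact: ct_cst|apply/funext => x; apply/funext => y; rewrite big_nil].
rewrite (_ : (fun x y => _) = fun x y =>
    c i * mode2 bc a b (F i) x y + \sum_(i <- r) c i * mode2 bc a b (F i) x y).
  by apply: ct_D IH; apply: ct_M; [exact: ct_cst|exact: ct_mode2].
by apply/funext => x; apply/funext => y; rewrite big_cons.
Qed.

Lemma mode2_sum_coef bc a b (I : Type) (r : seq I) (c : I -> R) (F : I -> nat * nat) m n :
  mode_coef bc a b (fun x y => \sum_(i <- r) c i * mode2 bc a b (F i) x y) m n =
  \sum_(i <- r) c i * mode_coef bc a b (mode2 bc a b (F i)) m n.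
Proof.
elim: r => [|i r IH].
  rewrite big_nil -[RHS](mode_coef0 bc a b m n).
  by apply: eq_RI => x _; congr (_ * _); apply: eq_RI => y _; rewrite big_nil.
have ci : ct2 (fun x y => c i * mode2 bc a b (F i) x y).
  by apply: ct_M; [exact: ct_cst|exact: ct_mode2].
rewrite big_cons -IH -mode_coefZ; last exact: ct_mode2.
rewrite -(mode_coefD bc a b m n ci (@ct2_mode2_sum bc a b _ r c F)).
by apply: eq_RI => x _; congr (_ * _); apply: eq_RI => y _; rewrite big_cons.
Qed.

Lemma mode2_sum_coef_nth bc a b (s : seq (nat * nat)) (c : 'I_(size s) -> R) (j : 'I_(size s)) :
  0 < a -> 0 < b -> uniq s ->
  let p := nth (0, 0)%N s j in
  mode_coef bc a b (fun x y => \sum_(i < size s) c i * mode2 bc a b (nth (0, 0)%N s i) x y) p.1 p.2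
  = c j * mode_coef bc a b (mode2 bc a b p) p.1 p.2.
Proof.
move=> a0 b0 us p; rewrite mode2_sum_coef (bigD1 j)//= big1 ?addr0// => i ij.
rewrite mode2_coef_eq0 ?mulr0// -surjective_pairing /p nth_uniq//.
Qed.

(** The modes with eigenvalue [mu] are independent because mode coefficients separate them, and they
    span because an eigenfunction minus its expansion has no nonzero coefficient. *)
Lemma eigenspace_dim bc a b mu (s : seq (nat * nat)) : 0 < a -> 0 < b -> uniq s ->
  (forall p, (p \in s) = (rect_eigenvalue bc a b p.1 p.2 == mu)) ->
  has_dim_on (closed_rect a b) (eigenspace_rect bc a b mu) (size s).
Proof.
move=> a0 b0 us smu.
pose q (i : 'I_(size s)) := nth (0, 0)%N s i.
have qmu (i : 'I_(size s)) : rect_eigenvalue bc a b (q i).1 (q i).2 = mu by apply/eqP; rewrite -smu mem_nth.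
have N0 (i : 'I_(size s)) : mode_coef bc a b (mode2 bc a b (q i)) (q i).1 (q i).2 != 0 by exact: mode2_coef_neq0.
exists (fun i p => mode2 bc a b (q i) p.1 p.2); split.
- by move=> i; have := mode2_eigenspace bc (q i) a0 b0; rewrite qmu.
- move=> c c0 j; have /= := mode2_sum_coef_nth bc c j a0 b0 us.
  rewrite -/(q j) (@eq_mode_coef _ _ _ _ _ (fun _ _ => 0) _ _ a0 b0 (@ct2_mode2_sum bc a b _ (index_enum 'I_(size s)) c q)).
  - by rewrite mode_coef0 => /esym/eqP; rewrite mulf_eq0 (negPf (N0 j)) orbF => /eqP.
  - exact: ct_cst.
  - move=> x y /andP[x0 xa] /andP[y0 yb]; apply: (c0 (x, y)).
    by split; rewrite !ltW.
move=> u Eu; have [ux [uy [uxx [uxy [uyx [uyy [[cu _ _ _] _ _ _ _]]]]]]] := Eu.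
pose c (i : 'I_(size s)) := mode_coef bc a b (clamped a b u) (q i).1 (q i).2 / mode_coef bc a b (mode2 bc a b (q i)) (q i).1 (q i).2.
exists c => -[x y] [/= xa yb].
(* [w] is minus the expansion of [u]. Outside [s] the coefficients of [u] and of [w] both vanish,
   and on [s] they cancel by the choice of [c]. *)
pose w x y : R := \sum_(i < size s) - c i * mode2 bc a b (q i) x y.
have cw : ct2 w by exact: ct2_mode2_sum.
have cU := ct_clamped (ltW a0) (ltW b0) cu.
suff /eqP : clamped a b u x y + w x y = 0.
  rewrite clampedE// addr_eq0 => /eqP ->; rewrite -sumrN; apply: eq_bigr => i _.
  by rewrite mulNr opprK.
move: x y xa yb; apply: (mode_complete2 (bc := bc) a0 b0); first exact: ct_D cU cw.
move=> m n; rewrite (mode_coefD bc a b m n cU cw).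
have [mn|mn] := eqVneq (rect_eigenvalue bc a b m n) mu; last first.
  rewrite (eigenfunction_coef a0 b0 Eu mn) add0r /w mode2_sum_coef big1// => i _.
  rewrite mode2_coef_eq0 ?mulr0//; apply: contraNneq mn => qi.
  by rewrite -(qmu i) qi.
have mns : (m, n) \in s by rewrite smu /= mn.
have ls : (index (m, n) s < size s)%N by rewrite index_mem.
have := mode2_sum_coef_nth bc (fun i => - c i) (Ordinal ls) a0 b0 us.
rewrite /w /= nth_index//= => ->; rewrite /c /q /= nth_index//= mulNr divfK ?subrr//.
exact: (mode2_coef_neq0 bc (m, n)).
Qed.

End eigenspaces.

(** * Multiplicities and increasing enumerations *)

Lemma has_dim_on_uniq (R : realType) (T : Type) (D : set T) (E : set (T -> R)) (d1 d2 : nat) :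
  has_dim_on D E d1 -> has_dim_on D E d2 -> d1 = d2.
Proof.
have le (k l : nat) : has_dim_on D E k -> has_dim_on D E l -> (k <= l)%N.
  move=> [e [Ee efree _]] [f [_ _ fspan]].
  have /boolp.choice[A AE] : forall i, exists c : 'I_l -> R,
      forall p, D p -> e i p = \sum_(j < l) c j * f j p by move=> i; exact: fspan.
  pose M := \matrix_(i < k, j < l) A i j.
  have Mfree : row_free M.
    apply: inj_row_free => v vM; apply/rowP => i; rewrite mxE.
    apply: (efree (fun i => v 0 i)) => p Dp.
    under eq_bigr do rewrite AE// mulr_sumr.
    rewrite exchange_big big1//= => j _.
    under eq_bigr do rewrite mulrA.
    rewrite -mulr_suml (_ : \sum_(_ < k) _ = (v *m M) 0 j); first by rewrite vM mxE mul0r.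
    by rewrite mxE; apply: eq_bigr => m _; rewrite mxE.
  by rewrite -(eqP Mfree) rank_leq_col.
by move=> H1 H2; apply/eqP; rewrite eqn_leq !le.
Qed.

Lemma card_eq_seq (T : choiceType) (s : seq T) : uniq s -> ([set` s] #= `I_(size s))%card.
Proof.
move=> us; rewrite (_ : [set` s] = [set` [fset x in s]%fset]).
  by apply/card_eq_fsetP; rewrite card_fseq undup_id.
by apply/seteqP; split=> x; rewrite /= inE.
Qed.

Lemma card_seq_size (T : choiceType) (s : seq T) (A : set T) d : uniq s ->
  (forall x, (x \in s) <-> A x) -> (A #= `I_d)%card -> size s = d.
Proof.
move=> us sA; have -> : A = [set` s] by apply/seteqP; split=> x; rewrite /= sA.
move=> sd; apply/(@card_eq_II (size s) d); apply: card_eq_trans sd.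
exact/card_esym/card_eq_seq.
Qed.

Lemma seq_argmin (R : realType) (T : eqType) (l : T -> R) (s : seq T) x : x \in s ->
  exists2 y, y \in s & forall z, z \in s -> l y <= l z.
Proof.
elim: s x => // y [|z s] IH x _.
  by exists y; rewrite ?mem_head// => w; rewrite inE => /eqP ->.
have [w ws wmin] := IH z (mem_head _ _).
have [yw|wy] := leP (l y) (l w).
  exists y; first exact: mem_head.
  move=> v; rewrite inE => /predU1P[->//|/wmin]; exact: le_trans.
exists w; first by rewrite inE ws orbT.
by move=> v; rewrite inE => /predU1P[->|/wmin//]; exact: ltW.
Qed.

Section enumeration.
Variables (R : realType) (T : choiceType) (l : T -> R).
Hypothesis lfin : forall t, finite_set [set p | l p <= t].
Hypothesis fresh : forall s : seq T, exists x, x \notin s.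

Lemma sublevel_seq t : exists2 s : seq T, uniq s & forall p, (p \in s) = (l p <= t).
Proof.
have /finite_seqP[s sE] := lfin t; exists (undup s); first exact: undup_uniq.
by move=> p; rewrite mem_undup; move/seteqP: sE => [H1 H2]; apply/idP/idP; [exact: H2|exact: H1].
Qed.

Lemma level_seq t : exists2 s : seq T, uniq s & forall p, (p \in s) = (l p == t).
Proof.
have [s us sE] := sublevel_seq t; exists [seq p <- s | l p == t]; first exact: filter_uniq.
by move=> p; rewrite mem_filter sE; case: eqP => //= ->; rewrite lexx.
Qed.

(** Greedy choice: each step takes an element of least value among those not yet listed. It exists
    because [fresh] supplies a candidate and only finitely many elements lie below it. *)
Lemma monotone_enumeration : exists2 e : nat -> T,
  injective e /\ (forall x, exists n, e n = x) & nondecreasing_seq (l \o e).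
Proof.
have /boolp.choice[next nextP] : forall s : seq T, exists x,
    x \notin s /\ forall y, y \notin s -> l x <= l y.
  move=> s; have [x xs] := fresh s; have [r _ rE] := sublevel_seq (l x).
  have xr : x \in [seq y <- r | y \notin s] by rewrite mem_filter xs rE lexx.
  have [y yr ymin] := seq_argmin l xr; exists y.
  move: yr; rewrite mem_filter => /andP[ys]; rewrite rE => yx; split => // z zs.
  have [xz|zx] := leP (l x) (l z); first exact: le_trans xz.
  by apply: ymin; rewrite mem_filter zs rE ltW.
(* [L n] holds the first [n] chosen elements, latest first. *)
pose L := fix L n := if n is n.+1 then next (L n) :: L n else [::].
pose e n := next (L n).
have eL j n : (j < n)%N -> e j \in L n.
  elim: n => // n IH; rewrite ltnS leq_eqVlt => /predU1P[->|/IH jn]; rewrite inE ?eqxx//.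
  by rewrite jn orbT.
have Le n x : x \in L n -> exists j, e j = x.
  by elim: n => // n IH; rewrite inE => /predU1P[->|//]; exists n.
have einj : injective e.
  have H j n : (j < n)%N -> e j <> e n.
    by move=> /eL jn E; have [/negP] := nextP (L n); rewrite -/(e n) -E.
  by move=> j n E; case: (ltngtP j n) => // /H; rewrite E.
have emono : nondecreasing_seq (l \o e).
  apply/nondecreasing_seqP => n /=; apply: (nextP (L n)).2.
  by have [+ _] := nextP (L n.+1); rewrite inE negb_or => /andP[].
exists e; last exact: emono.
split; [exact: einj|move=> x; apply: contrapT => nx].
have ex n : l (e n) <= l x.
  by apply: (nextP (L n)).2; apply/negP => /Le[j jx]; apply: nx; exists j.
(* An omitted [x] would confine all the values of the injective [e] to a finite sublevel set. *)
have [r _ rE] := sublevel_seq (l x).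
have /(uniq_leq_size _) : {subset map e (iota 0 (size r).+1) <= r}.
  by move=> y /mapP[j _ ->]; rewrite rE.
by rewrite map_inj_uniq// iota_uniq size_map size_iota ltnn => /(_ isT).
Qed.

End enumeration.

Section equidistribution.
Variable R : realType.

Lemma count_mem_sublevel (T : choiceType) (l : T -> R) (s : seq T) (t mu : R) d :
  uniq s -> (forall p, (p \in s) = (l p <= t)) -> mu <= t ->
  ([set p | l p = mu] #= `I_d)%card -> count_mem mu (map l s) = d.
Proof.
move=> us sE mut ld; rewrite count_map -size_filter; apply: card_seq_size ld.
  exact: filter_uniq.
by move=> p; rewrite mem_filter sE; split => [/andP[/eqP]//|/= ->]; rewrite eqxx.
Qed.

(** Equal multiplicities of every value make the two lists of values up to [t] permutations of each
    other, so [lam] need not be matched with an enumeration of [T]. *)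
Lemma card_sublevel (T : choiceType) (lam : nat -> R) (l : T -> R) (s : seq T) (t : R) :
  lam n @[n --> \oo] --> +oo -> uniq s -> (forall p, (p \in s) = (l p <= t)) ->
  (forall mu, exists2 d, ([set j | lam j = mu] #= `I_d)%card & ([set p | l p = mu] #= `I_d)%card) ->
  #|` fset_set [set j | lam j <= t]| = size s.
Proof.
move=> loo us sE ldim.
have [N _ HN] := (cvgryPgt lam).1 loo t.
pose J := [seq j <- iota 0 N | lam j <= t].
have uJ : uniq J by rewrite filter_uniq ?iota_uniq.
have JE j : (j \in J) = (lam j <= t).
  rewrite mem_filter mem_iota add0n /=; case: leP => //= jt.
  by rewrite ltnNge; apply/negP => /HN; rewrite ltNge jt.
have -> : size s = size J.
  rewrite -(size_map l) -(size_map lam); apply/perm_size/allP => mu _; apply/eqP => /=.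
  have [mut|tmu] := leP mu t.
    have [d d1 d2] := ldim mu.
    by rewrite (count_mem_sublevel us sE mut d2) (count_mem_sublevel uJ JE mut d1).
  have [-> ->] : count_mem mu (map l s) = 0%N /\ count_mem mu (map lam J) = 0%N => //.
  split; apply/count_memPn/mapP => -[p + E]; rewrite ?sE ?JE -E leNgt tmu//.
apply: card_fset_set; rewrite (_ : [set j | lam j <= t] = [set` J]); first exact: card_eq_seq.
by apply/seteqP; split=> j; rewrite /= JE.
Qed.

End equidistribution.

(** * The counting function as a lattice point count *)

Section spectrum.
Variable R : realType.
Implicit Types (bc : boundary_condition) (a b t mu : R).

Lemma rect_eigenvalue_box bc a b t N m n : 0 < a -> 0 < b ->
  t < (pi / a * N%:R) ^+ 2 -> t < (pi / b * N%:R) ^+ 2 ->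
  rect_eigenvalue bc a b m n <= t -> (m < N)%N && (n < N)%N.
Proof.
move=> a0 b0 ta tb; have pi0 := pi_gt0 R.
have mono (h : R) (k : nat) : 0 < h -> (N <= k)%N -> (pi / h * N%:R) ^+ 2 <= (pi / h * (k + bc_shift bc)%:R) ^+ 2.
  move=> h0 Nk; have ph : 0 < pi / h by rewrite divr_gt0.
  have P (i : nat) : 0 <= pi / h * i%:R by apply: mulr_ge0 => //; exact: ltW.
  rewrite lerXn2r ?nnegrE//.
  by rewrite ler_pM2l// ler_nat (leq_trans Nk)// leq_addr.
rewrite /rect_eigenvalue => le; apply/andP; split; rewrite ltnNge; apply/negP => /mono.
  move=> /(_ _ a0); have := sqr_ge0 (pi / b * (n + bc_shift bc)%:R); lra.
move=> /(_ _ b0); have := sqr_ge0 (pi / a * (m + bc_shift bc)%:R); lra.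
Qed.

Lemma rect_eigenvalue_finite bc a b t : 0 < a -> 0 < b ->
  finite_set [set p : nat * nat | rect_eigenvalue bc a b p.1 p.2 <= t].
Proof.
move=> a0 b0; have pi0 := pi_gt0 R.
have [N [ta tb]] : exists N : nat, t < (pi / a * N%:R) ^+ 2 /\ t < (pi / b * N%:R) ^+ 2.
  have ex (h : R) : 0 < h -> exists N : nat, forall k, (N <= k)%N -> t < (pi / h * k%:R) ^+ 2.
    move=> h0; have ph : 0 < pi / h by rewrite divr_gt0.
    have x0 : 0 <= 1 + `|t| by rewrite addr_ge0.
    have H := archi_boundP (divr_ge0 x0 (ltW ph)).
    exists (Num.bound ((1 + `|t|) / (pi / h))) => k Nk.
    have xk : 1 + `|t| < pi / h * k%:R.
      by rewrite mulrC -ltr_pdivrMr// (lt_le_trans H)// ler_nat.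
    have := ler_norm t; have := normr_ge0 t; nra.
  have [N1 H1] := ex a a0; have [N2 H2] := ex b b0.
  by exists (maxn N1 N2); rewrite H1 ?leq_maxl// H2 ?leq_maxr.
apply: (@sub_finite_set _ _ (`I_N `*` `I_N)); last exact: finite_setX.
by move=> [m n] /= /(rect_eigenvalue_box a0 b0 ta tb)/andP[].
Qed.

(** Shows that [xget] does not fall back on its default: the eigenvalues of the modes, listed in
    increasing order, form an admissible sequence. *)
Lemma is_spectrum_spectrum bc a b : 0 < a -> 0 < b -> is_spectrum bc a b (spectrum bc a b).
Proof.
move=> a0 b0; apply: xgetPex.
pose l (p : nat * nat) := rect_eigenvalue bc a b p.1 p.2.
have lfin t : finite_set [set p | l p <= t] := rect_eigenvalue_finite bc t a0 b0.
have fresh (s : seq (nat * nat)) : exists x, x \notin s.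
  exists ((\max_(p <- s) p.1).+1, 0%N); apply/negP => H.
  by have := @leq_bigmax_seq _ s xpredT (fun p => p.1) _ H isT; rewrite /= ltnn.
have [e [einj esurj] emono] := @monotone_enumeration R _ l lfin fresh.
have /boolp.choice[e' e'K] := esurj.
exists (l \o e); split => //.
- apply/cvgryPgt => A; have [r ru rE] := sublevel_seq lfin A.
  exists (size r) => // n /= rn; rewrite ltNge; apply/negP => nA.
  have /(uniq_leq_size _) : {subset map e (iota 0 n.+1) <= r}.
    move=> p /mapP[j]; rewrite mem_iota add0n /= ltnS => jn ->; rewrite rE.
    exact: le_trans (emono _ _ jn) nA.
  rewrite map_inj_uniq// iota_uniq size_map size_iota => /(_ isT).
  by rewrite ltnNge rn.
move=> mu; have [s us sE] := level_seq lfin mu.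
exists (size s); split; first exact: eigenspace_dim.
rewrite -(size_map e') (_ : [set j | _] = [set` map e' s]).
  by apply: card_eq_seq; rewrite map_inj_uniq//; exact: can_inj e'K.
apply/seteqP; split=> j /=.
  by move=> jmu; apply/mapP; exists (e j); [rewrite sE jmu|apply: einj; rewrite e'K].
by move=> /mapP[p]; rewrite sE => /eqP pmu ->; rewrite e'K.
Qed.

(** The box of side [N] contains every pair with eigenvalue at most [t]. Uniqueness of the dimension
    identifies the multiplicity of a value in [spectrum] with its number of modes. *)
Lemma eigenvalue_count_lattice bc a b t N : 0 < a -> 0 < b ->
  t < (pi / a * N%:R) ^+ 2 -> t < (pi / b * N%:R) ^+ 2 ->
  (eigenvalue_count bc a b t)%:R =
  \sum_(0 <= m < N) \sum_(0 <= n < N) (rect_eigenvalue bc a b m n <= t)%R%:R :> R.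
Proof.
move=> a0 b0 ta tb.
have [_ loo ldim] := is_spectrum_spectrum bc a0 b0.
pose l (p : nat * nat) := rect_eigenvalue bc a b p.1 p.2.
have lfin s : finite_set [set p | l p <= s] := rect_eigenvalue_finite bc s a0 b0.
pose box := [seq (m, n) | m <- iota 0 N, n <- iota 0 N].
pose s := [seq p <- box | l p <= t].
have us : uniq s.
  by rewrite filter_uniq// allpairs_uniq ?iota_uniq// => -[x1 x2] [y1 y2] _ _ /= [-> ->].
have sE p : (p \in s) = (l p <= t).
  rewrite mem_filter; apply/andP/idP => [[]//|pt]; split => //.
  case: p pt => m n /(rect_eigenvalue_box a0 b0 ta tb) /andP[mN nN].
  by apply/allpairsP; exists (m, n); rewrite !mem_iota.
rewrite /eigenvalue_count (card_sublevel loo us sE).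
  rewrite size_filter -sum1_count big_mkcond/= big_allpairs natr_sum.
  rewrite /index_iota subn0; apply: eq_bigr => m _; rewrite natr_sum; apply: eq_bigr => n _.
  by rewrite -/(l (m, n)); case: (_ <= _).
move=> mu; have [d [Edim ld]] := ldim mu; exists d => //.
have [r ur rE] := level_seq lfin mu.
rewrite (has_dim_on_uniq Edim (eigenspace_dim a0 b0 ur rE)).
rewrite (_ : [set p | _] = [set` r]); first exact: card_eq_seq.
by apply/seteqP; split=> p; rewrite /= rE => /eqP.
Qed.

End spectrum.

Unset Implicit Arguments.

Theorem theorem2p2 (R : realType) (a b : R) (ha : 0 < a) (hb : 0 < b) :
  exists g : R -> R,
    [/\ almost_periodic g, has_mean_value g 0 &
        forall bc : boundary_condition,
          exists2 C : R, 0 < C & \forall t \near +oo,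
            `|average_error bc a b t - g (Num.sqrt t) * t `^ (- 4^-1)|
              <= C * `|t `^ (- 2^-1)|].
Proof.
apply: (average_asymptotics ha hb) => bc s N.
exact: eigenvalue_count_lattice ha hb.
Qed.
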